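(* Consider the Liénard dynamical system $$x_t=y,\qquad y_t=-(3x^2+\alpha)y+(3x^4+2x^3-ex^2-\sigma x-\delta),$$ with parameters $\alpha,e,\sigma,\delta\in\mathbb{C}$. Its irreducible invariant algebraic curves are exactly the following (each existing under the indicated conditions on the parameters, and with the indicated cofactor $\lambda$): (1) $F=y-x^2+\frac13(\alpha+e)$, $\lambda=-3x^2-2x-\alpha$, when $\delta=\frac{\alpha(e+\alpha)}{3}$, $\sigma=\frac{2(e+\alpha)}{3}$. (2) $F=y+x^3+\frac32x^2+\left(\alpha-\frac52\right)x+\frac{5\alpha}{6}-\frac{\sigma}{3}-\frac{25}{12}$, $\lambda=3x-\frac52$, when $\delta=\frac{25\alpha}{12}-\frac{5\sigma}{6}-\frac{125}{24}$, $e=\frac{45}{4}-3\alpha$. (3) $F=y^2+\left(x^3+\frac12x^2-\frac{37}{4}x+\frac{35}{8}\right)y-x^5-\frac32x^4+\frac{35}{2}x^3+\frac{37}{4}x^2-\frac{1365}{16}x+\frac{1225}{32}$, $\lambda=-3x^2+x+\frac{17}{4}$, when $\alpha=-\frac{27}{4}$, $e=\frac{63}{2}$, $\delta=-\frac{595}{16}$, $\sigma=-\frac92$. (4) $F=y^2+\left(x^3+\frac12x^2+\frac{11}{4}x+\frac{51}{8}\right)y-x^5-\frac32x^4-\frac52x^3-\frac{35}{4}x^2-\frac{69}{16}x+\frac{153}{32}$, $\lambda=-3x^2+x-\frac{31}{4}$, when $\alpha=\frac{21}{4}$, $e=-\frac92$, $\delta=\frac{93}{16}$, $\sigma=-\frac{17}{2}$.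 (5) $F=y^2+\left(x^3+\frac12x^2-\frac{95}{12}x+\frac{1505}{216}\right)y-x^5-\frac32x^4+\frac{275}{18}x^3+\frac{335}{108}x^2-\frac{31175}{432}x+\frac{508475}{7776}$, $\lambda=-3x^2+x+\frac{35}{12}$, when $\alpha=-\frac{65}{12}$, $e=\frac{55}{2}$, $\delta=-\frac{11825}{432}$, $\sigma=-\frac{185}{18}$. (6) $F=y^3+\left(2x^3+2x^2-\frac12x+\frac{35}{2}\right)y^2+\left(x^6+x^5-\frac54x^4+\frac{39}{2}x^3+\frac{103}{16}x^2-\frac{335}{16}x+\frac{7325}{64}\right)y-x^8-3x^7+\frac12x^6-\frac{63}{4}x^5-47x^4+\frac{519}{16}x^3-\frac{2065}{32}x^2-\frac{16325}{64}x+\frac{36625}{256}$, $\lambda=-3x^2+4x-\frac{29}{4}$, when $\alpha=\frac94$, $e=\frac92$, $\delta=\frac{145}{16}$, $\sigma=-\frac{39}{2}$. (7) $F=y^2+\left(x^3+\frac12x^2+\left\{\alpha-\frac52\right\}x+\frac56\left\{5-\frac{1}{27}\alpha\right\}\right)y-x^5-\frac32x^4+\frac{5}{12}\{15-4\alpha\}x^3+\left\{\frac{35}{24}-\frac{187}{162}\alpha\right\}x^2+\left\{\frac{11327}{14580}\alpha-\frac{353}{108}\right\}x+\frac{131545}{34992}-\frac{93553}{472392}\alpha$, $\lambda=-3x^2+x-\alpha-\frac52$, when $\alpha^2-\frac{4975}{486}\alpha+\frac{4225}{144}=0$, $e=\frac{45}{4}-3\alpha$, $\delta=\frac{5101\alpha}{14580}+\frac{193}{54}$,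 $\sigma=\frac{\alpha}{9}-\frac{15}{4}$.
   Context: A polynomial $F\in\mathbb{C}[x,y]\setminus\mathbb{C}$ is an invariant algebraic curve of a system $x_t=P(x,y)$, $y_t=Q(x,y)$ with $P,Q\in\mathbb{C}[x,y]$ if $PF_x+QF_y=\lambda F$ for some $\lambda\in\mathbb{C}[x,y]$, called the cofactor. It is irreducible if $F$ is irreducible in $\mathbb{C}[x,y]$. $F$ and $cF$ with $c\in\mathbb{C}\setminus\{0\}$ are identified. *)

(* Defs.v *)
From HB Require Import structures.
From mathcomp Require Import all_boot all_order all_algebra.
From mathcomp Require Import reals.
From mathcomp Require Export complex.

Set Implicit Arguments.
Unset Strict Implicit.
Unset Printing Implicit Defensive.

Import GRing.Theory.
Local Open Scope ring_scope.

(* K[x,y] is {poly {poly K}} = K[x][y]: the outer indeterminate is y and the   *)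
(* indeterminate of the coefficients is x, so a(x) is embedded as a%:P and a   *)
(* constant c as c%:P%:P.                                                      *)

Definition dx (K : fieldType) (F : {poly {poly K}}) : {poly {poly K}} :=
  map_poly (@deriv K) F.

Definition dy (K : fieldType) (F : {poly {poly K}}) : {poly {poly K}} := F^`().

(* irreducible_poly is not used: on {poly {poly K}} it ignores factors in      *)
(* K[x], i.e. it is irreducibility over K(x).                                  *)
Definition irreducible_elt (A : idomainType) (a : A) : Prop :=
  [/\ a != 0, a \isn't a GRing.unit &
      forall b c : A, a = b * c -> b \is a GRing.unit \/ c \is a GRing.unit].

Definition is_cofactor (K : fieldType) (P Q F lam : {poly {poly K}}) : Prop :=
  P * dx F + Q * dy F = lam * F.

Definition invariant_curve (K : fieldType) (P Q F : {poly {poly K}}) : Prop :=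
  ~ (exists c : K, F = c%:P%:P) /\ exists lam, is_cofactor P Q F lam.

(* A numeral of ring_scope is a unary nat, so the constants above 5000 are     *)
(* written a * 1000 + b.                                                       *)

Definition lienardP (K : fieldType) : {poly {poly K}} := 'X.

Definition lienardQ (K : fieldType) (alpha e sigma delta : K) :
    {poly {poly K}} :=
  let x : {poly K} := 'X in
  let y : {poly {poly K}} := 'X in
  - (3 *: x ^+ 2 + alpha%:P)%:P * y
  + (3 *: x ^+ 4 + 2 *: x ^+ 3 - e *: x ^+ 2 - sigma *: x - delta%:P)%:P.

Definition F1 (K : fieldType) (alpha e : K) : {poly {poly K}} :=
  let x : {poly K} := 'X in
  let y : {poly {poly K}} := 'X in
  y - (x ^+ 2)%:P + ((1 / 3) * (alpha + e))%:P%:P.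

Definition lam1 (K : fieldType) (alpha : K) : {poly {poly K}} :=
  let x : {poly K} := 'X in
  (- (3 *: x ^+ 2) - 2 *: x - alpha%:P)%:P.

Definition F2 (K : fieldType) (alpha sigma : K) : {poly {poly K}} :=
  let x : {poly K} := 'X in
  let y : {poly {poly K}} := 'X in
  y + (x ^+ 3 + (3 / 2) *: x ^+ 2 + (alpha - 5 / 2) *: x
       + (5 * alpha / 6 - sigma / 3 - 25 / 12)%:P)%:P.

Definition lam2 (K : fieldType) : {poly {poly K}} :=
  let x : {poly K} := 'X in
  (3 *: x - (5 / 2)%:P)%:P.

Definition F3 (K : fieldType) : {poly {poly K}} :=
  let x : {poly K} := 'X in
  let y : {poly {poly K}} := 'X in
  y ^+ 2
  + (x ^+ 3 + (1 / 2) *: x ^+ 2 - (37 / 4) *: x + (35 / 8)%:P)%:P * y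
  + (- x ^+ 5 - (3 / 2) *: x ^+ 4 + (35 / 2) *: x ^+ 3 + (37 / 4) *: x ^+ 2
     - (1365 / 16) *: x + (1225 / 32)%:P)%:P.

Definition lam3 (K : fieldType) : {poly {poly K}} :=
  let x : {poly K} := 'X in
  (- (3 *: x ^+ 2) + x + (17 / 4)%:P)%:P.

Definition F4 (K : fieldType) : {poly {poly K}} :=
  let x : {poly K} := 'X in
  let y : {poly {poly K}} := 'X in
  y ^+ 2
  + (x ^+ 3 + (1 / 2) *: x ^+ 2 + (11 / 4) *: x + (51 / 8)%:P)%:P * y
  + (- x ^+ 5 - (3 / 2) *: x ^+ 4 - (5 / 2) *: x ^+ 3 - (35 / 4) *: x ^+ 2
     - (69 / 16) *: x + (153 / 32)%:P)%:P.

Definition lam4 (K : fieldType) : {poly {poly K}} :=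
  let x : {poly K} := 'X in
  (- (3 *: x ^+ 2) + x - (31 / 4)%:P)%:P.

Definition F5 (K : fieldType) : {poly {poly K}} :=
  let x : {poly K} := 'X in
  let y : {poly {poly K}} := 'X in
  y ^+ 2
  + (x ^+ 3 + (1 / 2) *: x ^+ 2 - (95 / 12) *: x + (1505 / 216)%:P)%:P * y
  + (- x ^+ 5 - (3 / 2) *: x ^+ 4 + (275 / 18) *: x ^+ 3
     + (335 / 108) *: x ^+ 2 - ((31 * 1000 + 175) / 432) *: x
     + ((508 * 1000 + 475) / (7 * 1000 + 776))%:P)%:P.

Definition lam5 (K : fieldType) : {poly {poly K}} :=
  let x : {poly K} := 'X in
  (- (3 *: x ^+ 2) + x + (35 / 12)%:P)%:P.

Definition F6 (K : fieldType) : {poly {poly K}} :=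
  let x : {poly K} := 'X in
  let y : {poly {poly K}} := 'X in
  y ^+ 3
  + (2 *: x ^+ 3 + 2 *: x ^+ 2 - (1 / 2) *: x + (35 / 2)%:P)%:P * y ^+ 2
  + (x ^+ 6 + x ^+ 5 - (5 / 4) *: x ^+ 4 + (39 / 2) *: x ^+ 3
     + (103 / 16) *: x ^+ 2 - (335 / 16) *: x
     + ((7 * 1000 + 325) / 64)%:P)%:P * y
  + (- x ^+ 8 - 3 *: x ^+ 7 + (1 / 2) *: x ^+ 6 - (63 / 4) *: x ^+ 5
     - 47 *: x ^+ 4 + (519 / 16) *: x ^+ 3 - (2065 / 32) *: x ^+ 2
     - ((16 * 1000 + 325) / 64) *: x + ((36 * 1000 + 625) / 256)%:P)%:P.

Definition lam6 (K : fieldType) : {poly {poly K}} :=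
  let x : {poly K} := 'X in
  (- (3 *: x ^+ 2) + 4 *: x - (29 / 4)%:P)%:P.

Definition F7 (K : fieldType) (alpha : K) : {poly {poly K}} :=
  let x : {poly K} := 'X in
  let y : {poly {poly K}} := 'X in
  y ^+ 2
  + (x ^+ 3 + (1 / 2) *: x ^+ 2 + (alpha - 5 / 2) *: x
     + (5 / 6 * (5 - 1 / 27 * alpha))%:P)%:P * y
  + (- x ^+ 5 - (3 / 2) *: x ^+ 4 + (5 / 12 * (15 - 4 * alpha)) *: x ^+ 3
     + (35 / 24 - 187 / 162 * alpha) *: x ^+ 2
     + ((11 * 1000 + 327) / (14 * 1000 + 580) * alpha - 353 / 108) *: x
     + ((131 * 1000 + 545) / (34 * 1000 + 992)
        - (93 * 1000 + 553) / (472 * 1000 + 392) * alpha)%:P)%:P.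

Definition lam7 (K : fieldType) (alpha : K) : {poly {poly K}} :=
  let x : {poly K} := 'X in
  (- (3 *: x ^+ 2) + x - (alpha + 5 / 2)%:P)%:P.

(* lienard_list alpha e sigma delta F lam: F is one of the listed curves, lam  *)
(* is its listed cofactor and the parameters satisfy its conditions.           *)
Variant lienard_list (K : fieldType) (alpha e sigma delta : K) :
    {poly {poly K}} -> {poly {poly K}} -> Prop :=
| Curve1 of delta = alpha * (e + alpha) / 3 & sigma = 2 * (e + alpha) / 3 :
    lienard_list alpha e sigma delta (F1 alpha e) (lam1 alpha)
| Curve2 of delta = 25 * alpha / 12 - 5 * sigma / 6 - 125 / 24
          & e = 45 / 4 - 3 * alpha :
    lienard_list alpha e sigma delta (F2 alpha sigma) (lam2 K)
| Curve3 of alpha = - (27 / 4) & e = 63 / 2 & delta = - (595 / 16)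
          & sigma = - (9 / 2) :
    lienard_list alpha e sigma delta (F3 K) (lam3 K)
| Curve4 of alpha = 21 / 4 & e = - (9 / 2) & delta = 93 / 16
          & sigma = - (17 / 2) :
    lienard_list alpha e sigma delta (F4 K) (lam4 K)
| Curve5 of alpha = - (65 / 12) & e = 55 / 2
          & delta = - ((11 * 1000 + 825) / 432) & sigma = - (185 / 18) :
    lienard_list alpha e sigma delta (F5 K) (lam5 K)
| Curve6 of alpha = 9 / 4 & e = 9 / 2 & delta = 145 / 16
          & sigma = - (39 / 2) :
    lienard_list alpha e sigma delta (F6 K) (lam6 K)
| Curve7 of alpha ^+ 2 - 4975 / 486 * alpha + 4225 / 144 = 0
          & e = 45 / 4 - 3 * alpha
          & delta = (5 * 1000 + 101) * alpha / (14 * 1000 + 580) + 193 / 54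
          & sigma = alpha / 9 - 15 / 4 :
    lienard_list alpha e sigma delta (F7 alpha) (lam7 alpha).

(* Main.v *)
Require Import Defs.
From HB Require Import structures.
From Stdlib Require Import ZArith QArith_base Qreduction.
From mathcomp Require Import all_boot all_order all_algebra.
From mathcomp Require Import reals complex.
From mathcomp Require Import zify ssrZ ring.

Set Implicit Arguments.
Unset Strict Implicit.
Unset Printing Implicit Defensive.
Import Order.TTheory GRing.Theory Num.Theory.
Local Open Scope ring_scope.

Record rops := Rops {
  car :> Type;
  rcst : Q -> car;
  radd : car -> car -> car;
  rmul : car -> car -> car;
  rnull : car -> bool }.
Arguments rcst {r}.
Arguments radd {r}.
Arguments rmul {r}.
Arguments rnull {r}.

Delimit Scope Z_scope with bz.
Definition q0 : Q := Qmake Z0 1.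
Definition q1 : Q := Qmake (Zpos 1) 1.
Definition qm1 : Q := Qmake (Zneg 1) 1.

Definition cst (R : rops) (z : Z) (d : positive) : R := rcst (Qmake z d).
Arguments cst {R} z%_bz d%_positive.

Definition rsub (R : rops) (x y : R) := radd x (rmul (rcst qm1) y).

Section Pol.
Variable R : rops.

Fixpoint padd (p q : seq R) : seq R :=
  match p, q with
  | [::], _ => q
  | _, [::] => p
  | a :: p', b :: q' => radd a b :: padd p' q'
  end.

Definition pscale (c : R) (p : seq R) : seq R := map (rmul c) p.

Fixpoint pmul (p q : seq R) : seq R :=
  if p is a :: p' then padd (pscale a q) (rcst q0 :: pmul p' q) else [::].

Canonical pol : rops :=
  @Rops (seq R) (fun c => [:: rcst c]) padd pmul (all rnull).
End Pol.
Arguments padd {R}.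
Arguments pscale {R}.
Arguments pmul {R}.

Canonical qops : rops :=
  @Rops Q id (fun x y => Qred (Qplus x y)) (fun x y => Qred (Qmult x y))
        (fun x => Qeq_bool x q0).

Definition T1 := pol qops.
Definition T2 := pol T1.
Definition T3 := pol T2.

(* ---- level recursion *)
Section Levels.
Variable (R : rops).
Local Notation "x [+] y" := (radd x y) (at level 50, left associativity).
Local Notation "x [*] y" := (rmul x y) (at level 40, left associativity).

Record level := Level { lA : R; lB : R; lC : R; pA : R; pB : R; pC : R; pD : R }.

Variables (a b r rN : R).
Definition level0 : level :=
  Level (cst 1 1) (cst 5 2) a (cst 0 1) (cst 0 1) (cst 0 1) (cst (-1) 1).

Definition level_rr (j : Z) : R := rN [+] cst (1 - j) 1 [*] r.

Definition level_D (j : Z) (L : level) : R :=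
  cst 1 3 [*] ((a [+] cst (-5 - 5 * j) 2) [*] lB L
     [+] cst (6 * j - 1) 2 [*] lC L [+] cst 3 1 [*] b [*] lA L
     [+] cst (-1) 1 [*] level_rr j [*] pB L).

Definition level_A (j : Z) (L : level) : R :=
  cst (-1) (Z.to_pos (9 * (j + 1))%bz) [*] (cst (-2) 1 [*] b [*] lB L
     [+] cst (5 * (j + 1)) 2 [*] lC L [+] cst (2 - 3 * j) 1 [*] level_D j L
     [+] level_rr j [*] pC L).

Definition level_step (j : Z) (L : level) : level * R :=
  let A' := level_A j L in
  let D := level_D j L [+] cst (-1) 1 [*] A' in
  let B' := cst (5 + 6 * (j + 1)) 2 [*] A' in
  let C' := (a [+] cst (9 * (j + 1) * (j + 1) + 8 * (j + 1)) 2) [*] A'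
     [+] cst (-1) 2 [*] level_rr (j + 1)%bz [*] lA L in
  (Level A' B' C' (lA L) (lB L) (lC L) D,
   C' [+] cst (-1) 1 [*] b [*] lC L [+] level_rr j [*] pD L
      [+] (a [+] cst (5 * (j + 1)) 2) [*] D).

Fixpoint level_eqs (n : nat) (j : Z) (L : level) : seq R :=
  if n is n'.+1 then
    let LE := level_step j L in LE.2 :: level_eqs n' (j + 1)%bz LE.1
  else [::].
End Levels.

(* a, s, R as T3 *)
Definition vs : T3 := [:: [:: [:: q0; q1]]].
Definition va : T3 := [:: [:: [::]; [:: q1]]].
Definition vR : T3 := [:: [::]; [:: [:: q1]]].
Definition b_of (R : rops) (s a rN : R) : R :=
  radd (rmul (cst 3 1) (rmul s rN)) (radd (rmul (cst 23 18) a) (cst (-25) 18)).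
Definition r_of (R : rops) (s a rN : R) : R :=
  radd (rmul (cst 2 3) (rmul a a)) (radd (rmul (cst 25 9) a)
   (radd (rmul (cst 27 2) (rmul s rN)) (radd (rmul (cst (-3) 2) rN) (cst (-625) 72)))).

Definition eqs : seq T3 := level_eqs va (b_of vs va vR) (r_of vs va vR) vR 5 Z0 (level0 va).


(* ---- elimination functions *)
Section Elim.
Variable R : rops.
Definition rpow (x : R) (n : nat) : R := iter n (rmul x) (rcst q1).

Fixpoint psubst (num den : R) (p : seq R) : R :=
  if p is c :: p' then
    radd (rmul c (rpow den (size p'))) (rmul num (psubst num den p'))
  else rcst q0.

Fixpoint prem (n : nat) (lc : R) (cs row : seq R) : seq R :=
  if n is n'.+1 then
    if row is t :: row' then
      if (size row' < size cs)%N then row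
      else prem n' lc cs (padd (pscale lc row') (pscale (rmul (rcst qm1) t) cs))
    else row
  else row.

Fixpoint ptrim (p : seq R) : seq R :=
  if p is c :: p' then
    let t := ptrim p' in if nilp t && rnull c then [::] else c :: t
  else [::].
End Elim.

(* quotient of univariate polynomials over Q, highest coefficients first *)
Fixpoint qquot_rec (n : nat) (li : qops) (cs p : seq qops) : seq qops :=
  if n is n'.+1 then
    if p is t :: p' then
      if (size p' < size cs)%N then [::]
      else let c := rmul t li in
        c :: qquot_rec n' li cs (padd p' (pscale (rmul (rcst qm1) c) cs))
    else [::]
  else [::].

Definition qquot (f p : T1) : T1 :=
  if rev f is l :: cs then rev (qquot_rec (size p) (Qinv l) cs (rev p)) else [::].

Definition qcontent (cs : seq Q) : Q :=
  let l := foldr (fun c acc => Z.lcm (Zpos (Qden c)) acc) 1%bz cs in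
  let g := foldr (fun c acc => Z.gcd (Qnum (Qred (Qmult (Qmake l 1) c))) acc) 0%bz cs in
  Qred (Qdiv (Qmake l 1) (Qmake g 1)).

Definition pnorm (row : seq T1) : seq T1 :=
  let k := qcontent (flatten (row : seq (seq Q))) in
  if Qeq_bool k q0 then row else map (fun c : T1 => (ptrim (pscale (k : qops) c) : T1)) row.

Definition pstrip1 (f : T1) (row : seq T1) : seq T1 :=
  let q := map (qquot f) row in
  if all (fun cd : T1 * T1 => rnull (rsub cd.1 (rmul f cd.2))) (zip row q)
     && ~~ all rnull row
  then q else row.

Definition pstrip (fs : seq (T1 * nat)) (row : seq T1) : seq T1 :=
  foldl (fun row f => iter f.2 (pstrip1 f.1) row) (pnorm row) fs.

Definition det2 (R : rops) (u v : seq R) (i j : nat) : R :=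
  let z : R := rcst q0 in
  rsub (rmul (nth z u i) (nth z v j)) (rmul (nth z u j) (nth z v i)).

Definition det4 (R : rops) (a b c d : seq R) : R :=
  let m i j := det2 a b i j in let m' i j := det2 c d i j in
  radd (rsub (radd (rmul (m 0%N 1%N) (m' 2%N 3%N)) (rmul (m 0%N 3%N) (m' 1%N 2%N)))
             (rmul (m 0%N 2%N) (m' 1%N 3%N)))
       (rsub (radd (rmul (m 1%N 2%N) (m' 0%N 3%N)) (rmul (m 2%N 3%N) (m' 0%N 1%N)))
             (rmul (m 1%N 3%N) (m' 0%N 2%N))).

Fixpoint zadd (p q : seq Z) : seq Z :=
  match p, q with
  | [::], _ => q
  | _, [::] => p
  | a :: p', b :: q' => (a + b)%bz :: zadd p' q'
  end.

Fixpoint zmul (p q : seq Z) : seq Z :=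
  if p is a :: p' then zadd [seq (a * b)%bz | b <- q] (Z0 :: zmul p' q) else [::].

(* ---- univariate polynomials at rational points *)
Definition pmod (R : rops) (n : nat) (p row : seq R) : seq R :=
  if p is lc :: cs then prem n lc cs row else [::].

Definition qhorner (c : Q) (p : T1) : Q := foldr (fun d acc => radd d (rmul c acc)) q0 p.
Definition pat (c : Q) (p : seq T1) : T1 := map (qhorner c) p.

Definition dropz (R : rops) (p : seq R) : seq R := drop (find (predC rnull) p) p.
Definition qmonic (p : T1) : T1 :=
  if dropz p is lc :: cs then pscale (Qinv lc : qops) (lc :: cs) else [::].
Fixpoint peucl (n : nat) (p q : T1) : T1 :=
  if n is n'.+1 then
    if qmonic q is lc :: cs then peucl n' (lc :: cs) (prem 20 lc cs p)
    else p
  else p.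
Definition ugcd (p q : T1) : T1 := rev (qmonic (peucl 20 (rev p) (rev q))).
Definition det3 (R : rops) (u v w : seq R) (i j k : nat) : R :=
  let n x l : R := nth (rcst q0) x l in
  radd (rsub (rmul (n u i) (det2 v w j k)) (rmul (n u j) (det2 v w i k)))
       (rmul (n u k) (det2 v w i j)).

Definition qconst (p : T1) : bool := if p is c :: p' then ~~ Qeq_bool c q0 && all rnull p' else false.
Definition qeqp (p q : T1) : bool := rnull (rsub p q).

(* ---- the computation *)
Definition lin (c d : Z) : T1 := [:: Qmake c 1; Qmake d 1].
Arguments lin c%_bz d%_bz.
Definition f0 := lin 0 1.
Definition f17 := lin 1 17.
Definition f5m := lin 1 5.
Definition f5 := lin (-1) 5.
Definition f7 := lin (-1) 7.
Definition f65 := lin (-7) 65.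
Definition f27 : T1 := [:: Qmake 45%bz 1; Qmake (-118)%bz 1; Qmake 2717%bz 1].
Definition f27m : seq qops := [:: Qmake (-118)%bz 2717; Qmake 45%bz 2717].
Definition aff27 : T1 := [:: Qmake 710%bz 243; Qmake (-13585)%bz 972].
Definition E1c0 : T2 := [:: [:: Qmake (-215)%bz 24; Qmake (-3905)%bz 48];
  [:: Qmake 1%bz 6; Qmake 70%bz 3]; [:: q0; Qmake 3%bz 1]].
Definition E1c1 : T2 := [:: [:: q0; Qmake 9%bz 4; Qmake 153%bz 4]].
Definition E1lit : T3 := [:: E1c0; E1c1].

Definition elimR (E : T3) : T2 :=
  rev (pstrip [:: (f0, 2%N); (f17, 2%N)] (rev (ptrim (psubst (rmul (rcst qm1) E1c0) E1c1 E)))).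

Definition reduce (P : T2) (k l : nat) (row : seq T1) : seq T1 :=
  pstrip [:: (f0, k); (f5m, l)] (pmod 10 (rev P) row).

Definition known : seq (T1 * nat) := [:: (f0, 8); (f17, 12); (f5m, 9); (f5, 1); (f7, 2); (f65, 1); (f27, 1)]%N.
Definition strip_known (p : T1) : T1 := head [::] (pstrip known [:: p]).

Definition bezU : seq Z := [:: 10; 5; 9; 9; 7; 10; 5; 5; 0; 7; 3; 10; 7]%bz.
Definition bezV : seq Z := [:: 8; 9; 7; 4; 2; 1; 9; 7; 4; 1; 5; 10; 5; 4; 6]%bz.

Definition coprime11 (X W : seq Q) : bool :=
  let XW := zadd (zmul bezU (map Qnum X)) (zmul bezV (map Qnum W)) in
  [&& all (fun q => Qeq_bool q (Qmake (Qnum q) 1)) (X ++ W), (1 < size X)%N, (1 < size W)%N,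
   [seq (c mod 11)%bz | c <- XW] == 1%bz :: nseq (size XW).-1 Z0,
   ((last Z0 (map Qnum X)) mod 11 != 0)%bz & ((last Z0 (map Qnum W)) mod 11 != 0)%bz].

Definition generic_ok (P3 P4 P5 : T2) : bool :=
  let r0 := reduce P3 9 1 (rev P4) in
  let r1 := reduce P3 1 0 (rcons r0 [::]) in
  let r2 := reduce P3 1 0 (rcons r1 [::]) in
  let r3 := reduce P3 1 0 (rcons r2 [::]) in
  let q := reduce P3 12 1 (rev P5) in
  let m := prem 100 q1 f27m (rev (det3 r0 r1 r2 0 1 2)) in
  let l := prem 100 q1 f27m (rev (det3 r0 r1 r2 0 1 3)) in
  [&& all (fun r : seq T1 => size r == 4%N) [:: r0; r1; r2; r3; q],
      coprime11 (strip_known (det4 r0 r1 r2 r3)) (strip_known (det4 r0 r1 r2 q)),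
      qconst (ugcd (rev m) f27) &
      all rnull (prem 10 q1 f27m (rev (padd (rev l) (pmul (rev m) aff27))))].

Definition gcd3 (c : Q) (P3 P4 P5 : T2) : T1 :=
  ugcd (ugcd (pat c P3) (pat c P4)) (pat c P5).

Definition points_ok (P3 P4 P5 : T2) : bool :=
  [&& qconst (gcd3 (Qmake (-1)%bz 5) P3 P4 P5),
   qeqp (gcd3 (Qmake 1%bz 5) P3 P4 P5) [:: Qmake 1%bz 4; q1],
   qeqp (gcd3 (Qmake 7%bz 65) P3 P4 P5) [:: Qmake 37%bz 4; q1] &
   qeqp (gcd3 (Qmake 1%bz 7) P3 P4 P5) [:: Qmake (-1045)%bz 48; Qmake 31%bz 6; q1]].

Definition special_ok (E2 E3 E4 : T3) : bool :=
  let at0 (E : T3) := pat (Qmake 215%bz 4) (map (pat q0) E) in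
  let at17 (E : T3) : seq T1 := map (pat (Qmake (-1)%bz 17)) E in
  let red E := pmod 10 (rev (map (fun c : T1 => (ptrim c : T1)) (ptrim (at17 E2)))) (rev (at17 E)) in
  [&& qconst (ugcd (at0 E2) (at0 E3)),
   size (red E3) == 2%N, size (red E4) == 2%N &
   qconst (ugcd (pat (Qmake (-1)%bz 17) E1c0) (det2 (red E3) (red E4) 0 1))].

Definition elim_ok (E1 E2 E3 E4 : T3) : bool :=
  let P3 := elimR E2 in let P4 := elimR E3 in let P5 := elimR E4 in
  [&& rnull (rsub E1 E1lit), generic_ok P3 P4 P5, points_ok P3 P4 P5 & special_ok E2 E3 E4].

Definition E_ (i : nat) : T3 := behead (nth [::] eqs i).

Lemma elim_okP : elim_ok (E_ 1) (E_ 2) (E_ 3) (E_ 4).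
Proof. by vm_compute. Qed.


(* ---- semantics *)
Section Semantics.
Variable K : numFieldType.

Definition zk (z : Z) : K := (int_of_Z z)%:~R.
Definition qk (q : Q) : K := zk (Qnum q) / zk (Zpos (Qden q)).

Lemma zkD x y : zk (x + y)%bz = zk x + zk y.
Proof.
have e : int_of_Z (x + y)%bz = int_of_Z x + int_of_Z y by lia.
by rewrite /zk e rmorphD.
Qed.
Lemma zkM x y : zk (x * y)%bz = zk x * zk y.
Proof.
have e : int_of_Z (x * y)%bz = int_of_Z x * int_of_Z y by lia.
by rewrite /zk e rmorphM.
Qed.
Lemma zk_eq0 x : (zk x == 0) = (x == Z0).
Proof. by rewrite /zk intr_eq0; apply/eqP/eqP=> ?; lia. Qed.
Lemma zk_neq0 p : zk (Zpos p) != 0.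
Proof. by rewrite zk_eq0. Qed.

Lemma zkO p : zk (Zpos (xO p)) = 2 * zk (Zpos p).
Proof. by rewrite -[Zpos (xO p)]/(Z.mul (Zpos 2) (Zpos p)) zkM. Qed.
Lemma zkI p : zk (Zpos (xI p)) = 2 * zk (Zpos p) + 1.
Proof. by rewrite -[Zpos (xI p)]/(Z.add (Z.mul (Zpos 2) (Zpos p)) (Zpos 1)) zkD zkM. Qed.
Lemma zkN p : zk (Zneg p) = - zk (Zpos p).
Proof. by rewrite -[Zneg p]/(Z.mul (Zneg 1) (Zpos p)) zkM mulN1r. Qed.
Lemma zk1 : zk (Zpos 1) = 1. Proof. by []. Qed.
Lemma zk0 : zk Z0 = 0. Proof. by []. Qed.
Definition zkE := (zkO, zkI, zkN, zk1, zk0).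

Lemma qk_eq x y : Qeq x y -> qk x = qk y.
Proof.
move=> e; apply/eqP; rewrite /qk eqr_div ?zk_neq0 // -!zkM; apply/eqP; congr zk.
exact: e.
Qed.

Lemma qkD x y : qk (Qred (Qplus x y)) = qk x + qk y.
Proof.
rewrite (qk_eq (Qred_correct _)) /qk /= zkD !zkM addf_div ?zk_neq0 //.
by rewrite -[zk (Zpos (Qden x)) * zk (Zpos (Qden y))]zkM; congr (_ / _); ring.
Qed.

Lemma qkM x y : qk (Qred (Qmult x y)) = qk x * qk y.
Proof. by rewrite (qk_eq (Qred_correct _)) /qk /= mulf_div -!zkM. Qed.

Lemma qk0 : qk q0 = 0. Proof. by rewrite /qk /zk mul0r. Qed.
Lemma qk1 : qk q1 = 1. Proof. by rewrite /qk /zk /= divr1. Qed.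
Lemma qkm1 : qk qm1 = -1. Proof. by rewrite /qk /zk /= divr1. Qed.

Definition kops : rops := @Rops K qk +%R *%R (fun x => x == 0).

Record morph (R : rops) (ev : R -> K) : Prop := Morph {
  evc : forall c, ev (rcst c) = qk c;
  evD : forall x y, ev (radd x y) = ev x + ev y;
  evM : forall x y, ev (rmul x y) = ev x * ev y;
  ev0 : forall x, rnull x -> ev x = 0 }.

Lemma qk_morph : morph (qk : qops -> K).
Proof.
split=> //; [exact: qkD | exact: qkM |].
by move=> x /= /Qeq_bool_eq /qk_eq ->; rewrite qk0.
Qed.

Lemma id_morph : morph (id : kops -> K).
Proof. by split=> // x /eqP. Qed.

Fixpoint pev (R : rops) (ev : R -> K) (x : K) (p : seq R) : K :=
  if p is c :: p' then ev c + x * pev ev x p' else 0.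

Section PolSem.
Variables (R : rops) (ev : R -> K) (x : K).
Hypothesis Hev : morph ev.
Local Notation "[[ p ]]" := (pev ev x p).

Lemma pev_add p q : [[padd p q]] = [[p]] + [[q]].
Proof.
elim: p q => [|a p IH] [|b q] /=; rewrite ?add0r ?addr0 //.
by rewrite (evD Hev) IH; ring.
Qed.

Lemma pev_scale c p : [[pscale c p]] = ev c * [[p]].
Proof. by elim: p => [|a p /= ->]; rewrite /= ?mulr0 // (evM Hev); ring. Qed.

Lemma pev_mul p q : [[pmul p q]] = [[p]] * [[q]].
Proof.
elim: p => [|a p IH] /=; first by rewrite mul0r.
by rewrite pev_add pev_scale /= IH (evc Hev) qk0; ring.
Qed.

Lemma pev_null p : all rnull p -> [[p]] = 0.
Proof. by elim: p => //= a p IH /andP[/(ev0 Hev)-> /IH->]; rewrite mulr0 addr0. Qed.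

Lemma pol_morph : morph (pev ev x : pol R -> K).
Proof.
split; [|exact: pev_add|exact: pev_mul|exact: pev_null].
by move=> c /=; rewrite mulr0 addr0 (evc Hev).
Qed.

Lemma ev_sub a b : ev (rsub a b) = ev a - ev b.
Proof. by rewrite /rsub (evD Hev) (evM Hev) (evc Hev) qkm1 mulN1r. Qed.

Lemma ev_pow c n : ev (rpow c n) = ev c ^+ n.
Proof.
by elim: n => [|n IH]; rewrite /rpow /= ?(evc Hev) ?qk1 // (evM Hev) [ev (iter _ _ _)]IH exprS.
Qed.

Lemma psubstE num den c p : ev den * x = ev num ->
  ev (psubst num den (c :: p)) = ev den ^+ size p * [[c :: p]].
Proof.
move=> e; elim: p c => [|d p IH] c.
  by rewrite /= (evD Hev) !(evM Hev) !(evc Hev) qk0 qk1; ring.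
rewrite [LHS](evD Hev) !(evM Hev) ev_pow IH -e /= exprS; ring.
Qed.

Lemma psubst_root num den p : ev den * x = ev num -> [[p]] = 0 -> ev (psubst num den p) = 0.
Proof.
case: p => [|c p] e p0; first by rewrite /= (evc Hev) qk0.
by rewrite psubstE // p0 mulr0.
Qed.

Lemma ptrimE p : [[ptrim p]] = [[p]].
Proof.
elim: p => //= c p <-; case: (ptrim p) => //=.
by case: ifP => //= /(ev0 Hev)->; rewrite mulr0 addr0.
Qed.

Lemma pev_rcons p c : [[rcons p c]] = [[p]] + ev c * x ^+ size p.
Proof. by elim: p => [|a p IH] /=; rewrite ?IH ?exprS; ring. Qed.

Lemma pev_rev_cons c p : [[rev (c :: p)]] = [[rev p]] + ev c * x ^+ size p.
Proof. by rewrite rev_cons pev_rcons size_rev. Qed.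

Lemma pev_rev_scale c p : [[rev (pscale c p)]] = ev c * [[rev p]].
Proof. by rewrite /pscale -map_rev pev_scale. Qed.

Lemma size_padd (p q : seq R) : (size q <= size p)%N -> size (padd p q) = size p.
Proof. by elim: p q => [|c p IHp] [|d q] //= le; rewrite IHp. Qed.

Lemma pev_rev_add p q : (size q <= size p)%N ->
  [[rev (padd p q)]] = [[rev p]] + [[rev q]] * x ^+ (size p - size q).
Proof.
elim: p q => [|a p IH] [|b q] //=; rewrite ?mul0r ?addr0 ?mul0r //.
rewrite ltnS => le; rewrite !pev_rev_cons size_padd // IH // subSS (evD Hev).
by rewrite -[in x ^+ size p](subnK le) exprD; ring.
Qed.

Lemma prem_root n lc cs row : [[rev (lc :: cs)]] = 0 -> [[rev row]] = 0 ->
  [[rev (prem n lc cs row)]] = 0.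
Proof.
move=> P0; elim: n row => // n IH [|t row] //= r0.
case: ltnP => // le; apply: IH.
have szs : size (pscale (rmul (rcst qm1) t) cs) = size cs by rewrite size_map.
have szr : size (pscale lc row) = size row by rewrite size_map.
rewrite pev_rev_add ?szs ?szr // !pev_rev_scale (evM Hev) (evc Hev) qkm1.
move: P0 r0; rewrite !pev_rev_cons => P0 r0.
have -> : [[rev cs]] = - (ev lc * x ^+ size cs) by apply/eqP; rewrite -addr_eq0 P0.
have -> : [[rev row]] = - (ev t * x ^+ size row) by apply/eqP; rewrite -addr_eq0 r0.
by rewrite -[in x ^+ size row](subnK le) exprD; ring.
Qed.

Lemma pmod_root n p row : [[rev p]] = 0 -> [[rev row]] = 0 -> [[rev (pmod n p row)]] = 0.
Proof. by case: p => // lc cs; exact: prem_root. Qed.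

End PolSem.

Section Strip.
Variables (s a : K).
Let ev1 : T1 -> K := pev (qk : qops -> K) s.
Let m1 : morph ev1 := pol_morph s qk_morph.
Local Notation ev2 := (pev ev1 a).

Lemma pnorm_root row : ev2 (rev row) = 0 -> ev2 (rev (pnorm row)) = 0.
Proof.
rewrite /pnorm; case: ifP => // _; set k := qcontent _ => r0.
set f := fun c : T1 => _; suff -> : ev2 (rev (map f row)) = qk k * ev2 (rev row) by rewrite r0 mulr0.
rewrite -map_rev; elim: (rev row) => [|c r IH]; first by rewrite /= mulr0.
rewrite [LHS]/= IH /f /ev1 (ptrimE s qk_morph) (pev_scale s qk_morph) /=; ring.
Qed.

Lemma pstrip1_root f row : ev1 f != 0 -> ev2 (rev row) = 0 -> ev2 (rev (pstrip1 f row)) = 0.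
Proof.
move=> f0; rewrite /pstrip1; case: ifP => // /andP[H _] r0.
apply: (mulfI f0); rewrite mulr0 -[RHS]r0 -map_rev.
have {}H : all (fun cd : T1 * T1 => rnull (rsub cd.1 (rmul f cd.2)))
             (zip (rev row) (map (qquot f) (rev row))).
  by rewrite map_rev -rev_zip ?size_map // all_rev.
elim: (rev row) H => [|c r IH]; first by rewrite /= mulr0.
move=> /= /andP[/(ev0 m1)]; rewrite (ev_sub m1) (evM m1) => /eqP; rewrite subr_eq0 => /eqP-> /IH <-.
ring.
Qed.

Lemma pstrip_root fs row : all (fun f => ev1 f.1 != 0) fs ->
  ev2 (rev row) = 0 -> ev2 (rev (pstrip fs row)) = 0.
Proof.
rewrite /pstrip => H /pnorm_root; elim: fs H (pnorm row) => //= [[f n] fs] IH /andP[/= f0 /IH{}IH] r r0.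
by apply: IH => /=; elim: n => //= n IHn; apply: pstrip1_root.
Qed.

Lemma det4_root (r1 r2 r3 r4 : seq T1) :
  size r1 = 4 -> size r2 = 4 -> size r3 = 4 -> size r4 = 4 ->
  ev2 (rev r1) = 0 -> ev2 (rev r2) = 0 -> ev2 (rev r3) = 0 -> ev2 (rev r4) = 0 ->
  ev1 (det4 r1 r2 r3 r4) = 0.
Proof.
move=> s1 s2 s3 s4 e1 e2 e3 e4.
rewrite /det4 /det2; do ![rewrite (ev_sub m1) || rewrite (evM m1) || rewrite (evD m1)].
case: r1 s1 e1 => [|a0 [|a1 [|a2 [|a3 [|? ?]]]]] //= _.
case: r2 s2 e2 => [|b0 [|b1 [|b2 [|b3 [|? ?]]]]] //= _.
case: r3 s3 e3 => [|c0 [|c1 [|c2 [|c3 [|? ?]]]]] //= _.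
case: r4 s4 e4 => [|d0 [|d1 [|d2 [|d3 [|? ?]]]]] //= _.
rewrite /rev /= !mulr0 !addr0.
move: (ev1 a0) (ev1 a1) (ev1 a2) (ev1 a3) (ev1 b0) (ev1 b1) (ev1 b2) (ev1 b3).
move=> A0 A1 A2 A3 B0 B1 B2 B3.
move: (ev1 c0) (ev1 c1) (ev1 c2) (ev1 c3) (ev1 d0) (ev1 d1) (ev1 d2) (ev1 d3).
move=> C0 C1 C2 C3 D0 D1 D2 D3 e4 e3 e2 e1.
have EA : A3 = - (a * (A2 + a * (A1 + a * A0))) by apply/eqP; rewrite -addr_eq0 e1.
have EB : B3 = - (a * (B2 + a * (B1 + a * B0))) by apply/eqP; rewrite -addr_eq0 e2.
have EC : C3 = - (a * (C2 + a * (C1 + a * C0))) by apply/eqP; rewrite -addr_eq0 e3.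
have ED : D3 = - (a * (D2 + a * (D1 + a * D0))) by apply/eqP; rewrite -addr_eq0 e4.
rewrite EA EB EC ED; ring.
Qed.
End Strip.
End Semantics.


(* ---- coprimality modulo a prime *)
Section ModP.

Section Zev.
Variable (A : comNzRingType).
Definition zev (x : A) (p : seq Z) : A :=
  foldr (fun c acc => (int_of_Z c)%:~R + x * acc) 0 p.

Lemma zev_add x p q : zev x (zadd p q) = zev x p + zev x q.
Proof.
elim: p q => [|a p IH] [|b q] /=; rewrite ?add0r ?addr0 //.
have e : int_of_Z (a + b)%bz = int_of_Z a + int_of_Z b by lia.
by rewrite IH e intrD; ring.
Qed.

Lemma zev_mul x p q : zev x (zmul p q) = zev x p * zev x q.
Proof.
elim: p => [|a p IH] /=; first by rewrite mul0r.
rewrite zev_add /= IH add0r; suff -> : zev x [seq (a * b)%bz | b <- q] = (int_of_Z a)%:~R * zev x q by ring.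
elim: q {IH} => [|b q IH] /=; first by rewrite mulr0.
have e : int_of_Z (a * b)%bz = int_of_Z a * int_of_Z b by lia.
by rewrite IH e intrM; ring.
Qed.

Lemma zev_mod x (l : Z) p : (int_of_Z l)%:~R = 0 :> A ->
  zev x [seq (c mod l)%bz | c <- p] = zev x p.
Proof.
move=> l0; elim: p => //= c p ->; congr (_ + _).
have -> : int_of_Z c = int_of_Z l * int_of_Z (c / l)%bz + int_of_Z (c mod l)%bz.
  have := Z_div_mod_eq_full c l; lia.
by rewrite intrD intrM l0 mul0r add0r.
Qed.
End Zev.

Lemma rmorph_zev (A B : comNzRingType) (f : {rmorphism A -> B}) x p : f (zev x p) = zev (f x) p.
Proof. by elim: p => [|c p IH] /=; rewrite ?rmorph0 // rmorphD rmorphM rmorph_int IH. Qed.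

Lemma polyseq_zev (p : seq Z) : last Z0 p != Z0 ->
  zev 'X p = map int_of_Z p :> seq int.
Proof.
move=> lp; have -> : zev 'X p = Poly (map int_of_Z p).
  elim: p {lp} => //= c p ->.
  by rewrite cons_poly_def -[in RHS](intz (int_of_Z c)) rmorph_int mulrC addrC.
apply: (@PolyK _ 1); case: p lp => //= c p lp.
by rewrite last_map; apply: contra_neq lp; lia.
Qed.

Lemma lead_coef_zev (p : seq Z) : last Z0 p != Z0 ->
  lead_coef (zev 'X p : {poly int}) = int_of_Z (last Z0 p).
Proof.
by move=> lp; rewrite lead_coefE polyseq_zev // nth_last; exact: (last_map int_of_Z p Z0).
Qed.

Lemma resultant_map (A B : nzRingType) (f : {rmorphism A -> B}) (p q : {poly A}) :
    f (lead_coef p) != 0 -> f (lead_coef q) != 0 ->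
  f (resultant p q) = resultant (map_poly f p) (map_poly f q).
Proof.
move=> fp fq; rewrite /resultant /Sylvester_mx !size_map_poly_id0 //.
rewrite -det_map_mx /= map_col_mx; congr (\det (col_mx _ _));
  by apply: map_lin1_mx => v; rewrite map_poly_rV rmorphM /= map_rVpoly.
Qed.

Lemma coprime_mod11 (K : numFieldType) (s : K) (X W U V : seq Z) :
  (1 < size X)%N -> (1 < size W)%N ->
  [seq (c mod 11)%bz | c <- zadd (zmul U X) (zmul V W)] =
    1%bz :: nseq (size (zadd (zmul U X) (zmul V W))).-1 Z0 ->
  ((last Z0 X) mod 11 != 0)%bz -> ((last Z0 W) mod 11 != 0)%bz ->
  zev s X = 0 -> zev s W = 0 -> False.
Proof.
move=> szX szW UV lX lW sX sW.
pose f : {rmorphism int -> 'F_11} := intr.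
pose pX : {poly int} := zev 'X X; pose pW : {poly int} := zev 'X W.
have fl (l : seq Z) : ((last Z0 l) mod 11 != 0)%bz ->
  last Z0 l != Z0 /\ f (lead_coef (zev 'X l : {poly int})) != 0.
  move=> ll; have ll0 : last Z0 l != Z0 by apply: contra_neq ll => ->.
  split=> //; rewrite lead_coef_zev //; move: (last Z0 l) ll {ll0} => z ll.
  have := Z_mod_lt z 11; set m := (z mod 11)%bz in ll * => m_lt.
  have -> : int_of_Z z = 11%:Z * int_of_Z (z / 11)%bz + (Z.to_nat m)%:Z.
    have := Z_div_mod_eq_full z 11; rewrite -/m; lia.
  have p11 : 11%N \in [pchar 'F_11] by exact: pchar_Fp.
  rewrite rmorphD rmorphM /= -!pmulrn (pcharf0 p11) mul0r add0r -(dvdn_pcharf p11).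
  apply: contra ll => /dvdnP[k kE]; apply/eqP.
  have /m_lt : (11 > 0)%bz by []; clearbody m; clear -kE; lia.
have [lX0 fX] := fl _ lX; have [lW0 fW] := fl _ lW.
have zsz (l : seq Z) : last Z0 l != Z0 -> (1 < size l)%N -> (1 < size (zev 'X l : {poly int}))%N.
  by move=> l0; rewrite polyseq_zev // size_map.
have r0 : resultant pX pW = 0.
  have [[u v] /= _ e] := resultant_in_ideal (zsz _ lX0 szX) (zsz _ lW0 szW).
  pose g : {rmorphism {poly int} -> K} := horner_eval s \o map_poly intr.
  have gX : g 'X = s by rewrite /g /= map_polyX /horner_eval hornerX.
  have := congr1 g e; rewrite rmorphD !rmorphM !rmorph_zev gX sX sW !mulr0 addr0.
  rewrite /g /= map_polyC /horner_eval hornerC => /eqP.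
  by rewrite intr_eq0 => /eqP.
have : resultant (map_poly f pX) (map_poly f pW) = 0.
  by rewrite -resultant_map // r0 rmorph0.
apply/eqP; rewrite resultant_eq0 -leqNgt.
suff /eqP-> : coprimep (map_poly f pX) (map_poly f pW) by [].
apply/Bezout_coprimepP; exists (zev 'X U, zev 'X V) => /=.
rewrite !rmorph_zev /= map_polyX -!zev_mul -zev_add.
have p11 : 11%N \in [pchar 'F_11] by exact: pchar_Fp.
rewrite -(@zev_mod _ _ 11); last first.
  by rewrite -[RHS](polyC0) -(pcharf0 p11) polyC_natr.
rewrite UV /=; set n := _.-1.
have -> : zev 'X (nseq n Z0) = 0 :> {poly 'F_11}.
  by elim: n => //= n ->; rewrite mulr0 addr0.
by rewrite mulr0 addr0 eqpxx.
Qed.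
End ModP.


Arguments prem : simpl never.
Arguments iter : simpl never.
Lemma elim_ok_E1 E1 E2 E3 E4 : elim_ok E1 E2 E3 E4 -> rnull (rsub E1 E1lit).
Proof. by case/and4P. Qed.

Section Sound.
Variable K : numFieldType.
Implicit Types s a R : K.
Let qkm := qk_morph K.
Local Notation ev1 s := (pev (qk K : qops -> K) s).
Local Notation ev2 s a := (pev (ev1 s) a).
Local Notation ev3 s a R := (pev (ev2 s a) R).

Lemma qhorner_ev c (p : T1) : qk K (qhorner c p) = ev1 (qk K c) p.
Proof. by elim: p => [|d p IH] /=; rewrite ?qk0 // qkD qkM IH. Qed.

Lemma pat_ev c (p : T2) a : ev1 a (pat c p) = ev2 (qk K c) a p.
Proof. by elim: p => //= d p ->; rewrite qhorner_ev. Qed.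

Lemma dropz_ev (p : T1) s : ev1 s (rev (dropz p)) = ev1 s (rev p).
Proof.
rewrite /dropz; elim: p => //= c p IH; case: ifP => //= /negbFE /(ev0 qkm) c0.
by rewrite IH pev_rev_cons // c0 mul0r addr0.
Qed.

Lemma qmonic_root (p : T1) s : ev1 s (rev p) = 0 -> ev1 s (rev (qmonic p)) = 0.
Proof.
rewrite /qmonic -(dropz_ev p s); case: (dropz p) => // lc cs p0.
by rewrite pev_rev_scale // p0 mulr0.
Qed.

Lemma peucl_root n (p q : T1) s : ev1 s (rev p) = 0 -> ev1 s (rev q) = 0 -> ev1 s (rev (peucl n p q)) = 0.
Proof.
elim: n p q => //= n IH p q p0 /qmonic_root.
case: (qmonic q) => [|lc cs] // q0'; apply: IH => //. exact: (prem_root qkm).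
Qed.

Lemma ugcd_root (p q : T1) s : ev1 s p = 0 -> ev1 s q = 0 -> ev1 s (ugcd p q) = 0.
Proof.
by move=> p0 q0'; apply: qmonic_root; apply: peucl_root; rewrite revK.
Qed.

Lemma qk_eq0 c : qk K c = 0 -> Qeq_bool c q0.
Proof.
move=> /eqP; rewrite mulf_eq0 invr_eq0 (negPf (zk_neq0 _ _)) orbF zk_eq0 => /eqP c0.
by apply/Qeq_bool_iff; rewrite /Qeq c0.
Qed.

Lemma qconst_neq0 p s : qconst p -> ev1 s p != 0.
Proof.
case: p => //= c p /andP[c0 p0]; rewrite (pev_null _ qkm p0) mulr0 addr0.
by apply: contra c0 => /eqP /qk_eq0.
Qed.

Lemma qconst_root p s : ev1 s p = 0 -> ~~ qconst p.
Proof. by move=> p0; apply/negP => /(qconst_neq0 s); rewrite p0 eqxx. Qed.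

Lemma qeqp_ev p q s : qeqp p q -> ev1 s p = ev1 s q.
Proof.
have m := pol_morph s qkm.
by move=> /(ev0 m); rewrite (ev_sub m) => /eqP; rewrite subr_eq0 => /eqP.
Qed.

Section Point.
Variables (E1 E2 E3 E4 : T3) (s a R : K).
Let m1 := pol_morph s qkm.
Let m2 := pol_morph a m1.
Let m3 := pol_morph R m2.
Hypotheses (HE1 : ev3 s a R E1 = 0) (HE2 : ev3 s a R E2 = 0).
Hypotheses (HE3 : ev3 s a R E3 = 0) (HE4 : ev3 s a R E4 = 0).
Hypothesis (E1ok : rnull (rsub E1 E1lit)).

Lemma E1lit_root : ev3 s a R E1lit = 0.
Proof. by move/(ev0 m3): E1ok; rewrite (ev_sub m3) HE1 sub0r => /eqP; rewrite oppr_eq0 => /eqP. Qed.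

Lemma den_num : ev2 s a E1c1 * R = ev2 s a (rmul (rcst qm1) E1c0).
Proof.
rewrite (evM m2) (evc m2) qkm1 mulN1r; move: E1lit_root; rewrite /E1lit.
move: E1c0 E1c1 => c0 c1 e; have {}e : ev2 s a c0 + R * (ev2 s a c1 + R * 0) = 0 by exact: e.
by apply/eqP; rewrite -addr_eq0 addrC -[X in _ == X]e mulr0 addr0 mulrC.
Qed.

Lemma elimR_root E : ev1 s f0 != 0 -> ev1 s f17 != 0 -> ev3 s a R E = 0 -> ev2 s a (elimR E) = 0.
Proof.
move=> h0 h17 E0; rewrite /elimR; apply: pstrip_root; first by apply/and3P.
by rewrite revK ptrimE // (psubst_root m2 den_num).
Qed.

Section Generic.
Hypotheses (h0 : ev1 s f0 != 0) (h17 : ev1 s f17 != 0) (h5m : ev1 s f5m != 0).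

Lemma reduce_root P k l row : ev2 s a P = 0 -> ev2 s a (rev row) = 0 ->
  ev2 s a (rev (reduce P k l row)) = 0.
Proof.
move=> P0 r0; apply: pstrip_root; first by apply/and3P.
by apply: (pmod_root m1) => //; rewrite revK.
Qed.

Lemma shift_root P k l row : ev2 s a P = 0 -> ev2 s a (rev row) = 0 ->
  ev2 s a (rev (reduce P k l (rcons row [::]))) = 0.
Proof. by move=> P0 r0; apply: reduce_root; rewrite // rev_rcons /= r0 mulr0 add0r. Qed.

Lemma zev_qk (p : seq Q) : all (fun q => Qeq_bool q (Qmake (Qnum q) 1)) p ->
  zev s (map Qnum p) = ev1 s p.
Proof.
elim: p => //= c p IH /andP[/Qeq_bool_eq /(qk_eq K) -> /IH ->].
by rewrite /qk /= /zk divr1.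
Qed.

Lemma coprime11P X W : coprime11 X W -> ev1 s X = 0 -> ev1 s W = 0 -> False.
Proof.
case/and5P => intXW sX sW /eqP UV /andP[lX lW].
move: intXW; rewrite all_cat => /andP[/zev_qk<- /zev_qk<-] X0 W0.
by apply: (coprime_mod11 _ _ UV lX lW X0 W0); rewrite size_map.
Qed.

Lemma pstrip_head (fs : seq (T1 * nat)) (x : T1) : all (fun f => ev1 s f.1 != 0) fs ->
  ev1 s x = 0 -> ev1 s (head [::] (pstrip fs [:: x])) = 0.
Proof.
move=> nz x0; have H : ev2 s 0 (rev [:: x]) = 0 by rewrite /= mul0r addr0.
have := pstrip_root nz H.
have : size (pstrip fs [:: x]) = 1%N.
  rewrite /pstrip; set r := pnorm _; have : size r = 1%N by rewrite /r /pnorm; case: ifP.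
  elim: fs r {nz H} => //= f fs IH r szr; apply: IH; elim: f.2 => //= n szi.
  by rewrite iterS /pstrip1; case: ifP; rewrite ?size_map.
by case: (pstrip fs [:: x]) => [|c [|? ?]] //= _; rewrite mul0r addr0.
Qed.

Lemma det3_root (r1 r2 r3 : seq T1) :
  size r1 = 4%N -> size r2 = 4%N -> size r3 = 4%N ->
  ev2 s a (rev r1) = 0 -> ev2 s a (rev r2) = 0 -> ev2 s a (rev r3) = 0 ->
  ev1 s (det3 r1 r2 r3 0 1 2) * a + ev1 s (det3 r1 r2 r3 0 1 3) = 0.
Proof.
move=> s1 s2 s3 e1 e2 e3.
rewrite /det3 /det2; do ![rewrite (ev_sub m1) || rewrite (evM m1) || rewrite (evD m1)].
case: r1 s1 e1 => [|a0 [|a1 [|a2 [|a3 [|? ?]]]]] //= _.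
case: r2 s2 e2 => [|b0 [|b1 [|b2 [|b3 [|? ?]]]]] //= _.
case: r3 s3 e3 => [|c0 [|c1 [|c2 [|c3 [|? ?]]]]] //= _.
rewrite /rev /= !mulr0 !addr0.
move: (ev1 s a0) (ev1 s a1) (ev1 s a2) (ev1 s a3) (ev1 s b0) (ev1 s b1) (ev1 s b2) (ev1 s b3).
move=> A0 A1 A2 A3 B0 B1 B2 B3.
move: (ev1 s c0) (ev1 s c1) (ev1 s c2) (ev1 s c3) => C0 C1 C2 C3 e3 e2 e1.
have EA : A3 = - (a * (A2 + a * (A1 + a * A0))) by apply/eqP; rewrite -addr_eq0 e1.
have EB : B3 = - (a * (B2 + a * (B1 + a * B0))) by apply/eqP; rewrite -addr_eq0 e2.
have EC : C3 = - (a * (C2 + a * (C1 + a * C0))) by apply/eqP; rewrite -addr_eq0 e3.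
rewrite EA EB EC; ring.
Qed.

Lemma prem_monic (x : K) n (cs row : seq qops) : ev1 x (rev (q1 :: cs)) = 0 ->
  ev1 x (rev (prem n q1 cs row)) = ev1 x (rev row).
Proof.
move=> P0; elim: n row => // n IH [|t row] //; rewrite /prem -/prem.
case: ltnP => // le; rewrite IH.
have szs : size (pscale (rmul (rcst qm1) (t : qops)) cs) = size cs by rewrite size_map.
have szr : size (pscale (q1 : qops) row) = size row by rewrite size_map.
rewrite pev_rev_add ?szs ?szr // !pev_rev_scale // (evM qkm) (evc qkm) qkm1 qk1.
move: P0; rewrite !pev_rev_cons // qk1 mul1r => P0.
have -> : ev1 x (rev cs) = - (x ^+ size cs) by apply/eqP; rewrite -addr_eq0 P0.
by rewrite -[in x ^+ size row](subnK le) exprD; ring.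
Qed.

Lemma generic_root P3 P4 P5 : generic_ok P3 P4 P5 ->
  ev2 s a P3 = 0 -> ev2 s a P4 = 0 -> ev2 s a P5 = 0 ->
  [|| ev1 s f5 == 0, ev1 s f7 == 0, ev1 s f65 == 0 | ev1 s f27 == 0] /\
  (ev1 s f27 = 0 -> a = ev1 s aff27).
Proof.
rewrite /generic_ok; set r0 := reduce P3 9 1 _; set r1 := reduce P3 1 0 _; set r2 := reduce P3 1 0 _.
set r3 := reduce P3 1 0 _; set q := reduce P3 12 1 _ => /and4P[sz XW mok lok] P30 P40 P50.
have z0 : ev2 s a (rev r0) = 0 by apply: reduce_root; rewrite ?revK.
have z1 : ev2 s a (rev r1) = 0 by exact: shift_root.
have z2 : ev2 s a (rev r2) = 0 by exact: shift_root.
have z3 : ev2 s a (rev r3) = 0 by exact: shift_root.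
have zq : ev2 s a (rev q) = 0 by apply: reduce_root; rewrite ?revK.
move: r0 r1 r2 r3 q sz z0 z1 z2 z3 zq XW mok lok => r0 r1 r2 r3 q.
case/and5P => /eqP sz0 /eqP sz1 /eqP sz2 /eqP sz3 /andP[/eqP sz4 _] z0 z1 z2 z3 zq XW mok lok.
split.
  apply: contraT; rewrite !negb_or => /and4P[h5 h7 h65 h27].
  have nz : all (fun f => ev1 s f.1 != 0) known by rewrite /known /all h0 h17 h5m h5 h7 h65 h27.
  by case: (coprime11P XW); apply: pstrip_head => //; apply: det4_root; eassumption.
move=> s27; have e27 : ev1 s (rev (q1 :: f27m)) = 0.
  apply: (mulfI (zk_neq0 K 2717)); rewrite mulr0 -[RHS]s27 /= !mulr0 !addr0.
  by rewrite /qk !zkE; field.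
have := det3_root sz0 sz1 sz2 z0 z1 z2.
move: mok lok; set m := prem 100 q1 f27m (rev (det3 r0 r1 r2 0 1 2)).
set l := prem 100 q1 f27m (rev (det3 r0 r1 r2 0 1 3)) => mok lok0.
have em : ev1 s (rev m) = ev1 s (det3 r0 r1 r2 0 1 2) by rewrite /m prem_monic ?revK.
have el : ev1 s (rev l) = ev1 s (det3 r0 r1 r2 0 1 3) by rewrite /l prem_monic ?revK.
rewrite -em -el => e.
have lok : ev1 s (rev l) + ev1 s (rev m) * ev1 s aff27 = 0.
  rewrite -(pev_mul _ qkm) -(pev_add _ qkm) -[RHS](pev_null s qkm (_ : all rnull (rev (prem 10 q1 f27m
    (rev (padd (rev l) (pmul (rev m) aff27))))))); first by rewrite prem_monic ?revK.
  by rewrite all_rev.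
have m0 : ev1 s (rev m) != 0.
  by apply: contraTneq (qconst_neq0 s mok) => m0; rewrite ugcd_root ?eqxx.
by apply: (mulfI m0); apply: (addIr (ev1 s (rev l))); rewrite e addrC lok.
Qed.
End Generic.

Lemma gcd3_root c P3 P4 P5 : s = qk K c -> ev2 s a P3 = 0 -> ev2 s a P4 = 0 ->
  ev2 s a P5 = 0 -> ev1 a (gcd3 c P3 P4 P5) = 0.
Proof. by move=> -> p3 p4 p5; rewrite /gcd3 !ugcd_root ?pat_ev. Qed.

Lemma det2_root (r1 r2 : seq T1) : size r1 = 2%N -> size r2 = 2%N ->
  ev2 a R (rev r1) = 0 -> ev2 a R (rev r2) = 0 -> ev1 a (det2 r1 r2 0 1) = 0.
Proof.
have ma := pol_morph a qkm.
rewrite /det2 (ev_sub ma) !(evM ma).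
case: r1 => [|u1 [|u0 [|? ?]]] //= _; case: r2 => [|v1 [|v0 [|? ?]]] //= _.
rewrite /rev /= !mulr0 !addr0; move: (ev1 a u0) (ev1 a u1) (ev1 a v0) (ev1 a v1) => U0 U1 V0 V1 e1 e2.
have -> : U0 = - (R * U1) by apply/eqP; rewrite -addr_eq0 e1.
have -> : V0 = - (R * V1) by apply/eqP; rewrite -addr_eq0 e2.
ring.
Qed.

Lemma pat2_ev c1 c2 (E : T3) : ev1 R (pat c2 (map (pat c1) E)) = ev3 (qk K c1) (qk K c2) R E.
Proof. by elim: E => //= p E ->; rewrite qhorner_ev pat_ev. Qed.

Lemma map_pat_ev c (E : T3) : ev2 a R (map (pat c) E : T2) = ev3 (qk K c) a R E.
Proof. by elim: E => //= p E ->; rewrite pat_ev. Qed.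

Lemma E1_rel : - (215 / 24) - 3905 / 48 * s + a * (1 / 6 + 70 / 3 * s) + 3 * a ^+ 2 * s
  + R * (9 / 4 * s + 153 / 4 * s ^+ 2) = 0.
Proof.
by rewrite -[RHS]E1lit_root /E1lit /E1c0 /E1c1 /= /qk !zkE; field.
Qed.

Lemma special_root : special_ok E2 E3 E4 -> ev1 s f0 != 0 /\ ev1 s f17 != 0.
Proof.
have qk215 : qk K (Qmake 215%bz 4) = 215 / 4 by rewrite /qk !zkE; field.
have qk17 : qk K (Qmake (-1)%bz 17) = - 1 / 17 by rewrite /qk !zkE; field.
case/and4P => c0 /eqP z3 /eqP z4 c17; split.
  apply: contraTneq c0 => e; have s0 : s = qk K q0.
    by rewrite qk0 -[RHS]e /= /qk !zkE; field.
  have a0 : a = qk K (Qmake 215%bz 4).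
    have := E1_rel; rewrite s0 qk0 qk215 => e1; apply: (mulfI (_ : (1 / 6 : K) != 0)).
      by rewrite mul1r invr_eq0 pnatr_eq0.
    by apply/eqP; rewrite -subr_eq0 -[X in _ == X]e1; apply/eqP; field.
  apply: (@qconst_root _ R); apply: ugcd_root.
    by rewrite pat2_ev -s0 -a0.
  by rewrite pat2_ev -s0 -a0.
apply: contraTneq c17 => e; have s17 : s = qk K (Qmake (-1)%bz 17).
  rewrite qk17; have -> : s = (ev1 s f17 - 1) / 17 by rewrite /= /qk !zkE; field.
  by rewrite e; field.
apply: (@qconst_root _ a); apply: ugcd_root.
  rewrite pat_ev -s17; have := E1lit_root; rewrite /E1lit.
  suff : ev2 s a E1c1 = 0.
    by move: E1c0 E1c1 => x y y0 h; have : ev2 s a x + R * (ev2 s a y + R * 0) = 0 by []; rewrite y0 !(mulr0, addr0).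
  by rewrite /E1c1 s17 /= qk17 /qk !zkE; field.
have root2 : ev2 a R (ptrim (map (pat (Qmake (-1)%bz 17)) E2 : T2)) = 0.
  by rewrite (ptrimE _ (pol_morph a qkm)) map_pat_ev -s17.
have red E : ev3 s a R E = 0 -> ev2 a R (rev (pmod 10 (rev (map (fun c : T1 => (ptrim c : T1))
    (ptrim (map (pat (Qmake (-1)%bz 17)) E2 : T2)))) (rev (map (pat (Qmake (-1)%bz 17)) E)))) = 0.
  move=> E0; apply: (pmod_root (pol_morph a qkm)); rewrite revK.
    rewrite -[RHS]root2; elim: (ptrim _) => //= c p ->; congr (_ + _).
    by rewrite ptrimE.
  by rewrite map_pat_ev -s17.
by apply: det2_root => //; apply: red.
Qed.

Lemma elim_cases : elim_ok E1 E2 E3 E4 ->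
  [\/ s = 1 / 5 /\ a = - (1 / 4), s = 1 / 7 /\ a ^+ 2 + 31 / 6 * a - 1045 / 48 = 0,
      s = 7 / 65 /\ a = - (37 / 4) |
      2717 * s ^+ 2 - 118 * s + 45 = 0 /\ a = 710 / 243 - 13%:R * 1045%:R / 972 * s].
Proof.
case/and4P => _ gok pok /special_root[h0 h17].
have p3 := elimR_root h0 h17 HE2; have p4 := elimR_root h0 h17 HE3.
have p5 := elimR_root h0 h17 HE4.
move: gok pok p3 p4 p5; move: (elimR E2) (elimR E3) (elimR E4) => P3 P4 P5.
move=> gok /and4P[k1 k2 k3 k4] p3 p4 p5.
have qkE := zkE.
have h5m : ev1 s f5m != 0.
  apply: contraTneq k1 => e; apply: (@qconst_root _ a).
  apply: gcd3_root => //; have -> : s = (ev1 s f5m - 1) / 5 by rewrite /= /qk !zkE; field.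
  by rewrite e /qk !zkE; field.
have [] := generic_root h0 h17 h5m gok p3 p4 p5.
case/or4P => /eqP e k27.
- have s5 : s = qk K (Qmake 1%bz 5).
    have -> : s = (ev1 s f5 + 1) / 5 by rewrite /= /qk !zkE; field.
    by rewrite e /qk !zkE; field.
  constructor 1; split; first by rewrite s5 /qk !zkE; field.
  have := gcd3_root s5 p3 p4 p5; rewrite (qeqp_ev a k2) => ea.
  have -> : a = 0 - 1 / 4 by rewrite -ea /= /qk !zkE; field.
  by field.
- have s5 : s = qk K (Qmake 1%bz 7).
    have -> : s = (ev1 s f7 + 1) / 7 by rewrite /= /qk !zkE; field.
    by rewrite e /qk !zkE; field.
  constructor 2; split; first by rewrite s5 /qk !zkE; field.
  have := gcd3_root s5 p3 p4 p5; rewrite (qeqp_ev a k4) => <-.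
  by rewrite /= /qk !zkE; field.
- have s5 : s = qk K (Qmake 7%bz 65).
    have -> : s = (ev1 s f65 + 7) / 65 by rewrite /= /qk !zkE; field.
    by rewrite e /qk !zkE; field.
  constructor 3; split; first by rewrite s5 /qk !zkE; field.
  have := gcd3_root s5 p3 p4 p5; rewrite (qeqp_ev a k3) => ea.
  have -> : a = 0 - 37 / 4 by rewrite -ea /= /qk !zkE; field.
  by field.
constructor 4; split; first by rewrite -[RHS]e /= /qk !zkE; field.
by rewrite (k27 e) /= /qk !zkE; field.
Qed.
End Point.
End Sound.


(* ---- from the recursion to the elimination *)
Section LevelSem.
Variable K : numFieldType.

Definition map_level (R : rops) (ev : R -> K) (L : level R) : level (kops K) :=
  @Level (kops K) (ev (lA L)) (ev (lB L)) (ev (lC L)) (ev (pA L)) (ev (pB L)) (ev (pC L)) (ev (pD L)).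

Local Arguments level_step : simpl never.
Lemma level_eqsS (R : rops) (a b r rN : R) n j L : level_eqs a b r rN n.+1 j L =
  (level_step a b r rN j L).2 :: level_eqs a b r rN n (j + 1)%bz (level_step a b r rN j L).1.
Proof. by []. Qed.

Lemma level_eqs_morph (R : rops) (ev : R -> K) (m : morph ev) a b r rN n j L :
  map ev (level_eqs a b r rN n j L) =
  level_eqs (R := kops K) (ev a) (ev b) (ev r) (ev rN) n j (map_level ev L).
Proof.
have cstE z d : ev (cst z d) = cst (R := kops K) z d by rewrite /cst (evc m).
have rrE i : ev (level_rr r rN i) = level_rr (R := kops K) (ev r) (ev rN) i.
  by rewrite /level_rr (evD m) (evM m) cstE.
elim: n j L => // n IH j L; rewrite !level_eqsS map_cons IH.
have -> : level_step (R := kops K) (ev a) (ev b) (ev r) (ev rN) j (map_level ev L) =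
    (map_level ev (level_step a b r rN j L).1, ev (level_step a b r rN j L).2).
  rewrite /level_step /map_level /=; congr (@Level _ _ _ _ _ _ _ _, _);
  by do ![rewrite (evD m) || rewrite (evM m) || rewrite cstE || rewrite rrE].
by [].
Qed.

Definition pre (T : Type) (x0 : T) (f : nat -> T) (j : nat) : T := if j is i.+1 then f i else x0.

Section Seqs.
Variables (a b r rN : K) (A : nat -> K).
Definition rr (j : nat) : K := rN + (1 - j%:R) * r.
Definition Bj (j : nat) : K := (5 / 2 + 3 * j%:R) * A j.
Definition Cj (j : nat) : K := (a + (9 * j%:R ^+ 2 + 8 * j%:R) / 2) * A j - rr j / 2 * pre 0 A j.
Definition Dj (j : nat) : K :=
  ((a - 5 / 2 - 5 / 2 * j%:R) * Bj j + (3 * j%:R - 1 / 2) * Cj j + 3 * b * A j - rr j * pre 0 Bj j) / 3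
  - A j.+1.
Definition X1 (j : nat) : Prop :=
  2 * Bj j.+1 - 2 * b * Bj j + 5 / 2 * (j%:R + 1) * Cj j + (2 - 3 * j%:R) * Dj j + rr j * pre 0 Cj j = 0.
Definition X0 (j : nat) : Prop :=
  Cj j.+1 - b * Cj j + rr j * pre (-1) Dj j + (a + 5 / 2 * (j%:R + 1)) * Dj j = 0.

Hypotheses (A0 : A 0%N = 1) (HX1 : forall j, X1 j) (HX0 : forall j, X0 j).

Definition stateL (j : nat) : level (kops K) :=
  @Level (kops K) (A j) (Bj j) (Cj j) (pre 0 A j) (pre 0 Bj j) (pre 0 Cj j) (pre (-1) Dj j).

Lemma level_stepE j : level_step (R := kops K) a b r rN (Z.of_nat j) (stateL j) = (stateL j.+1, 0).
Proof.
have zj : zk K (Z.of_nat j) = j%:R.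
  by rewrite /zk; have -> : int_of_Z (Z.of_nat j) = j%:Z by lia.
have cE z d : cst (R := kops K) z d = zk K z / zk K (Zpos d) by [].
have zkB x y : zk K (x - y)%bz = zk K x - zk K y.
  rewrite -[(x - y)%bz]/(x + - y)%bz zkD; congr (_ + _).
  have -> : (- y)%bz = (-1 * y)%bz by lia. by rewrite zkM zkN zk1 mulN1r.
have pos : zk K (Zpos (Z.to_pos (9 * (Z.of_nat j + 1)))%bz) = 9 * (j%:R + 1).
  rewrite Z2Pos.id; last lia.
  by rewrite zkM zkD zj !zkE; ring.
have j1 : j%:R + 1 != 0 :> K by rewrite natr1 pnatr_eq0.
have A1 : A j.+1 = - 1 / (9 * (j%:R + 1)) * (- 2 * b * Bj j + 5 / 2 * (j%:R + 1) * Cj j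
   + (2 - 3 * j%:R) * (Dj j + A j.+1) + rr j * pre 0 Cj j).
  have := HX1 j; rewrite /X1 {1}/Bj -natr1; move: (pre 0 Cj j) => pC h.
  apply/eqP; rewrite -subr_eq0; apply/eqP.
  rewrite -[RHS](mulr0 (1 / (9 * (j%:R + 1)))) -[X in _ = _ * X]h; field.
  by rewrite j1.
have rrE i : level_rr (R := kops K) r rN (Z.of_nat i) = rr i.
  have zi : zk K (Z.of_nat i) = i%:R.
    by rewrite /zk; have -> : int_of_Z (Z.of_nat i) = i%:Z by lia.
  by rewrite /level_rr cE zkB zi !zkE /rr [LHS]/=; field.
have rrE1 : level_rr (R := kops K) r rN (Z.of_nat j + 1) = rr j.+1.
  by rewrite -rrE; congr level_rr; lia.
have D0E : level_D (R := kops K) a b r rN (Z.of_nat j) (stateL j) = Dj j + A j.+1.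
  rewrite /level_D /Dj rrE !cE !(zkB, zkD, zkM) zj !zkE [LHS]/=; by field.
have AE : level_A (R := kops K) a b r rN (Z.of_nat j) (stateL j) = A j.+1.
  rewrite /level_A D0E rrE !cE pos !(zkB, zkD, zkM) zj !zkE [RHS]A1 [LHS]/=; field.
  by rewrite j1.
rewrite /level_step AE D0E rrE rrE1 !cE !(zkB, zkD, zkM) zj !zkE /=.
have j1E : (j.+1)%:R = j%:R + 1 :> K by rewrite natr1.
congr (@Level _ _ _ _ _ _ _ _, _).
- by rewrite /Bj j1E; field.
- by rewrite /Cj j1E /=; field.
- by rewrite /=; field.
by rewrite -[RHS](HX0 j) /Cj j1E /=; field.
Qed.

Lemma level_eqs0 n : level_eqs (R := kops K) a b r rN n Z0 (level0 (R := kops K) a) = nseq n 0.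
Proof.
have st0 : level0 (R := kops K) a = stateL 0.
  have cE z d : cst (R := kops K) z d = zk K z / zk K (Zpos d) by [].
  rewrite /level0 /stateL !cE !zkE; congr (@Level _ _ _ _ _ _ _ _) => /=.
  - by rewrite A0; field. - by rewrite /Bj A0; field. - by rewrite /Cj A0 /=; field.
  - by field. - by field. - by field. - by field.
rewrite st0 -[Z0]/(Z.of_nat 0); elim: n 0%N {st0} => // n IH j.
rewrite level_eqsS level_stepE /=; congr (_ :: _).
by have := IH j.+1; have -> : Z.of_nat j.+1 = (Z.of_nat j + 1)%bz by lia.
Qed.
End Seqs.

Lemma cst_morph (R : rops) (ev : R -> K) (m : morph ev) z d : ev (cst z d) = cst (R := kops K) z d.
Proof. exact: evc. Qed.

Lemma level0_morph (R : rops) (ev : R -> K) (m : morph ev) a :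
  map_level ev (level0 a) = level0 (R := kops K) (ev a).
Proof. by rewrite /map_level /level0 [lA _]/= [lB _]/= [lC _]/= [pA _]/= [pB _]/= [pC _]/= [pD _]/= !(cst_morph m). Qed.

Lemma b_of_morph (R : rops) (ev : R -> K) (m : morph ev) s a rN :
  ev (b_of s a rN) = b_of (R := kops K) (ev s) (ev a) (ev rN).
Proof. by rewrite /b_of; do ![rewrite (evD m) || rewrite (evM m) || rewrite (cst_morph m)]. Qed.

Lemma r_of_morph (R : rops) (ev : R -> K) (m : morph ev) s a rN :
  ev (r_of s a rN) = r_of (R := kops K) (ev s) (ev a) (ev rN).
Proof. by rewrite /r_of; do ![rewrite (evD m) || rewrite (evM m) || rewrite (cst_morph m)]. Qed.

Lemma eqs_heads : (size eqs == 5%N) && all (fun e : T3 => rnull (head [::] e)) eqs.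
Proof. by vm_compute. Qed.

Lemma eq_mod (c : K) (x y e : K) : e = 0 -> x = y + c * e -> x = y.
Proof. by move=> -> ->; rewrite mulr0 addr0. Qed.

Section Solutions.
Variables (a b r rN : K) (A : nat -> K).
Hypotheses (A0 : A 0%N = 1) (HX1 : forall j, X1 a b r rN A j) (HX0 : forall j, X0 a b r rN A j).

Lemma A1_rel : b = 3 * A 1%N + (23 * a - 25) / 18.
Proof.
have -> : b = b + (2 * Bj A 1 - 2 * b * Bj A 0 + 5 / 2 * (0%:R + 1) * Cj a r rN A 0
   + (2 - 3 * 0%:R) * Dj a b r rN A 0 + rr r rN 0 * 0) / 3 by rewrite [X in X / 3]HX1; field.
by rewrite /Dj /Cj /Bj /= A0; field.
Qed.

Lemma r_rel : r = 2 / 3 * a ^+ 2 + 25 / 9 * a + 27 / 2 * A 1%N - 3 / 2 * rN - 625 / 72.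
Proof.
have -> : r = r + (Cj a r rN A 1 - b * Cj a r rN A 0 + rr r rN 0 * (-1)
  + (a + 5 / 2 * (0%:R + 1)) * Dj a b r rN A 0) by rewrite [X in r + X]HX0 addr0.
by rewrite /Dj /Cj /Bj /rr /= A0 A1_rel; field.
Qed.

Lemma A_eq0 : r = 0 -> rN = 0 -> forall j, A j.+1 = 0.
Proof.
move=> r0 rN0; have rr0 j : rr r rN j = 0 by rewrite /rr r0 rN0 mulr0 addr0.
have pE : A 1%N = 625 / 972 - 50 / 243 * a - 4 / 81 * a ^+ 2.
  by apply: (eq_mod (c := 2 / 27) r0); rewrite [in RHS]r_rel rN0; field.
have bE : b = 3 * (625 / 972 - 50 / 243 * a - 4 / 81 * a ^+ 2) + (23 * a - 25) / 18.
  by rewrite A1_rel pE.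
pose k1 := - (4115%:R / 1944) + 151 / 486 * a - 8 / 81 * a ^+ 2.
have A2 : A 2%N = k1 * A 1%N.
  apply: (eq_mod (c := 1 / 18) (HX1 1)).
  by rewrite /k1 /Dj /Cj /Bj /= !rr0 bE; field.
have A3 : A 3%N = - 1 / 27 * (- 2 * b * (17 / 2) + 15 / 2 * (a + 26) - 4 *
   ((a - 15 / 2) * (17 / 2) + 11 / 2 * (a + 26) + 3 * b) / 3) * A 2%N.
  by apply: (eq_mod (c := 1 / 27) (HX1 2)); rewrite /Dj /Cj /Bj /= !rr0; field.
have e1 : (- (3065%:R / 54) + 835 / 54 * a + 10 / 9 * a ^+ 2) * A 1%N = 0.
  apply: (eq_mod (c := 1) (HX0 1)).
  by rewrite /Dj /Cj /Bj /= !rr0 A2 /k1 bE; field.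
have e2 : (- (3230275%:R / 26244%:R) - 9154045%:R / 52488%:R * a + 116810%:R / 6561%:R * a ^+ 2
   - 18130%:R / 2187 * a ^+ 3 - 160 / 729 * a ^+ 4) * A 1%N = 0.
  have h := HX0 2; rewrite /X0 /Dj /Cj /Bj /= !rr0 A3 A2 /k1 bE in h.
  by apply: (eq_mod (c := 1) h); field.
have A10 : A 1%N = 0.
  apply: (eq_mod (c := - (36500098%:R / 2414366955%:R) - 204650%:R / 482873391%:R * a
    - 448936%:R / 804788985%:R * a ^+ 2 - 3712 / 268262995%:R * a ^+ 3) e1).
  apply: (eq_mod (c := - (309312%:R / 268262995%:R) - 18792%:R / 268262995%:R * a) e2).
  by field.
elim=> [//|j Aj].
have jE : j.+1%:R = j%:R + 1 :> K by rewrite natr1.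
have jE2 : j.+2%:R = j%:R + 2 :> K by rewrite -addn2 natrD.
have j1 : j%:R + 2 != 0 :> K by rewrite -jE2 pnatr_eq0.
apply: (eq_mod (c := 1 / (9 * (j%:R + 2))) (HX1 j.+1)).
by rewrite /Dj /Cj /Bj /= !rr0 Aj jE jE2; field.
Qed.

Hypothesis rN0 : rN != 0.
Let s := A 1%N / rN.

Lemma E_root i : (0 < i < 5)%N -> pev (pev (pev (qk K : qops -> K) s) a) rN (E_ i) = 0.
Proof.
move=> i5; have m2 := pol_morph a (pol_morph s (qk_morph K)); set ev3 := pev _ _.
have [ev [evE m3]] : exists ev : T3 -> K, ev = ev3 /\ morph ev.
  by exists ev3; split=> //; exact: pol_morph.
rewrite -evE.
have eva : ev va = a by rewrite evE /ev3 /= !(qk0, qk1); ring.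
have evs : ev vs = s by rewrite evE /ev3 /= !(qk0, qk1); ring.
have evR : ev vR = rN by rewrite evE /ev3 /= !(qk0, qk1); ring.
have evb : ev (b_of vs va vR) = b.
  by rewrite (b_of_morph m3) eva evs evR /b_of /= /cst /= /qk !zkE mulfVK // A1_rel /=; field.
have evr : ev (r_of vs va vR) = r.
  by rewrite (r_of_morph m3) eva evs evR /r_of /= /cst /= /qk !zkE mulfVK // [RHS]r_rel /=; field.
have H : map ev eqs = nseq 5 0.
  by rewrite /eqs (level_eqs_morph m3) (level0_morph m3) eva evb evr evR (level_eqs0 A0 HX1 HX0).
have /andP[/eqP sz /all_nthP] := eqs_heads; rewrite sz => /(_ [::] i).
have : ev (nth [::] eqs i) = 0.
  by rewrite -(nth_map [::] 0 ev) ?sz ?H ?nth_nseq; case/andP: i5 => // _ ->.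
rewrite /E_; case/andP: i5 => _ i5; case: (nth _ _ i) => [|e0 e1] //= e /(_ i5) /(ev0 m2) e00.
apply: (mulfI rN0); rewrite mulr0 -[RHS]e evE /ev3 /=; by rewrite [X in X + _]e00 add0r.
Qed.

Lemma rN_cases : [\/ s = 1 / 5 /\ a = - (1 / 4), s = 1 / 7 /\ a ^+ 2 + 31 / 6 * a - 1045 / 48 = 0,
      s = 7 / 65 /\ a = - (37 / 4) |
      2717 * s ^+ 2 - 118 * s + 45 = 0 /\ a = 710 / 243 - 13%:R * 1045%:R / 972 * s].
Proof.
exact: (elim_cases (E_root (isT : 0 < 1 < 5)%N) (E_root (isT : 0 < 2 < 5)%N)
  (E_root (isT : 0 < 3 < 5)%N) (E_root (isT : 0 < 4 < 5)%N) (elim_ok_E1 elim_okP) elim_okP).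
Qed.

Lemma rN_rel : - (215 / 24) - 3905 / 48 * s + a * (1 / 6 + 70 / 3 * s) + 3 * a ^+ 2 * s
  + rN * (9 / 4 * s + 153 / 4 * s ^+ 2) = 0.
Proof.
exact: (E1_rel (E_root (isT : 0 < 1 < 5)%N) (elim_ok_E1 elim_okP)).
Qed.

Variant solution (a b r A1 : K) (N : nat) : Prop :=
| Sol3 of N = 1%N & a = - (37 / 4) & b = - (149 / 24) & r = 65 / 3 & A1 = 7 / 3
| Sol4 of N = 1%N & a = 11 / 4 & b = 41 / 8 & r = 7 & A1 = 1
| Sol5 of N = 1%N & a = - (95 / 12) & b = - (685 / 216) & r = 175 / 9 & A1 = 25 / 9
| Sol6 of N = 2%N & a = - (1 / 4) & b = 151 / 24 & r = 20 / 3 & A1 = 8 / 3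
| Sol7 al of N = 1%N & al ^+ 2 - 4975 / 486 * al + 4225 / 144 = 0 & a = al - 5 / 2
    & b = - (5 / 6) + 43 / 54 * al & r = - (611 / 108) + 5981%:R / 3645 * al
    & A1 = 5 / 4 - 13 / 81 * al.

Lemma rN_solution (N : nat) : rN = r * N%:R -> solution a b r (A 1%N) N.
Proof.
move=> rNE; have A1E : A 1%N = s * rN by rewrite /s mulfVK.
have r0 : r != 0 by apply: contra_neq rN0 => r0; rewrite rNE r0 mul0r.
have := r_rel; have := A1_rel; have := rN_rel; have := rN_cases; rewrite A1E.
move: (s) => t cas e1 eb er.
have natE k : r = rN / k.+1%:R -> N = k.+1.
  move=> e; have /eqP : N%:R = k.+1%:R :> K.
    apply: (mulfI r0); rewrite -rNE {}e mulfVK //; by rewrite pnatr_eq0.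
  by rewrite eqr_nat => /eqP.
case: cas => -[tE aE].
- have RE : rN = 40 / 3.
    move: e1; rewrite tE aE => e1.
    by apply: (eq_mod (c := 100 / 198) e1); field.
  have rE : r = 20 / 3 by rewrite er tE aE RE; field.
  constructor 4; rewrite ?eb ?tE ?aE ?RE //; try by field.
  by apply: natE; rewrite rE RE; field.
- have : (a - 11 / 4) * (a + 95 / 12) = 0 by rewrite -[RHS]aE; field.
  move/eqP; rewrite mulf_eq0 subr_eq0 addr_eq0 => /orP[] /eqP {}aE.
    have RE : rN = 7.
      move: e1; rewrite tE aE => e1.
      by apply: (eq_mod (c := 196 / 216) e1); field.
    have rE : r = 7 by rewrite er tE aE RE; field.
    constructor 2; rewrite ?eb ?tE ?aE ?RE //; try by field.
    by apply: natE; rewrite rE RE; field.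
  have RE : rN = 175 / 9.
    move: e1; rewrite tE aE => e1.
    by apply: (eq_mod (c := 196 / 216) e1); field.
  have rE : r = 175 / 9 by rewrite er tE aE RE; field.
  constructor 3; rewrite ?eb ?tE ?aE ?RE //; try by field.
  by apply: natE; rewrite rE RE; field.
- have RE : rN = 65 / 3.
    move: e1; rewrite tE aE => e1.
    by apply: (eq_mod (c := 4225 / 2898%:R) e1); field.
  have rE : r = 65 / 3 by rewrite er tE aE RE; field.
  constructor 1; rewrite ?eb ?tE ?aE ?RE //; try by field.
  by apply: natE; rewrite rE RE; field.
have t2 : t ^+ 2 = 118 / 2717%:R * t - 45 / 2717%:R.
  by apply: (eq_mod (c := 1 / 2717%:R) tE); field.
have RE : rN = 2295203%:R / 708588%:R - 16250377%:R / 708588%:R * t.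
  apply: (eq_mod (c := - (13087468841%:R / 56528316288%:R) - 141664366415%:R / 113056632576%:R * t
      + 174328031735%:R / 113056632576%:R * t ^+ 2 + rN * (1 / 45 + 80291%:R / 797760%:R * t)) tE).
  apply: (eq_mod (c := - (1521191%:R / 1794960%:R) - 12832391%:R / 1794960%:R * t) e1).
  by rewrite aE; field.
have A1t : t * rN = 5 / 4 - 13 / 81 * (2635 / 486 - 13%:R * 1045%:R / 972 * t).
  by apply: (eq_mod (c := - (5981%:R / 708588%:R)) tE); rewrite RE; field.
have rE : r = rN.
  rewrite er A1t; apply: (eq_mod (c := 67925%:R / 1417176%:R) tE); rewrite aE RE; by field.
constructor 5 with (2635 / 486 - 13%:R * 1045%:R / 972 * t).
- by apply: natE; rewrite rE divr1.
- by apply: (eq_mod (c := 67925%:R / 944784%:R) tE); field.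
- by rewrite aE; field.
- by rewrite eb A1t aE; field.
- by rewrite rE RE; field.
- exact: A1t.
Qed.
End Solutions.

End LevelSem.


(* ---- polynomials in two variables *)
Section Bivariate.
Variable K : numFieldType.
Implicit Types (p q : {poly K}) (F G : {poly {poly K}}).

Lemma poly0_infinite (A : idomainType) (f : nat -> A) (P : {poly A}) :
  injective f -> (forall i, P.[f i] = 0) -> P = 0.
Proof.
move=> f_inj P0; apply/eqP/negPn/negP => nzP.
have := max_poly_roots nzP (rs := map f (iota 0 (size P))).
rewrite map_inj_uniq // iota_uniq size_map size_iota ltnn => /(_ _ isT) h.
by suff /h : all (root P) (map f (iota 0 (size P))); [by []|apply/allP => _ /mapP[i _ ->]; apply/rootP].
Qed.

Lemma poly_ext p q : (forall x, p.[x] = q.[x]) -> p = q.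
Proof.
move=> e; apply/eqP; rewrite -subr_eq0; apply/eqP.
apply: (@poly0_infinite _ (fun i : nat => i%:R : K)); last by move=> i; rewrite hornerD hornerN e subrr.
by move=> i j /eqP; rewrite eqr_nat => /eqP.
Qed.

Lemma poly2_ext F G : (forall x y, F.[y%:P].[x] = G.[y%:P].[x]) -> F = G.
Proof.
move=> e; apply/eqP; rewrite -subr_eq0; apply/eqP.
apply: (@poly0_infinite _ (fun i : nat => (i%:R : K)%:P)).
  by move=> i j /polyC_inj /eqP; rewrite eqr_nat => /eqP.
by move=> i; rewrite hornerD hornerN; apply: poly_ext => x; rewrite hornerD hornerN e subrr horner0.
Qed.

Lemma dx_swap F : dx F = swapXY (swapXY F)^`().
Proof.
apply/polyP => i; apply/polyP => j.
have -> : (dx F)`_i = (F`_i)^`() by rewrite /dx coef_map_id0 ?deriv0.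
rewrite [LHS]coef_deriv [RHS]coef_swapXY coef_deriv coefMn; congr (_ *+ _).
by rewrite [RHS]coef_swapXY.
Qed.

Lemma coef_dx F i : (dx F)`_i = (F`_i)^`().
Proof. by rewrite /dx coef_map_id0 ?deriv0. Qed.

Lemma size_dx F : (size (dx F) <= size F)%N.
Proof. by apply/leq_sizeP => j le; rewrite coef_dx nth_default // deriv0. Qed.

Lemma dxD F G : dx (F + G) = dx F + dx G.
Proof. by rewrite (dx_swap (F + G)) rmorphD /= derivD rmorphD /= -!dx_swap. Qed.

Lemma dxM F G : dx (F * G) = dx F * G + F * dx G.
Proof.
by rewrite (dx_swap (F * G)) rmorphM derivM rmorphD !rmorphM /= !swapXYK -!dx_swap.
Qed.

Lemma dxC p : dx p%:P = p^`()%:P.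
Proof. by apply/polyP=> i; rewrite coef_dx !coefC; case: eqP; rewrite ?deriv0. Qed.

Lemma dxX : dx 'X = 0 :> {poly {poly K}}.
Proof.
apply/polyP => i; rewrite coef_dx coefX coef0.
by case: (i == 1%N); rewrite ?deriv0 // -[(true : nat)%:R]/(1%:P) derivC.
Qed.

Lemma dx_comp F p : dx (F \Po ('X + p%:P)) =
  (dx F) \Po ('X + p%:P) + p^`()%:P * (dy F \Po ('X + p%:P)).
Proof.
elim/poly_ind: F => [|F c IH].
  by rewrite /dy deriv0 !comp_poly0 dx_swap !rmorph0 deriv0 rmorph0 comp_poly0 mulr0 addr0.
rewrite /dy !comp_polyD !comp_polyM !comp_polyX !comp_polyC !dxD !dxM !dxD IH !dxX !dxC.
rewrite derivD derivM derivX derivC addr0 mulr1 !comp_polyD !comp_polyM !comp_polyX !comp_polyC.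
rewrite ?comp_poly0 /dy; ring.
Qed.
End Bivariate.

Section Shape.
Variables (K : numFieldType) (f G : {poly K}).
Implicit Types (F lam : {poly {poly K}}) (l : {poly K}).

Let Q : {poly {poly K}} := - f%:P * 'X + G%:P.

Let QE F : Q * dy F = 'X * ((- f)%:P * dy F) + G%:P * dy F.
Proof. by rewrite /Q polyCN; ring. Qed.

Lemma cofactor_coef0 F l : is_cofactor 'X Q F l%:P -> G * F`_1 = l * F`_0.
Proof.
move=> /(congr1 (fun P : {poly {poly K}} => P`_0)).
by rewrite QE !coefD !coefXM !coefCM coef_deriv /= !add0r mulr1n.
Qed.

Lemma cofactor_coefS F l i : is_cofactor 'X Q F l%:P ->
  (F`_i)^`() - f *+ i.+1 * F`_i.+1 + G *+ i.+2 * F`_i.+2 = l * F`_i.+1.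
Proof.
move=> /(congr1 (fun P : {poly {poly K}} => P`_i.+1)).
rewrite QE !coefD !coefXM !coefCM !coef_deriv /= coef_dx => <-.
by ring.
Qed.

Lemma deriv_eq0 (p : {poly K}) : p^`() = 0 -> exists c, p = c%:P.
Proof.
move=> p0; exists p`_0; apply/polyP => -[|i]; rewrite coefC //=.
have := congr1 (fun q : {poly K} => q`_i) p0; rewrite coef_deriv coef0 => /eqP.
by rewrite mulrn_eq0 => /eqP.
Qed.

Lemma cofactor_shape F lam : F != 0 -> is_cofactor 'X Q F lam ->
  exists c l, [/\ c != 0, lam = l%:P & lead_coef F = c%:P].
Proof.
move=> nzF H; set M := (size F).-1.
have szF : size F = M.+1 by rewrite /M prednK // size_poly_gt0.
have szL : (size (lam * F)%R <= M.+2)%N.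
  rewrite -H; apply: leq_trans (size_polyD _ _) _; rewrite geq_max; apply/andP; split.
    apply: leq_trans (size_polyMleq _ _) _; rewrite size_polyX /=.
    by rewrite ltnS -szF size_dx.
  apply: leq_trans (size_polyMleq _ _) _.
  have szQ : (size Q <= 2)%N.
    rewrite (leq_trans (size_polyD _ _)) // geq_max (leq_trans (size_polyC_leq1 _)) // andbT.
    by rewrite -polyCN (leq_trans (size_polyMleq _ _)) // size_polyX addn2 /= ltnS size_polyC_leq1.
  have szd : (size (dy F) <= M)%N by rewrite -ltnS -szF lt_size_deriv.
  by apply: leq_trans (leq_pred _) _; apply: leq_trans (leq_add szQ szd) _; rewrite add2n.
have szl : (size lam <= 2)%N.
  have [->|nzl] := eqVneq lam 0; first by rewrite size_poly0.
  move: szL; by rewrite size_mul // szF addnS /= -add2n leq_add2r.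
have lamE : lam = (lam`_1)%:P * 'X + (lam`_0)%:P.
  apply/polyP=> i; rewrite coefD coefCM coefX coefC.
  case: i => [|[|i]] /=; rewrite ?mulr0 ?mulr1 ?add0r ?addr0 //.
  by rewrite nth_default // (leq_trans szl).
have LE : lam * F = (lam`_1)%:P * ('X * F) + (lam`_0)%:P * F by rewrite {1}lamE; ring.
have top : (lead_coef F)^`() = lam`_1 * lead_coef F.
  have := congr1 (fun P : {poly {poly K}} => P`_M.+1) H.
  rewrite QE LE !coefD !coefXM !coefCM coefXM coef_dx !coef_deriv /=.
  have F1 : F`_M.+1 = 0 by rewrite nth_default ?szF.
  have F2 : F`_M.+2 = 0 by rewrite nth_default ?szF.
  by rewrite F1 F2 !mul0rn !mulr0 !addr0 lead_coefE -/M.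
have l1 : lam`_1 = 0.
  apply/eqP; apply: contraT => nzl; have nzlead : lead_coef F != 0 by rewrite lead_coef_eq0.
  have := lt_size_deriv nzlead; rewrite top ltnNge size_mul //.
  by rewrite -(prednK (n := size lam`_1)) ?size_poly_gt0 // addSn leq_addl.
have [c cE] := deriv_eq0 (etrans top (etrans (congr1 (fun x => x * _) l1) (mul0r _))).
exists c, lam`_0; split => //; last by rewrite {1}lamE l1 mul0r add0r.
by rewrite -polyC_eq0 -cE lead_coef_eq0.
Qed.
End Shape.


(* ---- multiplicity at the second place at infinity *)
Section Gauss.
Variable K : numClosedFieldType.
Implicit Types (F q d : {poly {poly K}}) (c : {poly K}).

Lemma dvd_linear_prod (xi : K) q d c F : ('X - xi%:P)%:P * F = q * d ->
  (exists q', q = ('X - xi%:P)%:P * q') \/ (exists d', d = ('X - xi%:P)%:P * d').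
Proof.
move=> e.
have ext (p : {poly {poly K}}) : map_poly (horner_eval xi) p = 0 -> exists p', p = ('X - xi%:P)%:P * p'.
  move=> p0; exists (map_poly (fun c => c %/ ('X - xi%:P)) p); apply/polyP => i.
  rewrite coefCM coef_map_id0 ?div0p // mulrC divpK //.
  rewrite dvdp_XsubCl; apply/rootP.
  by have := congr1 (fun r : {poly K} => r`_i) p0; rewrite coef_map coef0.
have := congr1 (map_poly (horner_eval xi)) e.
rewrite !rmorphM /= map_polyC /= /horner_eval hornerXsubC subrr mul0r => /esym/eqP.
by rewrite mulf_eq0 => /orP[] /eqP /ext ?; [left|right].
Qed.

Lemma gauss_split F q d c : c != 0 -> c%:P * F = q * d ->
  exists q' d', [/\ F = q' * d', size q' = size q & size d' = size d].
Proof.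
have [n] := ubnP (size c); elim: n c q d => // n IH c q d szc c0 e.
have [c1|/negP c1] := boolP (size c == 1).
  have /size_poly1P[k k0 cE] := c1.
  exists (k^-1%:P%:P * q), d; split=> //; last first.
    by rewrite size_Cmul // polyC_eq0 invr_eq0.
  by rewrite -mulrA -e cE mulrA -!polyCM mulVf // !polyC1 mul1r.
have /closed_rootP[xi /factor_theorem[c' cE]] : size c != 1 by apply/negP.
have nzX : ('X - xi%:P)%:P != 0 :> {poly {poly K}} by rewrite polyC_eq0 polyXsubC_eq0.
have c'0 : c' != 0 by apply: contra_neq c0 => c'0; rewrite cE c'0 mul0r.
have szc' : (size c' < n)%N.
  by move: szc; rewrite cE size_mul ?polyXsubC_eq0 // size_XsubC addn2.
have : ('X - xi%:P)%:P * (c'%:P * F) = q * d by rewrite mulrA -polyCM [_ * c']mulrC -cE e.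
move=> /[dup] e' /dvd_linear_prod[] // [p pE].
  have [|q' [d' [FE sq sd]]] := IH c' p d szc' c'0.
    by apply: (mulfI nzX); rewrite e' pE mulrA.
  by exists q', d'; split; rewrite // sq pE size_Cmul // polyXsubC_eq0.
have [|q' [d' [FE sq sd]]] := IH c' q p szc' c'0.
  by apply: (mulfI nzX); rewrite e' pE mulrCA.
by exists q', d'; split; rewrite // sd pE size_Cmul // polyXsubC_eq0.
Qed.

Lemma irreducible_size F q d c : irreducible_elt F -> c != 0 -> c%:P * F = q * d ->
  size q = 1%N \/ size d = 1%N.
Proof.
move=> [_ _ irr] c0 /(gauss_split c0)[q' [d' [/irr + <- <-]]].
by rewrite !poly_unitE => -[] /andP[/eqP]; [left|right].
Qed.

Lemma deriv_neq0 F : (1 < size F)%N -> F^`() != 0.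
Proof.
case E: (size F) => [|[|n]] // _; apply/eqP => /(congr1 (fun p : {poly {poly K}} => p`_n)).
rewrite coef_deriv coef0 -scaler_nat => /eqP; rewrite scaler_eq0 pnatr_eq0 /=.
by rewrite -[n.+1]/(n.+2.-1) -E -lead_coefE lead_coef_eq0 -size_poly_eq0 E.
Qed.

Lemma irreducible_resultant F : irreducible_elt F -> (1 < size F)%N -> resultant F F^`() != 0.
Proof.
move=> irr szF; rewrite resultant_eq0 -leqNgt.
have F0 : F != 0 by rewrite -size_poly_gt0 ltnW.
have szd : (size (gcdp F F^`()) < size F)%N.
  by apply: leq_ltn_trans (lt_size_deriv F0); rewrite dvdp_leq ?deriv_neq0 ?dvdp_gcdr.
have /Pdiv.Idomain.dvdpP[[c q] /= c0 e] := dvdp_gcdl F F^`().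
have e' : c%:P * F = q * gcdp F F^`() by rewrite mul_polyC.
case: (irreducible_size irr c0 e') => [sq|->//].
have := congr1 (fun p : {poly {poly K}} => size p) e'; rewrite size_Cmul //.
have /size_poly1P[k k0 ->] : size q == 1 by rewrite sq.
by rewrite size_Cmul // => sz; rewrite sz ltnn in szd.
Qed.
End Gauss.


Section Homogenise.
Variable K : numFieldType.
Implicit Types (P R : {poly {poly K}}) (Y z : {poly K}).

Definition homog z e P : {poly {poly K}} := \poly_(i < e.+1) (P`_i * z ^+ (e - i)).

Lemma coef_homog z e P i : (homog z e P)`_i = if (i < e.+1)%N then P`_i * z ^+ (e - i) else 0.
Proof. by rewrite coef_poly. Qed.

Lemma coef_comp_scale z P i : (P \Po (z%:P * 'X))`_i = P`_i * z ^+ i.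
Proof.
rewrite comp_polyE coef_sum.
have [lt|ge] := ltnP i (size P); last first.
  rewrite nth_default // mul0r big1 // => j _.
  rewrite exprMn -rmorphXn /= coefZ coefCM coefXn; case: eqP => [e|]; last by rewrite !mulr0.
  by move: (ltn_ord j); rewrite -e ltnNge ge.
rewrite (bigD1 (Ordinal lt)) //= big1 ?addr0 => [|j ne];
  rewrite exprMn -rmorphXn /= coefZ coefCM coefXn.
  by rewrite eqxx mulr1.
case: eqP => [e|]; last by rewrite !mulr0.
by move: ne; rewrite -val_eqE /= -e eqxx.
Qed.

Lemma homog_comp z e P : (size P <= e.+1)%N ->
  homog z e P \Po (z%:P * 'X) = (z ^+ e)%:P * P.
Proof.
move=> sz; apply/polyP => i; rewrite coef_comp_scale coefCM coef_homog.
case: ltnP => [lt|ge]; last by rewrite mul0r nth_default ?mulr0 // (leq_trans sz).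
by rewrite -mulrA -exprD subnK // mulrC.
Qed.

Lemma comp_scale_inj z P R : z != 0 -> P \Po (z%:P * 'X) = R \Po (z%:P * 'X) -> P = R.
Proof.
move=> z0 e; apply/polyP => i; apply: (mulIf (expf_neq0 i z0)).
by rewrite -!coef_comp_scale e.
Qed.

Lemma homogM z e1 e2 P R : z != 0 -> (size P <= e1.+1)%N -> (size R <= e2.+1)%N ->
  homog z (e1 + e2) (P * R) = homog z e1 P * homog z e2 R.
Proof.
move=> z0 s1 s2; apply: (comp_scale_inj z0).
rewrite comp_polyM !homog_comp //; first by rewrite exprD polyCM; ring.
by apply: leq_trans (size_polyMleq _ _) _; move: s1 s2; lia.
Qed.

Lemma homogD z e P R : homog z e (P + R) = homog z e P + homog z e R.
Proof.
by apply/polyP => i; rewrite coefD !coef_homog coefD; case: ifP; rewrite ?addr0 // mulrDl.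
Qed.

Lemma deriv_homog z e P : (homog z e.+1 P)^`() = homog z e P^`().
Proof.
apply/polyP => i; rewrite coef_deriv !coef_homog coef_deriv ltnS.
by case: ifP => _; rewrite ?mul0rn // subSS mulrnAl.
Qed.

Lemma size_homog_horner (m s e : nat) Y P : (size Y <= m.+3)%N ->
  (forall i, (size (P`_i)%R <= s)%N) -> (size (homog 'X^m e P).[Y] <= s + m * e + 2 * e)%N.
Proof.
move=> szY szP; rewrite horner_poly; apply: leq_trans (size_sum _ _ _) _.
apply/bigmax_leqP => i _; have := ltn_ord i; set j := nat_of_ord i => le.
have sY : (size (Y ^+ j) <= j * m.+2 + 1)%N.
  elim: j {le} => [|k IH]; first by rewrite expr0 size_poly1.
  rewrite exprS; apply: leq_trans (size_polyMleq _ _) _; move: IH szY; lia.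
have sz : (size ('X^m ^+ (e - j) : {poly K}) = (m * (e - j)).+1)%N by rewrite -exprM size_polyXn.
apply: leq_trans (size_polyMleq _ _) _.
have := size_polyMleq P`_j ('X^m ^+ (e - j)); rewrite sz; have := szP j.
have h : (m * (e - j) + j * m.+2 <= m * e + 2 * e)%N.
  rewrite -[in (m * e)%N](subnK (_ : j <= e)%N) // mulnDr !mulnS; move: (m * _)%N => u.
  by rewrite [(j * m)%N]mulnC; lia.
move=> sP sPz; rewrite -subn1 leq_subLR; apply: leq_trans (leq_add sPz sY) _.
by rewrite addnS /= addnA addn1 add1n ltnS -addnA -[(s + _ + _)%N]addnA leq_add.
Qed.
End Homogenise.

Section SizeBounds.
Variable K : numFieldType.

Lemma size_mul_le (p q : {poly K}) a b c : (size p <= a)%N -> (size q <= b)%N -> (a + b <= c.+1)%N ->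
  (size (p * q)%R <= c)%N.
Proof. by move=> pa qb abc; apply: leq_trans (size_polyMleq _ _) _; lia. Qed.

Lemma size_add_le (p q : {poly K}) c : (size p <= c)%N -> (size q <= c)%N -> (size (p + q)%R <= c)%N.
Proof. by move=> pc qc; apply: leq_trans (size_polyD _ _) _; rewrite geq_max pc. Qed.

Lemma size_deriv_le (p : {poly K}) c : (size p <= c)%N -> (size p^`() <= c.-1)%N.
Proof.
move=> pc; have [->|p0] := eqVneq p 0; first by rewrite deriv0 size_poly0.
by have := lt_size_deriv p0; lia.
Qed.

End SizeBounds.

Section Approx.
Variable K : numFieldType.
Variables (f G : {poly K}).
Hypotheses (szf : (size f <= 3)%N) (f2 : f`_2 != 0) (szG : (size G <= 5)%N).

(* z^3 times the defect of the truncated series Y/z *)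
Definition defect (z Y : {poly K}) : {poly K} :=
  z ^+ 2 * (f * Y - G * z) + Y * (z * Y^`() - z^`() * Y).

Lemma defectD z Y W : defect z (Y + W) = defect z Y + (z ^+ 2 * f * W
  + W * (z * Y^`() - z^`() * Y) + (Y + W) * (z * W^`() - z^`() * W)).
Proof. by rewrite /defect derivD; ring. Qed.

Lemma approx m j : (j <= m.+3)%N ->
  exists2 Y : {poly K}, (size Y <= m.+3)%N & (size (defect 'X^m Y) <= 2 * m + 2 + (m.+3 - j))%N.
Proof.
elim: j => [_|j IH jm].
  exists 0; first by rewrite size_poly0.
  rewrite /defect mulr0 sub0r mul0r addr0.
  apply: (size_mul_le (a := (2 * m).+1) (b := m + 5)); last by lia.
    by rewrite -exprM size_polyXn mulnC.
  by rewrite size_polyN; apply: (size_mul_le (a := 5) (b := m.+1)); rewrite ?size_polyXn //; lia.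
have [Y szY szE] := IH (ltnW jm); pose e := (m + 2 - j)%N.
have eE : (m.+3 - j = e.+1)%N by rewrite /e; lia.
pose c := - (defect 'X^m Y)`_(2 * m + 2 + e) / f`_2.
pose W : {poly K} := c%:P * 'X^e.
have szW : (size W <= e.+1)%N.
  by apply: (size_mul_le (a := 1) (b := e.+1)); rewrite ?size_polyC_leq1 ?size_polyXn.
have szz : (size ('X^m : {poly K}) <= m.+1)%N by rewrite size_polyXn.
have szz' : (size (('X^m : {poly K})^`()) <= m)%N by exact: (size_deriv_le szz).
have em : (e <= m.+2)%N by rewrite /e; lia.
exists (Y + W); first by apply: size_add_le => //; apply: leq_trans szW _.
have -> : (2 * m + 2 + (m.+3 - j.+1) = 2 * m + 2 + e)%N by rewrite /e; lia.
have szYW : (size (Y + W)%R <= m.+3)%N by apply: size_add_le => //; apply: leq_trans szW _.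
have szY' := size_deriv_le szY; have szW' := size_deriv_le szW.
have low1 : (size (W * ('X^m * Y^`() - ('X^m)^`() * Y))%R <= 2 * m + 2 + e)%N.
  apply: (size_mul_le szW (b := 2 * m + 2)); last by lia.
  apply: size_add_le; first by apply: (size_mul_le szz szY'); lia.
  by rewrite size_polyN; apply: (size_mul_le szz' szY); lia.
have low2 : (size ((Y + W) * ('X^m * W^`() - ('X^m)^`() * W))%R <= 2 * m + 2 + e)%N.
  apply: (size_mul_le szYW (b := m + e)); last by lia.
  apply: size_add_le; first by apply: (size_mul_le szz szW'); lia.
  by rewrite size_polyN; apply: (size_mul_le szz' szW); lia.
apply/leq_sizeP => i; rewrite leq_eqVlt => /orP[/eqP<-|lt].
  rewrite defectD !coefD (leq_sizeP _ _ low1) // (leq_sizeP _ _ low2) // !addr0.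
  have -> : 'X^m ^+ 2 * f * W = c%:P * (f * 'X^(2 * m + e)).
    by rewrite /W exprD mulnC exprM; ring.
  rewrite coefCM coefMXn ltnNge; have -> : (2 * m + e <= 2 * m + 2 + e)%N by lia.
  have -> : (2 * m + 2 + e - (2 * m + e) = 2)%N by lia.
  by rewrite /c /= divfK // /defect coefD subrr.
rewrite defectD coefD (leq_sizeP _ _ szE) ?add0r; last by rewrite eE; lia.
rewrite !coefD (leq_sizeP _ _ low1) ?(ltnW lt) // (leq_sizeP _ _ low2) ?(ltnW lt) // !addr0.
have szT : (size ('X^m ^+ 2 * f * W)%R <= 2 * m + 2 + e.+1)%N.
  apply: (size_mul_le (a := 2 * m + 3) _ szW); last by lia.
  by apply: (size_mul_le (a := (2 * m).+1) _ szf); rewrite -?exprM ?size_polyXn; lia.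
by rewrite (leq_sizeP _ _ szT) //; lia.
Qed.
End Approx.


Section PartialDerivatives.
Variable K : numFieldType.

Lemma horner_pderiv (P : {poly {poly K}}) (Y : {poly K}) :
  P.[Y]^`() = (dx P).[Y] + Y^`() * P^`().[Y].
Proof.
elim/poly_ind: P => [|P c IH].
  have -> : dx 0 = 0 :> {poly {poly K}} by rewrite -polyC0 dxC deriv0.
  by rewrite !deriv0 !horner0 deriv0 mulr0 addr0.
rewrite dxD dxM dxX dxC derivD derivM derivX derivC !hornerE derivD derivM IH; ring.
Qed.

Lemma dx_deriv (P : {poly {poly K}}) : dx P^`() = (dx P)^`().
Proof. by apply/polyP => i; rewrite coef_dx !coef_deriv coef_dx derivMn. Qed.
End PartialDerivatives.

Section HomogenisedEquation.
Variable K : numFieldType.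
Variables (f G l z : {poly K}) (F : {poly {poly K}}) (N : nat).
Hypotheses (szF : size F = N.+2) (monF : F \is monic).
Hypothesis eqF : is_cofactor 'X (- f%:P * 'X + G%:P) F l%:P.
Let Fh := homog z N.+1 F.

Let Fh_le j k : (j + k = N.+1)%N -> Fh`_j = F`_j * z ^+ k.
Proof. by move=> jk; rewrite coef_homog ifT; [congr (_ * _ ^+ _); lia|lia]. Qed.

Let Fh_gt j : (N.+1 < j)%N -> Fh`_j = 0.
Proof. by move=> jk; rewrite coef_homog ifF //; apply/negbTE; lia. Qed.

Lemma homog_pde : 'X * (z%:P * dx Fh) =
  ((z ^+ 2 * l)%:P + (z^`() *+ N.+1)%:P * 'X) * Fh +
  ((z ^+ 2 * f)%:P * 'X - (z ^+ 3 * G)%:P - z^`()%:P * 'X^2) * Fh^`().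
Proof.
transitivity ((z ^+ 2 * l)%:P * Fh - (z ^+ 3 * G)%:P * Fh^`() + 'X * ((z^`() *+ N.+1)%:P * Fh
   + (z ^+ 2 * f)%:P * Fh^`() - z^`()%:P * ('X * Fh^`()))); last by ring.
have lead1 : F`_N.+1 = 1 by rewrite -(monicP monF) lead_coefE szF.
apply/polyP => -[|j].
  rewrite coefD coefB !coefXM !coefCM /= coef_deriv addr0.
  rewrite (@Fh_le 0 N.+1) // (@Fh_le 1 N) //= mulr1n.
  have e0 := cofactor_coef0 eqF; symmetry.
  transitivity (z ^+ 3 * z ^+ N * (l * F`_0 - G * F`_1)); first by rewrite (exprS z N); ring.
  by rewrite e0 subrr mulr0.
rewrite coefD coefB !coefXM !coefCM /= coefB coefD !coefCM coefXM coef_dx !coef_deriv.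
have jE : (if j == 0%N then 0 else Fh`_j.-1.+1 *+ j.-1.+1) = Fh`_j *+ j.
  by case: j => [|j] /=; rewrite ?mulr0n.
rewrite jE {jE}; have rec := cofactor_coefS j eqF.
have [lt|] := ltnP j N.
  have [k kE] : exists k, (j.+2 + k = N.+1)%N by exists (N - j.+1)%N; lia.
  rewrite (@Fh_le j k.+2) ?(@Fh_le j.+1 k.+1) ?(@Fh_le j.+2 k); try lia.
  have -> : N.+1 = (j + k.+2)%N by lia.
  rewrite derivM deriv_exp /=.
  have -> : (F`_j)^`() = l * F`_j.+1 + f *+ j.+1 * F`_j.+1 - G *+ j.+2 * F`_j.+2 by rewrite -rec; ring.
  by rewrite !(exprS z); ring.
rewrite leq_eqVlt => /orP[/eqP jN|].
  move: rec; rewrite -jN [F`_N.+2]nth_default ?szF // lead1 mulr0 addr0 => rec.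
  rewrite (@Fh_le N 1) ?addn1 // (@Fh_le N.+1 0) ?addn0 // Fh_gt // lead1 !expr0 expr1.
  rewrite derivM.
  have -> : (F`_N)^`() = l * 1 + f *+ N.+1 * 1 by rewrite -rec; ring.
  by ring.
rewrite leq_eqVlt => /orP[/eqP jN|lt].
  have FE : Fh`_j = 1 by rewrite -jN (@Fh_le N.+1 0) ?addn0 // lead1 mulr1.
  rewrite FE !Fh_gt; try lia; by rewrite -jN derivC; ring.
rewrite !Fh_gt; try lia; by rewrite deriv0; ring.
Qed.
Lemma taylor0 Y : z * Y * Fh.[Y]^`() - (z ^+ 2 * l + z^`() *+ N.+1 * Y) * Fh.[Y] =
  defect f G z Y * Fh^`().[Y].
Proof.
have := congr1 (fun P : {poly {poly K}} => P.[Y]) homog_pde.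
rewrite horner_pderiv /defect !(hornerM, hornerD, hornerN, hornerC, hornerX, hornerXn) => h.
apply/eqP; rewrite -subr_eq0; apply/eqP; move/eqP: h; rewrite -subr_eq0 => /eqP <-; ring.
Qed.

Lemma taylor1 Y : z * Y * Fh^`().[Y]^`() -
  (z ^+ 2 * (l + f) + (z^`() *+ N.+1 * Y - z^`() *+ 2 * Y + z * Y^`())) * Fh^`().[Y] =
  z^`() *+ N.+1 * Fh.[Y] - z * Fh.[Y]^`() + defect f G z Y * Fh^`()^`().[Y].
Proof.
have := congr1 (fun P : {poly {poly K}} => P^`().[Y]) homog_pde.
rewrite !horner_pderiv dx_deriv /defect !(derivM, derivD, derivN, derivC, derivX, derivXn).
rewrite !(hornerM, hornerD, hornerN, hornerC, hornerX, hornerXn, hornerMn) => h.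
apply/eqP; rewrite -subr_eq0; apply/eqP; move/eqP: h; rewrite -subr_eq0 => /eqP <-; ring.
Qed.
End HomogenisedEquation.


Section Degrees.
Variable K : numFieldType.
Implicit Types (p q S W R Phi : {poly K}).

Lemma size_solution m S W R Phi : size S = (2 * m + 3)%N -> (size W <= 2 * m + 3)%N ->
  W * Phi^`() - S * Phi = R -> Phi != 0 -> (size Phi + (2 * m + 2) = size R)%N.
Proof.
move=> szS szW <- nzPhi; have nzS : S != 0 by rewrite -size_poly_eq0 szS addnS.
have szSP : size (S * Phi) = (2 * m + 2 + size Phi)%N.
  by rewrite size_mul // szS; move: (size Phi) => x; lia.
have szP : (0 < size Phi)%N by rewrite size_poly_gt0.
have szWP : (size (W * Phi^`())%R < size (S * Phi)%R)%N.
  rewrite szSP; apply: leq_ltn_trans (_ : 2 * m + 1 + size Phi < _)%N; last by move: (size Phi) => x; lia.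
  have := size_deriv_le (leqnn (size Phi)) => szP'.
  by apply: (size_mul_le szW szP'); move: (size Phi) szP => x; lia.
by rewrite addrC size_polyDl size_polyN // szSP addnC.
Qed.
End Degrees.

Section Multiplicity.
Variable K : numClosedFieldType.
Variables (f G l : {poly K}) (F : {poly {poly K}}) (N : nat).
Hypotheses (szf : (size f <= 3)%N) (f2 : f`_2 = 3) (szG : (size G <= 5)%N) (szl : (size l <= 3)%N).
Hypotheses (irrF : irreducible_elt F) (szF : size F = N.+2) (monF : F \is monic).
Hypothesis eqF : is_cofactor 'X (- f%:P * 'X + G%:P) F l%:P.

Lemma cofactor_lead : l`_2 = 0 \/ l`_2 = -3.
Proof.
have [->|l20] := eqVneq l`_2 0; first by left.
have [->|l23] := eqVneq l`_2 (-3); first by right.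
exfalso; have [rho [U [V [rho0 bez]]]] : exists rho U V, rho != 0 /\ rho%:P = U * F + V * F^`().
  have szF1 : (1 < size F)%N by rewrite szF.
  have [szF'|szF'] := ltnP 1 (size F^`()).
    have [[U V] /= _ e] := resultant_in_ideal szF1 szF'.
    by exists (resultant F F^`()), U, V; rewrite irreducible_resultant.
  have F'E := size1_polyC szF'.
  exists (F^`())`_0, 0, 1; rewrite mul0r add0r mul1r -F'E -polyC_eq0 -F'E; split=> //.
  exact: deriv_neq0.
have [s sP] : exists s, forall P, P \in [:: F^`(); F^`()^`(); U; V] -> forall i, (size (P`_i)%R <= s)%N.
  pose b (P : {poly {poly K}}) := (\max_(i < size P) size (P`_i)%R)%N.
  exists (\max_(P <- [:: F^`(); F^`()^`(); U; V]) b P)%N => P PL i.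
  apply: leq_trans (_ : (b P <= _)%N); last exact: (@leq_bigmax_seq _ _ xpredT b P PL isT).
  have [lt|ge] := ltnP i (size P); last by rewrite nth_default // size_poly0.
  exact: (leq_bigmax (Ordinal lt)).
have mem4 : [/\ F^`() \in [:: F^`(); F^`()^`(); U; V], F^`()^`() \in [:: F^`(); F^`()^`(); U; V],
  U \in [:: F^`(); F^`()^`(); U; V] & V \in [:: F^`(); F^`()^`(); U; V]].
  by split; rewrite !inE eqxx ?orbT.
case: mem4 => /sP sF1 /sP sF2 /sP sU /sP sV {sP}.
pose e := (size U + size V)%N; pose m := (2 * s + 2 * e + 2 * N + 2)%N.
have f20 : f`_2 != 0 by rewrite f2 pnatr_eq0.
have [Y szY szE] := approx szf f20 szG (leqnn m.+3).
rewrite subnn addn0 in szE; pose z : {poly K} := 'X^m.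
have z0 : z != 0 by rewrite monic_neq0 ?monicXn.
have szz : (size z <= m.+1)%N by rewrite size_polyXn.
have szz' : (size z^`() <= m)%N by exact: (size_deriv_le szz).
pose Fh := homog z N.+1 F.
pose Phi0 := Fh.[Y]; pose Phi1 := Fh^`().[Y]; pose Phi2 := Fh^`()^`().[Y].
have bnd k (P : {poly {poly K}}) : (forall i, (size (P`_i)%R <= s)%N) -> (size (homog z k P).[Y] <= s + m * k + 2 * k)%N.
  by move=> sP; apply: size_homog_horner.
have FhE : Fh^`() = homog z N F^`() by rewrite deriv_homog.
have sz1 : (size Phi1 <= s + m * N + 2 * N)%N by rewrite /Phi1 FhE; apply: bnd.
have sz2 : (size (defect f G z Y * Phi2)%R <= m + 1 + s + m * N + 2 * N)%N.
  rewrite /Phi2 FhE; case: (N) => [|N'].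
    have -> : (homog z 0 F^`())^`() = 0.
      by apply/polyP => i; rewrite coef_deriv coef_homog ltnS /= mul0rn coef0.
    by rewrite horner0 mulr0 size_poly0.
  rewrite deriv_homog; have := bnd N' _ sF2 => h.
  by apply: (size_mul_le szE h); rewrite mulnS; move: (m * N')%N => x; lia.
(* the first two Taylor coefficients at Y *)
have eq0 := taylor0 z szF monF eqF Y; have eq1 := taylor1 z szF monF eqF Y.
rewrite -/Fh -/Phi0 -/Phi1 -/Phi2 in eq0 eq1.
have szW : (size (z * Y)%R <= 2 * m + 3)%N by apply: (size_mul_le szz szY); lia.
have szY' := size_deriv_le szY.
(* a coefficient -n or 3-n that does not vanish keeps the x^(2m+2) term *)
have sizeS (h w : {poly K}) : (size h <= 3)%N -> h`_2 != 0 -> (size w <= 2 * m + 2)%N ->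
    size (z ^+ 2 * h + w) = (2 * m + 3)%N.
  move=> szh h2 szw; have szh3 : size h = 3%N.
    by apply/eqP; rewrite eqn_leq szh ltnNge; apply: contra h2 => /leq_sizeP ->.
  have h0 : h != 0 by rewrite -size_poly_eq0 szh3.
  have szzh : size (z ^+ 2 * h) = (2 * m + 3)%N.
    have -> : z ^+ 2 = 'X^(m * 2) by rewrite exprM.
    rewrite mulrC size_mulXn // szh3; lia.
  by rewrite size_polyDl // szzh; lia.
have w0 : (size (z^`() *+ N.+1 * Y)%R <= 2 * m + 2)%N.
  rewrite -scaler_nat -scalerAl; apply: leq_trans (size_scale_leq _ _) _.
  by apply: (size_mul_le szz' szY); lia.
have w0' : (size (z^`() *+ 2 * Y)%R <= 2 * m + 2)%N.
  rewrite -scaler_nat -scalerAl; apply: leq_trans (size_scale_leq _ _) _.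
  by apply: (size_mul_le szz' szY); lia.
have w1 : (size (z * Y^`())%R <= 2 * m + 2)%N by apply: (size_mul_le szz szY'); lia.
have S0 := sizeS l _ szl l20 w0.
have lf2 : (l + f)`_2 != 0 by rewrite coefD f2 addr_eq0.
have S1 : size (z ^+ 2 * (l + f) + (z^`() *+ N.+1 * Y - z^`() *+ 2 * Y + z * Y^`())) = (2 * m + 3)%N.
  apply: sizeS => //; first exact: size_add_le.
  by do 2?apply: size_add_le; rewrite ?size_polyN.
have sz0 : (size Phi0 <= s + m * N + 2 * N)%N.
  have [->|nz0] := eqVneq Phi0 0; first by rewrite size_poly0.
  have := size_solution S0 szW eq0 nz0.
  have : (size (defect f G z Y * Phi1)%R <= (2 * m + 1) + (s + m * N + 2 * N))%N.
    by apply: (size_mul_le szE sz1); lia.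
  move: (size _) (size _) => x y; lia.
have szPhi1 : Phi1 != 0 -> (size Phi1 + m.+1 <= s + m * N + 2 * N)%N.
  move=> nz1; have := size_solution S1 szW eq1 nz1.
  have : (size (z^`() *+ N.+1 * Phi0 - z * Phi0^`() + defect f G z Y * Phi2)%R
      <= m + 1 + s + m * N + 2 * N)%N.
    have sz0' := size_deriv_le sz0.
    apply: size_add_le => //; apply: size_add_le.
      rewrite -scaler_nat -scalerAl; apply: leq_trans (size_scale_leq _ _) _.
      by apply: (size_mul_le szz' sz0); clear; move: m (m * N)%N => x y; lia.
    by rewrite size_polyN; apply: (size_mul_le szz sz0'); clear; move: m (m * N)%N => x y; lia.
  move: (size _) (size _) => x y; lia.
have bezY : rho * z ^+ (e + N.+1) = (homog z e U).[Y] * Phi0 + (homog z e.+1 V).[Y] * Phi1.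
  have eUF : homog z e U * Fh = homog z (e + N.+1) (U * F).
    by rewrite homogM ?szF // leqW // leq_addr.
  have eVF : homog z e.+1 V * homog z N F^`() = homog z (e + N.+1) (V * F^`()).
    rewrite -addSnnS homogM //; first by rewrite !leqW // leq_addl.
    by rewrite -ltnS -szF lt_size_deriv // -size_poly_gt0 szF.
  rewrite /Phi0 /Phi1 FhE -!hornerM -hornerD eUF eVF -homogD -bez.
  rewrite (_ : homog z (e + N.+1) rho%:P = (rho * z ^+ (e + N.+1))%:P) ?hornerC //.
  apply/polyP => -[|i]; rewrite coef_homog !coefC /= ?subn0 //.
  by rewrite mul0r if_same.
have : (m * (e + N.+1) < size (rho * z ^+ (e + N.+1))%R)%N.
  have -> : z ^+ (e + N.+1) = 'X^(m * (e + N.+1)) by rewrite exprM.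
  by rewrite size_mulXn // -[X in (X < _)%N]addn0 ltn_add2l size_poly_gt0.
apply/negP; rewrite -leqNgt bezY.
have hU := bnd e U sU; have hV := bnd e.+1 V sV.
have mE : (m * (e + N.+1) = m * e + m * N + m)%N by rewrite mulnDr mulnS; lia.
apply: size_add_le.
  by apply: (size_mul_le hU sz0); rewrite mE; move: (m * e)%N (m * N)%N => x y; rewrite /m; lia.
have [->|nz1] := eqVneq Phi1 0; first by rewrite mulr0 size_poly0.
have le_m := leq_trans (leq_addl _ _) (szPhi1 nz1).
have {}szPhi1 : (size Phi1 <= s + m * N + 2 * N - m.+1)%N.
  by rewrite (leq_trans _ (leq_sub2r m.+1 (szPhi1 nz1))) ?addnK.
apply: (size_mul_le hV szPhi1); rewrite mE mulnS.
have mge : (2 * s + 2 * e + 2 * N + 2 <= m)%N by [].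
move: (m * e)%N (m * N)%N le_m => x y le_m; clear -mge le_m; clearbody m; clearbody e; lia.
Qed.
End Multiplicity.


(* ---- shifted coordinates *)
Section ShiftedEquation.
Variables (K : numFieldType) (alpha e sigma delta : K).
Implicit Types (F : {poly {poly K}}) (l : {poly K}).

Definition shift_a := alpha - 5 / 2.
Definition shift_b := 5 / 6 * shift_a - sigma / 3.
Definition shift_kappa := 45 / 4 - 3 * alpha - e.
Definition shift_r := 5 / 2 * shift_b - delta.
Definition shift_q : {poly K} := 'X^3 + (3 / 2)%:P * 'X^2 + shift_a%:P * 'X + shift_b%:P.

Definition shifted F : {poly {poly K}} := F \Po ('X - shift_q%:P).
Definition shift_Q : {poly {poly K}} :=
  (3 *: 'X - (5 / 2)%:P)%:P * 'X + (shift_kappa *: 'X^2 + shift_r%:P)%:P.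

Lemma shift_QE : (lienardQ alpha e sigma delta \Po ('X - shift_q%:P)) + ('X - shift_q%:P) * shift_q^`()%:P
  = shift_Q.
Proof.
have qE x : shift_q.[x] = x ^+ 3 + 3 / 2 * x ^+ 2 + shift_a * x + shift_b.
  by rewrite /shift_q !(hornerD, hornerM, hornerC, hornerX, hornerXn).
have q'E x : shift_q^`().[x] = 3 * x ^+ 2 + 3 * x + shift_a.
  rewrite /shift_q !(derivD, derivM, derivC, derivX, derivXn) /= !(hornerD, hornerM, hornerMn, hornerC, hornerX, hornerXn).
  by field.
move: shift_q qE q'E => q qE q'E; apply: poly2_ext => x y; rewrite hornerD horner_comp /lienardQ /shift_Q.
rewrite !(hornerD, hornerM, hornerN, hornerC, hornerX, hornerXn, hornerZ) qE q'E.
by rewrite /shift_kappa /shift_r /shift_b /shift_a; field.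
Qed.

Lemma shifted_eq F l : is_cofactor 'X (lienardQ alpha e sigma delta) F l%:P ->
  is_cofactor ('X - shift_q%:P) shift_Q (shifted F) l%:P.
Proof.
rewrite /is_cofactor => /(congr1 (comp_poly ('X - shift_q%:P))).
rewrite !(comp_polyM, comp_polyD, comp_polyX, comp_polyC) => h.
rewrite -shift_QE /shifted -polyCN dx_comp derivN /dy deriv_comp.
have -> : ('X + (- shift_q)%:P)^`() = 1 by rewrite derivD derivX derivC addr0.
by rewrite mulr1 !polyCN -h /dy /lienardQ !(comp_polyM, comp_polyD, comp_polyX, comp_polyC); ring.
Qed.

Definition inx F : {poly {poly K}} := swapXY (shifted F).

Lemma swap_cofactor (q p1 p2 l : {poly K}) F :
  is_cofactor ('X - q%:P) (p1%:P * 'X + p2%:P) F l%:P ->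
  ('X%:P - q^:P) * (swapXY F)^`() + (p1^:P * 'X%:P + p2^:P) * dx (swapXY F) = l^:P * swapXY F.
Proof.
have sD (A B : {poly {poly K}}) : swapXY (A + B) = swapXY A + swapXY B by exact: rmorphD.
have sM (A B : {poly {poly K}}) : swapXY (A * B) = swapXY A * swapXY B by exact: rmorphM.
have sB (A B : {poly {poly K}}) : swapXY (A - B) = swapXY A - swapXY B by exact: rmorphB.
move=> /(congr1 (fun P => swapXY P)); rewrite (dx_swap F) (dx_swap (swapXY F)) !swapXYK.
by rewrite sD sM sB (sM (_ + _)) sD !sM !swapXYK !swapXY_polyC swapXY_X.
Qed.

Lemma inx_eq F l : is_cofactor 'X (lienardQ alpha e sigma delta) F l%:P ->
  let H := inx F in
  ('X%:P - shift_q^:P) * H^`() +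
  (((3 *: 'X - (5 / 2)%:P) ^:P) * 'X%:P + (shift_kappa *: 'X^2 + shift_r%:P) ^:P) * dx H = l^:P * H.
Proof. by move=> /shifted_eq /swap_cofactor. Qed.
End ShiftedEquation.

Section CoefficientEquations.
Variables (K : numFieldType) (a b kappa r : K) (l : {poly K}) (H : {poly {poly K}}).
Hypothesis eqH :
  ('X%:P - ('X^3 + (3 / 2)%:P * 'X^2 + a%:P * 'X + b%:P : {poly K})^:P) * H^`() +
  (((3 *: 'X - (5 / 2)%:P) ^:P) * 'X%:P + (kappa *: 'X^2 + r%:P) ^:P) * dx H = l^:P * H.

Let h i := H`_i.
Let lhs (i : nat) : {poly K} := 'X * (h i.+1 *+ i.+1) - b%:P * (h i.+1 *+ i.+1)
  - a%:P * (h i *+ i) - (5 / 2)%:P * 'X * (h i)^`() + r%:P * (h i)^`().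

Let coefXd i : ('X * H^`())`_i = h i *+ i.
Proof. by case: i => [|i]; rewrite coefXM //= coef_deriv. Qed.

Let lhsE : l^:P * H = ('X%:P * H^`() - b%:P%:P * H^`() - a%:P%:P * ('X * H^`())
    - ((5 / 2)%:P * 'X)%:P * dx H + r%:P%:P * dx H)
  + 'X * ((3%:P * 'X)%:P * dx H - (3 / 2)%:P%:P * ('X * H^`())) + 'X^2 * (kappa%:P%:P * dx H - 'X * H^`()).
Proof.
rewrite -eqH -!mul_polyC !(rmorphD, rmorphM, rmorphN) /= !map_polyX !map_polyC /=.
by ring.
Qed.

Lemma inx_coef i : (l^:P * H)`_i = lhs i
  + (if i is j.+1 then 3%:P * 'X * (h j)^`() - (3 / 2)%:P * (h j *+ j) else 0)
  + (if i is j.+2 then kappa%:P * (h j)^`() - h j *+ j else 0).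
Proof.
rewrite lhsE !(coefD, coefN) coefXM coefXnM /lhs.
have dxE j : (dx H)`_j = (h j)^`() by rewrite coef_dx.
have dE j : (H^`())`_j = h j.+1 *+ j.+1 by rewrite coef_deriv.
case: i => [|[|i]] /=; rewrite ?subn2 /= !(coefD, coefN, coefCM) !(dxE, dE, coefXd) ?subr0 //; ring.
Qed.

Lemma inx_size : H != 0 -> (size l <= 3)%N.
Proof.
move=> nzH; have szL : (size (l^:P * H)%R <= (size H).+2)%N.
  apply/leq_sizeP => -[|[|i]] // le; rewrite inx_coef /lhs.
  have hj j : (i <= j)%N -> h j = 0 by move=> ij; rewrite /h nth_default // (leq_trans _ ij).
  by rewrite !hj ?leqW // !(deriv0, mul0rn, mulr0, subrr, addr0).
have [->|nzl] := eqVneq l 0; first by rewrite size_poly0.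
have nzl' : l^:P != 0 by rewrite map_polyC_eq0.
rewrite size_mul // size_map_polyC in szL; move: nzH szL; rewrite -size_poly_gt0.
by move: (size l) (size H) => x y; lia.
Qed.

Lemma inx_lcoef i : (size l <= 3)%N -> (l^:P * H)`_i = l`_0 *: h i
  + (if i is j.+1 then l`_1 *: h j else 0) + (if i is j.+2 then l`_2 *: h j else 0).
Proof.
move=> szl; have lE : l = (l`_0)%:P + (l`_1)%:P * 'X + (l`_2)%:P * 'X^2.
  apply/polyP => j; rewrite !coefD !coefCM coefC coefX coefXn.
  by case: j => [|[|[|j]]]; rewrite /= ?(mulr0n, mulr1n, mulr0, mulr1, addr0, add0r) // nth_default // (leq_trans szl).
have -> : l^:P * H = (l`_0)%:P%:P * H + 'X * ((l`_1)%:P%:P * H) + 'X^2 * ((l`_2)%:P%:P * H).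
  by rewrite {1}lE !(rmorphD, rmorphM) /= map_polyX !map_polyC /=; ring.
rewrite !coefD coefXM coefXnM !coefCM -mul_polyC.
by case: i => [|[|i]] /=; rewrite ?subn2 ?coefCM -?mul_polyC.
Qed.
End CoefficientEquations.


Lemma eq_transfer (V : zmodType) (x y u v : V) : x = y -> u - v = y - x -> u = v.
Proof. by move=> -> /eqP; rewrite subrr subr_eq0 => /eqP. Qed.

Ltac pointwise c := let t := fresh in apply: poly_ext => t; move: (congr1 (fun p => p.[t]) c);
  rewrite ?(deriv0, hornerD, hornerN, hornerM, hornerMn, hornerZ, hornerX, hornerC);
  let e := fresh in move=> e; apply: (eq_transfer e); by field.

Section TopCoefficient.
Variables (K : numFieldType) (a b kappa r : K) (l : {poly K}) (H : {poly {poly K}}).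
Hypothesis eqH :
  ('X%:P - ('X^3 + (3 / 2)%:P * 'X^2 + a%:P * 'X + b%:P : {poly K})^:P) * H^`() +
  (((3 *: 'X - (5 / 2)%:P) ^:P) * 'X%:P + (kappa *: 'X^2 + r%:P) ^:P) * dx H = l^:P * H.

Lemma size_first_order (m c : K) (p g : {poly K}) s : m != 0 ->
  m *: p + c *: p^`() = g -> (size g <= s)%N -> (size p <= s)%N.
Proof.
move=> m0 e szg; rewrite leqNgt; apply/negP => lt.
have nzp : p != 0 by rewrite -size_poly_gt0 (leq_trans _ lt).
have : g`_(size p).-1 = 0 by rewrite nth_default // (leq_trans szg) // -ltnS prednK // size_poly_gt0.
rewrite -e coefD !coefZ [p^`()`__]nth_default ?mulr0 ?addr0; last first.
  by rewrite -ltnS prednK ?lt_size_deriv ?size_poly_gt0.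
by apply/eqP; rewrite mulf_neq0 // -lead_coefE lead_coef_eq0.
Qed.

Lemma inx_top : H != 0 -> (size l <= 3)%N -> l`_2 = - (size H).-1%:R.
Proof.
move=> nzH szl; have nH : (size H).-1.+1 = size H by rewrite prednK // size_poly_gt0.
have := inx_coef eqH (size H).-1.+2; rewrite (inx_lcoef _ _ szl) /=.
set n := (size H).-1 in nH *.
have hj j : (n < j)%N -> H`_j = 0 by move=> nj; rewrite nth_default // -nH.
rewrite ![H`_n.+1]hj ?[H`_n.+2]hj ?[H`_n.+3]hj //; last by rewrite ltnW.
rewrite !(deriv0, mul0rn, mulr0, subrr, addr0, scaler0, add0r) => e.
have nzh : H`_n != 0 by rewrite -lead_coefE lead_coef_eq0.
apply/eqP; rewrite -addr_eq0; apply: contra_neqT nzh => nz.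
apply/eqP; rewrite -size_poly_leq0.
apply: (size_first_order (c := - kappa) (g := 0) nz); last by rewrite size_poly0.
by rewrite scalerDl e scaleNr -(mul_polyC kappa) scaler_nat; ring.
Qed.

Hypotheses (szl : (size l <= 3)%N) (szH : (size H <= 4)%N) (l2 : l`_2 = -3).

Let coef k : l`_0 *: H`_k + (if k is j.+1 then l`_1 *: H`_j else 0)
    + (if k is j.+2 then (-3) *: H`_j else 0) =
  'X * (H`_k.+1 *+ k.+1) - b%:P * (H`_k.+1 *+ k.+1)
  - a%:P * (H`_k *+ k) - (5 / 2)%:P * 'X * (H`_k)^`() + r%:P * (H`_k)^`()
  + (if k is j.+1 then 3%:P * 'X * (H`_j)^`() - (3 / 2)%:P * (H`_j *+ j) else 0)
  + (if k is j.+2 then kappa%:P * (H`_j)^`() - H`_j *+ j else 0).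
Proof. by rewrite -(inx_coef eqH k) (inx_lcoef _ _ szl) l2. Qed.

Let big k : (3 < k)%N -> H`_k = 0.
Proof. by move=> k3; rewrite nth_default // (leq_trans szH). Qed.

Lemma inx_linear : kappa != 0 -> forall i, (size (H`_i)%R <= 2)%N.
Proof.
move=> k0; have c5 := coef 5; have c4 := coef 4; have c3 := coef 3; have c2 := coef 2.
rewrite /= ![H`_4]big ?[H`_5]big ?[H`_6]big // in c5 c4 c3 c2.
have d3 : (H`_3)^`() = 0.
  by apply: (scalerI k0); pointwise c5.
rewrite d3 in c4 c3 c2.
have sz3 : (size (H`_3)%R <= 1)%N by have [c ->] := deriv_eq0 d3; rewrite size_polyC leq_b1.
have e2 : 1 *: H`_2 + kappa *: (H`_2)^`() = (l`_1 + 9 / 2) *: H`_3 by pointwise c4.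
have sz2 : (size (H`_2)%R <= 1)%N.
  exact: size_first_order (oner_neq0 _) e2 (leq_trans (size_scale_leq _ _) sz3).
have d2 : (H`_2)^`() = 0 by rewrite (size1_polyC sz2) derivC.
rewrite d2 in c3 c2.
have e1 : 2 *: H`_1 + kappa *: (H`_1)^`() = (l`_0 + 3 * a) *: H`_3 + (l`_1 + 3) *: H`_2 by pointwise c3.
have n0 k : k.+1%:R != 0 :> K by rewrite pnatr_eq0.
have sz1 : (size (H`_1)%R <= 1)%N.
  by apply: size_first_order (n0 1%N) e1 (size_add_le _ _); apply: leq_trans (size_scale_leq _ _) _.
have d1 : (H`_1)^`() = 0 by rewrite (size1_polyC sz1) derivC.
rewrite d1 in c2.
have e0 : 3 *: H`_0 + kappa *: (H`_0)^`() = ((3 * b) *: H`_3 - 3 *: ('X * H`_3)) + (l`_0 + 2 * a) *: H`_2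
    + (l`_1 + 3 / 2) *: H`_1 by pointwise c2.
have sz0 : (size (H`_0)%R <= 2)%N.
  apply: size_first_order (n0 2%N) e0 _; rewrite -scaleN1r scalerA.
  do ?apply: size_add_le; apply: leq_trans (size_scale_leq _ _) _; rewrite ?(leq_trans sz1, leq_trans sz2, leq_trans sz3) //.
  by apply: (@size_mul_le _ _ _ 2 1); rewrite ?size_polyX.
move=> [|[|[|[|i]]]]; rewrite ?(leq_trans sz1, leq_trans sz2, leq_trans sz3) //.
by rewrite big // size_poly0.
Qed.

Definition eqK0 (A B C D : {poly K}) :=
  [/\ B = (l`_1 + 9 / 2) *: A - 3 *: ('X * A^`()),
   2 *: C = l`_0 *: A + (l`_1 + 3) *: B + (3 * a) *: A - 3 *: ('X * B^`()) + (5 / 2) *: ('X * A^`()) - r *: A^`(),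
   3 *: D = l`_0 *: B + (l`_1 + 3 / 2) *: C + (2 * a) *: B + (3 * b) *: A - 3 *: ('X * A) - 3 *: ('X * C^`())
     + (5 / 2) *: ('X * B^`()) - r *: B^`(),
   l`_0 *: C + l`_1 *: D = 2 *: ('X * B) - (2 * b) *: B - a *: C - (5 / 2) *: ('X * C^`()) + r *: C^`() + 3 *: ('X * D^`())
  & l`_0 *: D = 'X * C - b *: C - (5 / 2) *: ('X * D^`()) + r *: D^`()].

Lemma inx_cubic : kappa = 0 -> eqK0 H`_3 H`_2 H`_1 H`_0.
Proof.
move=> k0; have c4 := coef 4; have c3 := coef 3; have c2 := coef 2; have c1 := coef 1; have c0 := coef 0.
rewrite k0 /= ![H`_4]big ?[H`_5]big ?[H`_6]big // in c4 c3 c2 c1 c0.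
by split; [pointwise c4 | pointwise c3 | pointwise c2 | pointwise (esym c1) | pointwise (esym c0)].
Qed.
End TopCoefficient.


Section Reversal.
Variables (K : numFieldType) (N : nat).
Implicit Types (p q : {poly K}).

Definition revc p (j : nat) : K := if (j <= N)%N then - p`_(N - j) else 0.

Lemma revcD p q j : revc (p + q) j = revc p j + revc q j.
Proof. by rewrite /revc coefD opprD; case: ifP; rewrite ?addr0. Qed.

Lemma revcN p j : revc (- p) j = - revc p j.
Proof. by rewrite /revc coefN; case: ifP; rewrite ?oppr0. Qed.

Lemma revcZ c p j : revc (c *: p) j = c * revc p j.
Proof. by rewrite /revc coefZ; case: ifP; rewrite ?mulr0 ?mulrN. Qed.

Lemma revcX p j : revc ('X * p) j = revc p j.+1.
Proof.
rewrite /revc; case: (leqP j N) => jN; last by rewrite leqNgt ltnW.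
rewrite coefXM; case: (ltngtP j N) jN => // [lt _|-> _]; last by rewrite subnn oppr0.
by rewrite subn_eq0 leqNgt lt /= -subnS.
Qed.

Lemma revcXd p j : revc ('X * p^`()) j = (N%:R - j%:R) * revc p j.
Proof.
rewrite /revc; case: leqP => [jN|_]; last by rewrite mulr0.
rewrite -natrB // coefXM; case: (N - j)%N => [|i]; rewrite ?mul0r ?oppr0 // coef_deriv /=.
by rewrite mulrN mulr_natl.
Qed.

Lemma revcd p j : revc p^`() j = (N%:R - j%:R + 1) * pre (- p`_N.+1) (revc p) j.
Proof.
rewrite /revc; case: j => [|j] /=.
  by rewrite !subn0 coef_deriv mulr0n subr0 natr1 mulrN mulr_natl.
rewrite -natr1; case: (ltngtP j N) => [lt|gt|->]; last 2 first.
- by rewrite mulr0.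
- by rewrite [_ - _ + 1](_ : _ = 0) ?mul0r //; ring.
rewrite (_ : _ + 1 = (N - j)%:R :> K); last by rewrite natrB ?(ltnW lt) //; ring.
by rewrite coef_deriv mulrN mulr_natl subnSK.
Qed.
End Reversal.

Section Recursion.
Variables (K : numFieldType) (a b r l0 l1 : K) (A B C D : {poly K}) (N : nat).
Hypotheses (szA : (size A <= N.+1)%N) (szB : (size B <= N.+1)%N) (szC : (size C <= N.+1)%N)
  (D1 : D`_N.+1 = 1) (szD : (size D <= N.+2)%N).
Hypotheses (eqB : B = (l1 + 9 / 2) *: A - 3 *: ('X * A^`()))
  (eqC : 2 *: C = l0 *: A + (l1 + 3) *: B + (3 * a) *: A - 3 *: ('X * B^`()) + (5 / 2) *: ('X * A^`()) - r *: A^`())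
  (eqD : 3 *: D = l0 *: B + (l1 + 3 / 2) *: C + (2 * a) *: B + (3 * b) *: A - 3 *: ('X * A) - 3 *: ('X * C^`())
     + (5 / 2) *: ('X * B^`()) - r *: B^`())
  (eq1 : l0 *: C + l1 *: D = 2 *: ('X * B) - (2 * b) *: B - a *: C - (5 / 2) *: ('X * C^`()) + r *: C^`() + 3 *: ('X * D^`()))
  (eq0 : l0 *: D = 'X * C - b *: C - (5 / 2) *: ('X * D^`()) + r *: D^`()).

Let n0 k : k.+1%:R != 0 :> K. Proof. by rewrite pnatr_eq0. Qed.

Let top (p : {poly K}) : (size p <= N.+1)%N -> p`_N.+1 = 0. Proof. by move=> sz; rewrite nth_default. Qed.
Let top2 (p : {poly K}) : (size p <= N.+1)%N -> p`_N.+2 = 0. Proof. by move=> sz; rewrite nth_default // leqW. Qed.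

Let coefXd (p : {poly K}) : ('X * p^`())`_N = N%:R * p`_N.
Proof. by rewrite coefXM; case: (N) => [|m]; rewrite ?mul0r // coef_deriv mulr_natl. Qed.

Lemma lead_A : A`_N = -1.
Proof.
have := congr1 (fun p : {poly K} => p`_N.+1) eqD.
rewrite !(coefD, coefN, coefZ, coefXM) /= !coef_deriv !(top szA, top szB, top szC) D1.
rewrite (top2 szB) !(mul0rn, mulr0) => e.
have h : 3 * (A`_N + 1) = 0.
  have -> : 3 * (A`_N + 1) = 3 * 1 + 3 * A`_N by ring.
  by rewrite e; ring.
by move/eqP: h; rewrite mulf_eq0 (negbTE (n0 2)) /= addr_eq0 => /eqP.
Qed.

Lemma lead_B : B`_N = 3 * N%:R - (l1 + 9 / 2).
Proof.
by rewrite eqB !(coefD, coefN, coefZ) coefXd lead_A; ring.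
Qed.

Lemma l1E : l1 = 3 * N%:R - 2.
Proof.
have := congr1 (fun p : {poly K} => p`_N.+1) eq1.
rewrite !(coefD, coefN, coefZ, coefXM) /= !coef_deriv !(top szB, top szC) D1 lead_B.
rewrite (top2 szC) !(mul0rn, mulr0) => e.
apply: (mulfI (n0 2)); apply: (eq_transfer (esym e)); by rewrite -natr1; field.
Qed.

Lemma l0E : l0 = - a - 5 / 2 * (N%:R + 1).
Proof.
have := congr1 (fun p : {poly K} => p`_N.+1) eq0.
rewrite !(coefD, coefN, coefZ, coefXM) /= !coef_deriv !(top szC) D1.
rewrite [D`_N.+2]nth_default // !(mul0rn, mulr0) => e0.
have := congr1 (fun p : {poly K} => p`_N) eqC.
rewrite !(coefD, coefN, coefZ) !coefXd !coef_deriv !(top szA) lead_A lead_B l1E mul0rn => e1.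
have e : 2 * (l0 + 5 / 2 * N.+1%:R) = 2 * C`_N by apply: (eq_transfer (congr1 ( *%R 2) (esym e0))); rewrite -natr1; ring.
rewrite e1 in e; apply: (mulfI (n0 2)); apply: (eq_transfer (esym e)); by rewrite -natr1; field.
Qed.

Let A' := revc N A.
Let rN := r * N%:R.

Lemma recB j : revc N B j = Bj A' j.
Proof. by rewrite eqB !(revcD, revcN, revcZ, revcXd) l1E /Bj /A'; field. Qed.

Let pB x j : pre x (revc N B) j = pre x (Bj A') j.
Proof. by case: j => //= j; rewrite recB. Qed.

Lemma recC j : revc N C j = Cj a r rN A' j.
Proof.
apply: (mulfI (n0 1)); rewrite -revcZ eqC !(revcD, revcN, revcZ, revcXd, revcd) (top szA) oppr0 recB l1E l0E.
by rewrite /Cj /Bj /rr -/A' /rN; move: (pre _ _ _) => x; field.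
Qed.

Let pC x j : pre x (revc N C) j = pre x (Cj a r rN A') j.
Proof. by case: j => //= j; rewrite recC. Qed.

Lemma recD j : revc N D j = Dj a b r rN A' j.
Proof.
apply: (mulfI (n0 2)); rewrite -revcZ eqD !(revcD, revcN, revcZ, revcXd, revcX, revcd) (top szB) oppr0 pB recB recC l1E l0E.
by rewrite /Dj /rr -/A' /rN; move: (pre _ _ _) (Cj _ _ _ _ _) (Bj _ _) => x y z; field.
Qed.

Let pD x j : pre x (revc N D) j = pre x (Dj a b r rN A') j.
Proof. by case: j => //= j; rewrite recD. Qed.

Lemma recX1 j : X1 a b r rN A' j.
Proof.
have := congr1 (fun p => revc N p j) eq1.
rewrite !(revcD, revcN, revcZ, revcXd, revcX, revcd) (top szC) oppr0 pC !recC !recB !recD l1E l0E /X1 => e.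
apply: (eq_transfer e); rewrite /rr /rN; move: (pre _ _ _) (Cj _ _ _ _ _) (Bj _ _) (Bj _ _) (Dj _ _ _ _ _ _) => x y z t u.
by field.
Qed.

Lemma recX0 j : X0 a b r rN A' j.
Proof.
have := congr1 (fun p => revc N p j) eq0.
rewrite !(revcD, revcN, revcZ, revcXd, revcX, revcd) D1 pD !recC !recD l0E /X0 => e.
apply: (eq_transfer e); rewrite /rr /rN; move: (pre _ _ _) (Cj _ _ _ _ _) (Cj _ _ _ _ _) (Dj _ _ _ _ _ _) => x y z u.
by field.
Qed.
End Recursion.


Section Curve.
Variables (K : numFieldType).

Definition unrev N (f : nat -> K) : {poly K} := \poly_(j < N.+1) (- f (N - j)%N).

Lemma unrevE N (f : nat -> K) (p : {poly K}) : (size p <= N.+1)%N -> (forall j, revc N p j = f j) -> p = unrev N f.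
Proof.
move=> szp rf; apply/polyP => j; rewrite coef_poly; case: ltnP => [jN|Nj].
  by rewrite -rf /revc leq_subr subKn // opprK.
by rewrite nth_default // (leq_trans szp).
Qed.

Definition cubic_inx (A B C D : {poly K}) : {poly {poly K}} :=
  A%:P * 'X^3 + B%:P * 'X^2 + C%:P * 'X + D%:P.

Definition cubic_q (a b : K) : {poly K} := 'X^3 + (3 / 2)%:P * 'X^2 + a%:P * 'X + b%:P.

Definition rec_inx (a b r : K) N (A : nat -> K) : {poly {poly K}} :=
  let rN := r * N%:R in
  cubic_inx (unrev N A) (unrev N (Bj A)) (unrev N (Cj a r rN A)) ('X^(N.+1) + unrev N (Dj a b r rN A)).

Definition curve (a b r : K) N (A : nat -> K) : {poly {poly K}} :=
  swapXY (rec_inx a b r N A) \Po ('X + (cubic_q a b)%:P).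

Lemma horner_swap_comp (H : {poly {poly K}}) (q : {poly K}) x y :
  (swapXY H \Po ('X + q%:P)).[y%:P].[x] = H.[x%:P].[y + q.[x]].
Proof.
rewrite horner_comp hornerD hornerX hornerC [in RHS]horner_polyC.
have -> : y + q.[x] = horner_eval x (y%:P + q) by rewrite /horner_eval hornerD hornerC.
by rewrite horner_map.
Qed.

Lemma horner_curve a b r N A x y : (curve a b r N A).[y%:P].[x] =
  let v := y + (x ^+ 3 + 3 / 2 * x ^+ 2 + a * x + b) in let rN := r * N%:R in
  (unrev N A).[v] * x ^+ 3 + (unrev N (Bj A)).[v] * x ^+ 2 + (unrev N (Cj a r rN A)).[v] * x
   + (v ^+ N.+1 + (unrev N (Dj a b r rN A)).[v]).
Proof.
rewrite horner_swap_comp /cubic_q !(hornerD, hornerM, hornerC, hornerX, hornerXn) /=.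
by [].
Qed.

Lemma horner_unrev1 f v : (unrev 1 f).[v] = - (f 0%N * v + f 1%N).
Proof. by rewrite horner_poly !big_ord_recl big_ord0 /=; ring. Qed.

Lemma horner_unrev2 f v : (unrev 2 f).[v] = - (f 0%N * v ^+ 2 + f 1%N * v + f 2%N).
Proof. by rewrite horner_poly !big_ord_recl big_ord0 /= /bump /=; ring. Qed.

Lemma curve_F3 A : A 0%N = 1 -> A 1%N = 7 / 3 -> A 2%N = 0 ->
  curve (- (37 / 4)) (- (149 / 24)) (65 / 3) 1 A = F3 K.
Proof.
move=> A0 A1 A2; apply: poly2_ext => x y; rewrite horner_curve /F3.
rewrite !(hornerD, hornerN, hornerM, hornerC, hornerX, hornerXn, hornerZ) !horner_unrev1.
by rewrite /Dj /Cj /Bj /rr /= A0 A1 A2; field.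
Qed.
Lemma curve_F4 A : A 0%N = 1 -> A 1%N = 1 -> A 2%N = 0 ->
  curve (11 / 4) (41 / 8) 7 1 A = F4 K.
Proof.
move=> A0 A1 A2; apply: poly2_ext => x y; rewrite horner_curve /F4.
rewrite !(hornerD, hornerN, hornerM, hornerC, hornerX, hornerXn, hornerZ) !horner_unrev1.
by rewrite /Dj /Cj /Bj /rr /= A0 A1 A2; field.
Qed.

Lemma curve_F5 A : A 0%N = 1 -> A 1%N = 25 / 9 -> A 2%N = 0 ->
  curve (- (95 / 12)) (- (685 / 216)) (175 / 9) 1 A = F5 K.
Proof.
move=> A0 A1 A2; apply: poly2_ext => x y; rewrite horner_curve /F5.
rewrite !(hornerD, hornerN, hornerM, hornerC, hornerX, hornerXn, hornerZ) !horner_unrev1.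
by rewrite /Dj /Cj /Bj /rr /= A0 A1 A2; field.
Qed.

Lemma curve_F6 A : A 0%N = 1 -> A 1%N = 8 / 3 -> A 2%N = 52 / 9 -> A 3%N = 0 ->
  curve (- (1 / 4)) (151 / 24) (20 / 3) 2 A = F6 K.
Proof.
move=> A0 A1 A2 A3; apply: poly2_ext => x y; rewrite horner_curve /F6.
rewrite !(hornerD, hornerN, hornerM, hornerC, hornerX, hornerXn, hornerZ) !horner_unrev2.
by rewrite /Dj /Cj /Bj /rr /= A0 A1 A2 A3; field.
Qed.

Lemma curve_F7 al A : al ^+ 2 - 4975 / 486 * al + 4225 / 144 = 0 ->
  A 0%N = 1 -> A 1%N = 5 / 4 - 13 / 81 * al -> A 2%N = 0 ->
  curve (al - 5 / 2) (- (5 / 6) + 43 / 54 * al) (- (611 / 108) + 5981%:R / 3645 * al) 1 A = F7 al.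
Proof.
move=> quad A0 A1 A2; apply: poly2_ext => x y; rewrite horner_curve /F7.
rewrite !(hornerD, hornerN, hornerM, hornerC, hornerX, hornerXn, hornerZ) !horner_unrev1.
apply: (eq_mod (c := - (25 / 243) - 2 / 3 * x) quad).
by rewrite /Dj /Cj /Bj /rr ![pre _ _ _]/= A0 A1 A2; field.
Qed.
End Curve.


Section LinearCurves.
Variables (K : numFieldType) (alpha e sigma delta : K).

Let f : {poly K} := 3 *: 'X ^+ 2 + alpha%:P.
Let G : {poly K} := 3 *: 'X ^+ 4 + 2 *: 'X ^+ 3 - e *: 'X ^+ 2 - sigma *: 'X - delta%:P.

Lemma lienard_f : ((size f <= 3)%N * (f`_2 = 3))%type.
Proof.
split; last by rewrite coefD coefZ coefXn coefC mulr1 addr0.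
apply: size_add_le; last by rewrite (leq_trans (size_polyC_leq1 _)).
by apply: leq_trans (size_scale_leq _ _) _; rewrite size_polyXn.
Qed.

Lemma lienard_G : (size G <= 5)%N.
Proof.
rewrite /G -!scaleNr -polyCN.
by do ?apply: size_add_le; rewrite ?(leq_trans (size_polyC_leq1 _)) //;
  apply: leq_trans (size_scale_leq _ _) _; rewrite ?size_polyXn ?size_polyX.
Qed.

Lemma quintic_size (h : {poly K}) : (h^`() + f) * h = G -> (size h <= 4)%N.
Proof.
have [szf f2] := lienard_f; move=> hG; rewrite leqNgt; apply/negP => sz.
have sz' : size (h^`() + f) = (size h).-1.
  have szd : size h^`() = (size h).-1.
    apply/eqP; rewrite eqn_leq size_deriv_le // leqNgt; apply/negP => lt.
    case: (size h) sz (lead_coefE h) lt => [|[|n]] // _ lE.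
    rewrite /= ltnS => /leq_sizeP/(_ n (leqnn n)); rewrite coef_deriv -[h`_n.+1]/(h`_(n.+2.-1)) -lE => /eqP.
    rewrite mulrn_eq0 /= lead_coef_eq0 => h0; move: hG; rewrite (eqP h0) mulr0 => G0.
    have := congr1 (fun p : {poly K} => p`_4) G0.
    by rewrite coef0 /G !(coefD, coefN, coefZ, coefXn, coefX, coefC) /= => /eqP; rewrite mulr1 !mulr0 oppr0 !addr0 eq_sym pnatr_eq0.
  rewrite size_polyDl szd //; apply: leq_ltn_trans szf _; move: sz; clear; move: (size h) => x; lia.
have := lienard_G; rewrite -hG size_mul ?sz'.
- by move: sz; clear; move: (size h) => x; lia.
- by rewrite -size_poly_gt0 sz'; move: sz; clear; move: (size h) => x; lia.
by rewrite -size_poly_gt0; move: sz; clear; move: (size h) => x; lia.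
Qed.

Lemma linear_curves (F : {poly {poly K}}) (l : {poly K}) : size F = 2%N -> F \is monic ->
  is_cofactor 'X (lienardQ alpha e sigma delta) F l%:P -> lienard_list alpha e sigma delta F l%:P.
Proof.
move=> szF monF cF; pose h := - F`_0.
have lF : F`_1 = 1 by move: monF; rewrite monicE lead_coefE szF => /eqP.
have FE : F = 'X - h%:P.
  apply/polyP => -[|[|i]]; rewrite coefD coefN coefX coefC /= ?lF ?oppr0 ?addr0 ?add0r ?opprK //.
  by rewrite nth_default ?szF.
have lE : l = - (h^`() + f).
  have := cofactor_coefS 0 cF; rewrite lF [F`_2]nth_default ?szF // mulr0 addr0 !mulr1 mulr1n => <-.
  by rewrite /h derivN [RHS]opprD opprK.
have hG : (h^`() + f) * h = G.
  have -> : G = l * F`_0 by have := cofactor_coef0 cF; rewrite lF mulr1.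
  by rewrite lE /h; ring.
clearbody h; have szh := quintic_size hG.
have hE : h = (h`_3)%:P * 'X^3 + (h`_2)%:P * 'X^2 + (h`_1)%:P * 'X + (h`_0)%:P.
  apply/polyP => j; rewrite !coefD !coefCM !coefXn coefX coefC.
  case: j => [|[|[|[|j]]]]; rewrite /= ?(mulr1n, mulr0n, mulr0, mulr1, addr0, add0r) //.
  by rewrite nth_default // (leq_trans szh).
move: h`_3 h`_2 h`_1 h`_0 hE => h3 h2 h1 h0 hE.
have h'E x : h^`().[x] = 3 * h3 * x ^+ 2 + 2 * h2 * x + h1.
  rewrite hE !(derivD, derivM, derivC, derivX, derivXn) !(hornerD, hornerM, hornerMn, hornerC, hornerX, hornerXn).
  by rewrite /=; field.
have hx x : h.[x] = h3 * x ^+ 3 + h2 * x ^+ 2 + h1 * x + h0.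
  by rewrite hE !(hornerD, hornerM, hornerC, hornerX, hornerXn).
pose g : {poly K} := (3 * h3 ^+ 2 + 3 * h3)%:P * 'X^5 + (5 * h2 * h3 + 3 * h2 - 3)%:P * 'X^4
  + (3 * h3 * h1 + 2 * h2 ^+ 2 + (h1 + alpha) * h3 + 3 * h1 - 2)%:P * 'X^3
  + (3 * h3 * h0 + 2 * h2 * h1 + (h1 + alpha) * h2 + 3 * h0 + e)%:P * 'X^2
  + (2 * h2 * h0 + (h1 + alpha) * h1 + sigma)%:P * 'X + ((h1 + alpha) * h0 + delta)%:P.
have g0 : g = 0.
  apply: poly_ext => x; have := congr1 (fun p : {poly K} => p.[x]) hG.
  rewrite /g !(hornerD, hornerN, hornerM, hornerZ, hornerC, hornerX, hornerXn) h'E hx => ee.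
  by apply: (eq_transfer (esym ee)); field.
have gc i : g`_i = 0 by rewrite g0 coef0.
have := gc 5; have := gc 4; have := gc 3; have := gc 2; have := gc 1%N; have := gc 0%N.
rewrite /g !(coefD, coefCM, coefXn, coefX, coefC) /= !(mulr1n, mulr0n, mulr0, mulr1, addr0, add0r).
clear gc g0 g hE => c0 c1 c2 c3 c4 c5.
have: h3 * (h3 + 1) = 0 by apply: (eq_mod (c := 1 / 3) c5); field.
move/eqP; rewrite mulf_eq0 addr_eq0 => /orP[] /eqP h3E; rewrite {h3}h3E in c1 c2 c3 c4 c5 h'E hx *.
  have h2E : h2 = 1 by apply: (eq_mod (c := 1 / 3) c4); field.
  rewrite {h2}h2E in c1 c2 c3 c4 h'E hx *.
  have h1E : h1 = 0 by apply: (eq_mod (c := 1 / 3) c3); field.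
  rewrite {h1}h1E in c0 c1 c2 c3 h'E hx *.
  have h0E : h0 = - (e + alpha) / 3 by apply: (eq_mod (c := 1 / 3) c2); field.
  rewrite {h0}h0E in c0 c1 c2 hx *.
  have -> : F = F1 alpha e.
    rewrite FE; apply: poly2_ext => x y; by rewrite /F1 !(hornerD, hornerN, hornerX, hornerC, hornerXn, hx); field.
  have -> : l%:P = lam1 alpha.
    rewrite lE /lam1 /f; congr (_%:P); apply: poly_ext => x.
    by rewrite !(hornerD, hornerN, hornerZ, hornerX, hornerC, hornerXn, h'E); ring.
  by apply: Curve1; [apply: (eq_mod (c := 1) c0) | apply: (eq_mod (c := 1) c1)]; field.
have h2E : h2 = - (3 / 2) by apply: (eq_mod (c := - (1 / 2)) c4); field.
rewrite {h2}h2E in c1 c2 c3 c4 h'E hx *.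
have h1E : h1 = 5 / 2 - alpha by apply: (eq_mod (c := - 1) c3); field.
rewrite {h1}h1E in c0 c1 c2 c3 h'E hx *.
have h0E : h0 = (25 / 4 - 5 / 2 * alpha + sigma) / 3 by apply: (eq_mod (c := - (1 / 3)) c1); field.
rewrite {h0}h0E in c0 c1 c2 hx *.
have -> : F = F2 alpha sigma.
  rewrite FE; apply: poly2_ext => x y.
  by rewrite /F2 !(hornerD, hornerN, hornerZ, hornerX, hornerC, hornerXn, hx); field.
have -> : l%:P = lam2 K.
  rewrite lE /lam2 /f; congr (_%:P); apply: poly_ext => x.
  by rewrite !(hornerD, hornerN, hornerZ, hornerX, hornerC, hornerXn, h'E); field.
by apply: Curve2; [apply: (eq_mod (c := 1) c0) | apply: (eq_mod (c := 1) c2)]; field.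
Qed.
End LinearCurves.


Section Irreducibility.
Variable K : numClosedFieldType.
Implicit Types (F S b c H : {poly {poly K}}) (q t : {poly K}).

Lemma unit_poly2 (F : {poly {poly K}}) : F \is a GRing.unit -> size F = 1%N.
Proof. by rewrite poly_unitE => /andP[/eqP]. Qed.

Lemma unit_monic_factor (b c : {poly {poly K}}) : b * c \is monic -> size b = 1%N -> b \is a GRing.unit.
Proof.
rewrite monicE lead_coefM => /eqP bc1 szb; rewrite poly_unitE szb /=.
have -> : b`_0 = lead_coef b by rewrite lead_coefE szb.
by apply/unitrP; exists (lead_coef c); rewrite mulrC bc1.
Qed.

Lemma monic_factors_neq0 (b c : {poly {poly K}}) : b * c \is monic -> b != 0 /\ c != 0.
Proof.
by move=> mbc; split; apply: contraTneq mbc => ->; rewrite ?mulr0 ?mul0r monicE lead_coef0 eq_sym oner_eq0.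
Qed.

Lemma size_comp_shift F q : size (F \Po ('X + q%:P)) = size F.
Proof. by rewrite size_comp_poly2 // size_XaddC. Qed.

Lemma monic_comp_shift F q : F \is monic -> F \Po ('X + q%:P) \is monic.
Proof.
move=> mF; rewrite monicE lead_coef_comp ?size_XaddC //.
by rewrite (eqP mF) lead_coefXaddC expr1n mulr1.
Qed.

Lemma comp_shiftK F q : (F \Po ('X + q%:P)) \Po ('X + (- q)%:P) = F.
Proof. by rewrite polyCN comp_polyXaddC_K. Qed.

Lemma irreducible_shift F q : F \is monic -> (1 < size F)%N -> irreducible_elt F ->
  irreducible_elt (F \Po ('X + q%:P)).
Proof.
move=> mF szF [F0 _ irr].
split; first by rewrite -size_poly_gt0 size_comp_shift ltnW.
  by apply/negP => /unit_poly2; rewrite size_comp_shift => sz; rewrite sz in szF.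
move=> b c e; have mbc : b * c \is monic by rewrite -e monic_comp_shift.
have : F = (b \Po ('X + (- q)%:P)) * (c \Po ('X + (- q)%:P)) by rewrite -comp_polyM -e comp_shiftK.
by move=> /irr[] /unit_poly2; rewrite size_comp_shift => sz; [left|right];
  [apply: (unit_monic_factor mbc) | rewrite mulrC in mbc; apply: (unit_monic_factor mbc)].
Qed.

Lemma irreducible_linear F : F \is monic -> size F = 2%N -> irreducible_elt F.
Proof.
move=> mF szF; split; first by rewrite monic_neq0.
  by apply/negP => /unit_poly2; rewrite szF.
move=> b c e; have mbc : b * c \is monic by rewrite -e.
have [b0 c0] := monic_factors_neq0 mbc.
have : (size b + size c = 3)%N.
  have := size_mul b0 c0; rewrite -e szF; move: b0 c0; rewrite -!size_poly_gt0.
  by move: (size b) (size c) => x y; lia.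
move: b0 c0; rewrite -!size_poly_gt0 => b0 c0 bc.
have [sz|sz] : size b = 1%N \/ size c = 1%N by move: b0 c0 bc; clear; move: (size b) (size c) => x y; lia.
  by left; apply: unit_monic_factor mbc sz.
by right; rewrite mulrC in mbc; apply: unit_monic_factor mbc sz.
Qed.

Lemma coefM_second b c m k : (size b <= m.+2)%N -> (size c <= k.+2)%N ->
  (b * c)`_(m + k).+1 = b`_m.+1 * c`_k + b`_m * c`_k.+1.
Proof.
move=> szb szc; rewrite coefM.
have lt1 : (m.+1 < (m + k).+2)%N by rewrite ltnS ltnS leq_addr.
have lt0 : (m < (m + k).+2)%N by rewrite ltnW.
rewrite (bigD1 (Ordinal lt1)) //= (bigD1 (Ordinal lt0)) /=; last by rewrite -val_eqE /= neq_ltn ltnSn.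
rewrite big1 ?addr0 => [|i]; first by congr (_ * _`_ _ + _ * _`_ _); lia.
rewrite -!val_eqE /= => /andP[i1 i0].
have [lt|ge] := ltnP i m; last by rewrite [b`_i]nth_default ?mul0r // (leq_trans szb) //; lia.
by rewrite [c`_ _]nth_default ?mulr0 // (leq_trans szc) //; lia.
Qed.

Lemma irreducible_swap H N : (size H <= 4)%N -> swapXY H \is monic -> size (swapXY H) = N.+2 ->
  (H`_3)`_N != 0 -> (forall v, root H`_3 v -> ~~ root H`_2 v) -> irreducible_elt (swapXY H).
Proof.
move=> szH mS szS A0 noroot; set S := swapXY H in mS szS *.
have S3 : (S`_N)`_3 != 0 by rewrite coef_swapXY.
have half b c : S = b * c -> (1 < size b)%N -> (exists i, (b`_i)`_3 != 0) -> size c = 1%N.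
  move=> e szb [i bi]; have [//|szc] := eqVneq (size c) 1%N; exfalso.
  have [b0 c0] : b != 0 /\ c != 0 by apply: monic_factors_neq0; rewrite -e.
  have HE : H = swapXY b * swapXY c by rewrite -rmorphM -e /S /= swapXYK.
  have szb4 : (3 < size (swapXY b))%N.
    rewrite ltnNge; apply: contra bi => /leq_sizeP/(_ 3 (leqnn _)) h.
    by rewrite -coef_swapXY h coef0.
  have szc1 : (size (swapXY c) <= 1)%N.
    have := size_mul (p := swapXY b) (q := swapXY c); rewrite !swapXY_eq0 -HE => /(_ b0 c0).
    by move: szH szb4; clear; move: (size _) (size _) (size _) => x y z; lia.
  have cE := size1_polyC szc1; set t := (swapXY c)`_0 in cE.
  have szt : size t = size c by rewrite -[c]swapXYK cE swapXY_polyC size_map_polyC.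
  have [v tv] : exists v, root t v by apply/closed_rootP; rewrite szt.
  have rv j : root H`_j v.
    by rewrite HE cE coefMC /root hornerM (eqP (tv : t.[v] == 0)) mulr0.
  by have := noroot v (rv 3); rewrite rv.
split; first by rewrite monic_neq0.
  by apply/negP => /unit_poly2; rewrite szS.
move=> b c e; have mbc : b * c \is monic by rewrite -e.
have mcb : c * b \is monic by rewrite mulrC.
have [b0 c0] := monic_factors_neq0 mbc; rewrite -!size_poly_gt0 in b0 c0.
have [szb|szb] := leqP (size b) 1.
  by left; apply: unit_monic_factor mbc _; apply/eqP; rewrite eqn_leq szb.
have [szc|szc] := leqP (size c) 1.
  by right; apply: unit_monic_factor mcb _; apply/eqP; rewrite eqn_leq szc.
have szbc : (size b + size c = N.+3)%N.
  have := size_mul (p := b) (q := c); rewrite -!size_poly_gt0 -e szS => /(_ b0 c0).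
  by move: b0 c0; clear; move: (size b) (size c) => x y; lia.
have [m szbE] : exists m, size b = m.+2 by exists (size b).-2; move: szb; clear; move: (size b) => x; lia.
have [k szcE] : exists k, size c = k.+2 by exists (size c).-2; move: szc; clear; move: (size c) => x; lia.
have NE : N = (m + k).+1 by move: szbc; rewrite szbE szcE; clear; lia.
have const (x y : {poly K}) : x * y = 1 -> exists z, x = z%:P.
  move=> xy; exists x`_0; apply: size1_polyC.
  have : x \is a GRing.unit by apply/unitrP; exists y; rewrite mulrC xy.
  by rewrite poly_unitE => /andP[/eqP ->].
have bc1 : b`_m.+1 * c`_k.+1 = 1.
  have := mbc; rewrite monicE lead_coefM /lead_coef szbE szcE => /eqP //.
have [z bz] := const _ _ bc1; have [w cw] : exists w, c`_k.+1 = w%:P.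
  by rewrite mulrC in bc1; apply: const bc1.
have := S3; rewrite e NE coefM_second ?szbE ?szcE // bz cw coefD coefCM coefMC.
have [ck|ck] := eqVneq (c`_k)`_3 0; last first.
  have := half c b; rewrite mulrC -e szbE => /(_ erefl szc) h _.
  by have := h (ex_intro _ k ck).
have [bm|bm] := eqVneq (b`_m)`_3 0; first by rewrite ck bm mulr0 mul0r addr0 eqxx.
by have := half b c e szb (ex_intro _ m bm); rewrite szcE.
Qed.
End Irreducibility.


Section Classification.
Variables (K : numClosedFieldType) (alpha e sigma delta : K).
Variables (F : {poly {poly K}}) (l : {poly K}).
Hypotheses (irrF : irreducible_elt F) (monF : F \is monic) (szF : (1 < size F)%N)
  (cF : is_cofactor 'X (lienardQ alpha e sigma delta) F l%:P).

Let a : K := shift_a alpha.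
Let b := shift_b alpha sigma.
Let kappa := shift_kappa alpha e.
Let r := shift_r alpha sigma delta.
Let q : {poly K} := cubic_q a b.
Let S := shifted alpha sigma F.
Let H := inx alpha sigma F.

Lemma irreducible_shift_factor (T : {poly {poly K}}) (p : {poly K}) : S = T * ('X + p%:P) -> size F = 2%N.
Proof.
move=> e0; have FE : F = (T \Po ('X + q%:P)) * ('X + (q + p)%:P).
  have -> : F = S \Po ('X + q%:P).
    by have := comp_shiftK F (- q); rewrite opprK polyCN => ->.
  rewrite e0 comp_polyM comp_polyD comp_polyX comp_polyC. 
  by rewrite (polyCD q p) addrA.
case: irrF => _ _ /(_ _ _ FE)[] /unit_poly2 sz; last by rewrite size_XaddC in sz.
rewrite FE size_Mmonic ?monicXaddC ?sz ?size_XaddC //.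
by rewrite -size_poly_gt0 sz.
Qed.

Lemma shifted_root (v : K) : (forall i, root H`_i v) -> size F = 2%N.
Proof.
move=> rt; have : root S v%:P.
  rewrite rootE horner_polyC; apply/eqP/polyP => i; rewrite coef0 coef_map_id0 ?horner_evalE ?horner0 //.
  exact/eqP/rt.
move=> /factor_theorem[T]; rewrite -polyCN; exact: irreducible_shift_factor.
Qed.

Let eqH :
  ('X%:P - ('X^3 + (3 / 2)%:P * 'X^2 + a%:P * 'X + b%:P : {poly K})^:P) * H^`() +
  (((3 *: 'X - (5 / 2)%:P) ^:P) * 'X%:P + (kappa *: 'X^2 + r%:P) ^:P) * dx H = l^:P * H.
Proof. exact: inx_eq cF. Qed.

Let monS : S \is monic.
Proof. by rewrite /S /shifted -polyCN monic_comp_shift. Qed.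

Let szS : size S = size F.
Proof. by rewrite /S /shifted -polyCN size_comp_shift. Qed.

Let nzH : H != 0.
Proof. by rewrite swapXY_eq0 monic_neq0. Qed.

Let szl : (size l <= 3)%N.
Proof. exact: inx_size eqH nzH. Qed.

Let coefH i j : (H`_i)`_j = (S`_j)`_i. Proof. by rewrite coef_swapXY. Qed.

Let lamE : l = (l`_2)%:P * 'X^2 + (l`_1)%:P * 'X + (l`_0)%:P.
Proof.
apply/polyP => j; rewrite !coefD !coefCM !coefXn coefX coefC.
case: j => [|[|[|j]]]; rewrite /= ?(mulr1n, mulr0n, mulr0, mulr1, addr0, add0r) //.
by rewrite nth_default // (leq_trans szl).
Qed.

(* the degree of H in x *)
Lemma shifted_cases : size F = 2%N \/ [/\ kappa = 0, size H = 4%N & l`_2 = -3].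
Proof.
case szE: (size F) szF => [|[|N]] // _; have l2 := inx_top eqH nzH szl.
have [szf f2] := lienard_f alpha; have szG := lienard_G e sigma delta.
have szH : (size H).-1.+1 = size H by rewrite prednK // size_poly_gt0.
have nat_eq n : l`_2 = - n%:R -> (size H).-1 = n.
  by rewrite l2 => /oppr_inj /eqP; rewrite eqr_nat => /eqP.
have [l0|l3] := cofactor_lead szf f2 szG szl irrF szE monF cF.
  left; rewrite -szE; have H0 : (size H).-1 = 0%N by apply: nat_eq; rewrite oppr0.
  have HC : H = (H`_0)%:P by apply: size1_polyC; rewrite -szH H0.
  have [v rv] : exists v, root H`_0 v.
    apply/closed_rootP; rewrite -(size_map_polyC (H`_0)) -swapXY_polyC -HC swapXYK szS szE //.
  apply: (shifted_root (v := v)) => i; rewrite HC coefC; case: (i == 0%N) => //.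
  by rewrite root0.
have H4 : size H = 4%N by rewrite -szH (nat_eq 3).
have [k0|k0] := eqVneq kappa 0; first by right.
left; have lin := inx_linear eqH szl (eq_leq H4) l3 k0.
have : (size S <= 2)%N.
  by apply/leq_sizeP => j j2; apply/polyP => i; rewrite -coefH coef0 nth_default // (leq_trans (lin i)).
by rewrite szS szE; case: N {szE}.
Qed.

Theorem monic_curves : lienard_list alpha e sigma delta F l%:P.
Proof.
have [szF2|[k0 szH l2]] := shifted_cases; first exact: linear_curves.
have [szF2|szF2] := eqVneq (size F) 2%N; first exact: linear_curves.
have [N szE] : exists N, size F = N.+3 by exists (size F - 3)%N; move: szF szF2; clear; move: (size F) => x; lia.
have [eB eC eD e1 e0] := inx_cubic eqH szl (eq_leq szH) l2 k0.
have lead1 : S`_N.+2 = 1 by move: monS; rewrite monicE lead_coefE szS szE => /eqP.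
have szi i : (0 < i)%N -> (size (H`_i)%R <= N.+2)%N.
  move=> i0; apply/leq_sizeP => j; rewrite leq_eqVlt coefH => /orP[/eqP<-|lt].
    by rewrite lead1 coefC eqn0Ngt i0.
  by rewrite [S`_j]nth_default ?coef0 // szS szE.
have D1 : (H`_0)`_N.+2 = 1 by rewrite coefH lead1 coefC.
have szD : (size (H`_0)%R <= N.+3)%N.
  by apply/leq_sizeP => j lt; rewrite coefH [S`_j]nth_default ?coef0 // szS szE.
have szA := szi 3 isT; have szB := szi 2 isT; have szC := szi 1%N isT.
set A := H`_3 in eB eC eD szA; set B := H`_2 in eB eC eD e1 szB.
set C := H`_1 in eC eD e1 e0 szC; set D := H`_0 in eD e1 e0 D1 szD.
pose A' := revc N.+1 A.
have rX1 := recX1 szA szB szC D1 szD eB eC eD e1 e0.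
have rX0 := recX0 szA szB szC D1 szD eB eC eD e1 e0.
have rB := recB szA szB szC D1 eB eD e1.
have rC := recC szA szB szC D1 szD eB eC eD e1 e0.
have rD := recD szA szB szC D1 szD eB eC eD e1 e0.
have l0v := l0E szA szB szC D1 szD eB eC eD e1 e0.
have l1v := l1E szA szB szC D1 eB eD e1.
have A0 : A' 0%N = 1 by rewrite /A' /revc subn0 (lead_A szA szB szC D1 eD) opprK.
have Aout : A' N.+2 = 0 by rewrite /A' /revc ltnn.
rewrite -/A' in rX1 rX0 rB rC rD.
have [r0|r0] := eqVneq r 0.
  have Az := A_eq0 A0 rX1 rX0 r0 (_ : r * N.+1%:R = 0); rewrite r0 mul0r in Az rC rD.
  have {}Az := Az erefl.
  apply: linear_curves => //; apply: (shifted_root (v := 0)) => i.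
  have rt (p : {poly K}) : revc N.+1 p N.+1 = 0 -> root p 0.
    by rewrite /revc leqnn subnn rootE horner_coef0 => /eqP; rewrite oppr_eq0.
  have CE : Cj a 0 0 A' N.+1 = 0 by rewrite /Cj /rr Az mulr0 mulr0 addr0 mul0r mul0r subrr.
  have BE : Bj A' N.+1 = 0 by rewrite /Bj Az mulr0.
  case: i => [|[|[|[|i]]]]; last by rewrite [H`_i.+4]nth_default ?root0 // szH.
  - by apply: rt; rewrite rD /Dj CE BE !Az /rr /=; ring.
  - by apply: rt; rewrite rC.
  - by apply: rt; rewrite rB.
  by apply: rt; rewrite -/A'.
have rN0 : r * N.+1%:R != 0 by rewrite mulf_neq0 // pnatr_eq0.
have FE : F = curve a b r N.+1 A'.
  have -> : F = S \Po ('X + q%:P) by have := comp_shiftK F (- q); rewrite opprK polyCN => ->.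
  rewrite /curve; congr (_ \Po _); rewrite -[LHS]swapXYK; congr swapXY; rewrite -/H /rec_inx.
  rewrite -(unrevE szA (fun _ => erefl)) -(unrevE szB rB) -(unrevE szC rC).
  have <- : D = 'X^(N.+2) + unrev N.+1 (Dj a b r (r * N.+1%:R) A').
    apply/polyP => j; rewrite coefD coefXn coef_poly; case: (ltngtP j N.+2) => jN.
    - by rewrite add0r -rD /revc leq_subr subKn // opprK.
    - by rewrite addr0 nth_default // (leq_trans szD).
    by rewrite jN D1 addr0.
  apply/polyP => i; rewrite /cubic_inx !coefD !coefCM !coefXn coefX coefC.
  case: i => [|[|[|[|i]]]]; rewrite /= ?(mulr1n, mulr0n, mulr0, mulr1, addr0, add0r) //.
  by rewrite nth_default // szH.
have aE : alpha = a + 5 / 2 by rewrite /a /shift_a subrK.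
have eE : e = 45 / 4 - 3 * alpha by apply: (eq_mod (c := -1) k0); rewrite /kappa /shift_kappa; ring.
have sE : sigma = 5 / 2 * a - 3 * b by rewrite /b /shift_b -/a; field.
have dE : delta = 5 / 2 * b - r by rewrite /r /shift_r -/b; ring.
rewrite lamE l2 l1v l0v; clearbody A'.
case: (rN_solution A0 rX1 rX0 rN0 erefl).
- case=> NE ha hb hr hA; subst N; rewrite ha hb hr in FE; rewrite ha in aE.
  rewrite ha hb in sE; rewrite hb hr in dE; rewrite FE curve_F3 //.
  rewrite (_ : _%:P = lam3 K); last first.
    rewrite /lam3 ha; congr (_%:P); apply: poly_ext => x.
    by rewrite !(hornerD, hornerN, hornerM, hornerZ, hornerX, hornerC, hornerXn); field.
  by apply: Curve3; rewrite ?eE ?sE ?dE ?aE; field.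
- case=> NE ha hb hr hA; subst N; rewrite ha hb hr in FE; rewrite ha in aE.
  rewrite ha hb in sE; rewrite hb hr in dE; rewrite FE curve_F4 //.
  rewrite (_ : _%:P = lam4 K); last first.
    rewrite /lam4 ha; congr (_%:P); apply: poly_ext => x.
    by rewrite !(hornerD, hornerN, hornerM, hornerZ, hornerX, hornerC, hornerXn); field.
  by apply: Curve4; rewrite ?eE ?sE ?dE ?aE; field.
- case=> NE ha hb hr hA; subst N; rewrite ha hb hr in FE; rewrite ha in aE.
  rewrite ha hb in sE; rewrite hb hr in dE; rewrite FE curve_F5 //.
  rewrite (_ : _%:P = lam5 K); last first.
    rewrite /lam5 ha; congr (_%:P); apply: poly_ext => x.
    by rewrite !(hornerD, hornerN, hornerM, hornerZ, hornerX, hornerC, hornerXn); field.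
  by apply: Curve5; rewrite ?eE ?sE ?dE ?aE; field.
- case=> NE ha hb hr hA; subst N; rewrite ha hb hr in FE; rewrite ha in aE.
  rewrite ha hb in sE; rewrite hb hr in dE; have A2 : A' 2%N = 52 / 9.
    have := rX1 1%N; rewrite /X1 /Dj /Cj /Bj /rr /= A0 hA ha hb hr => h.
    by apply: (eq_mod (c := 1 / 18) h); field.
  rewrite FE curve_F6 //.
  rewrite (_ : _%:P = lam6 K); last first.
    rewrite /lam6 ha; congr (_%:P); apply: poly_ext => x.
    by rewrite !(hornerD, hornerN, hornerM, hornerZ, hornerX, hornerC, hornerXn); field.
  by apply: Curve6; rewrite ?eE ?sE ?dE ?aE; field.
move=> al; case=> NE quad ha hb hr hA; subst N; rewrite ha hb hr in FE; rewrite ha in aE.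
rewrite ha hb in sE; rewrite hb hr in dE; rewrite FE curve_F7 //.
have alE : alpha = al by rewrite aE; ring.
rewrite (_ : _%:P = lam7 alpha); last first.
  rewrite /lam7 ha -alE; congr (_%:P); apply: poly_ext => x.
  by rewrite !(hornerD, hornerN, hornerM, hornerZ, hornerX, hornerC, hornerXn); field.
by rewrite -alE in quad sE dE *; apply: Curve7; rewrite ?sE ?dE //; field.
Qed.
End Classification.


Section ListedCurves.
Variable K : numFieldType.
Implicit Types (f G l p s w : {poly K}).

Lemma is_cofactor_pointwise f G l (F : {poly {poly K}}) :
  (forall x y, y * (dx F).[y%:P].[x] + (- f.[x] * y + G.[x]) * F^`().[y%:P].[x] = l.[x] * F.[y%:P].[x]) ->
  is_cofactor 'X (- f%:P * 'X + G%:P) F l%:P.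
Proof.
move=> h; apply: poly2_ext => x y.
by rewrite /dy !(hornerD, hornerN, hornerM, hornerX, hornerC).
Qed.

Lemma cofactor_linear f G l p :
  (forall x y, y * p^`().[x] + (- f.[x] * y + G.[x]) = l.[x] * (y + p.[x])) ->
  is_cofactor 'X (- f%:P * 'X + G%:P) ('X + p%:P) l%:P.
Proof.
move=> h; apply: is_cofactor_pointwise => x y.
rewrite !(dxD, dxC, dxX, derivD, derivX, derivC) !(hornerD, hornerX, hornerC) -h.
by ring.
Qed.

Lemma cofactor_quadratic f G l p s :
  (forall x y, y * (p^`().[x] * y + s^`().[x]) + (- f.[x] * y + G.[x]) * (2 * y + p.[x])
     = l.[x] * (y ^+ 2 + p.[x] * y + s.[x])) ->
  is_cofactor 'X (- f%:P * 'X + G%:P) ('X ^+ 2 + p%:P * 'X + s%:P) l%:P.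
Proof.
move=> h; apply: is_cofactor_pointwise => x y.
rewrite !(dxD, dxM, expr2, dxC, dxX, derivD, derivM, derivX, derivC).
by rewrite !(hornerD, hornerM, hornerX, hornerC) -[RHS]h; ring.
Qed.

Lemma cofactor_cubic f G l p s w :
  (forall x y, y * (p^`().[x] * y ^+ 2 + s^`().[x] * y + w^`().[x])
      + (- f.[x] * y + G.[x]) * (3 * y ^+ 2 + 2 * p.[x] * y + s.[x])
     = l.[x] * (y ^+ 3 + p.[x] * y ^+ 2 + s.[x] * y + w.[x])) ->
  is_cofactor 'X (- f%:P * 'X + G%:P) ('X ^+ 3 + p%:P * 'X ^+ 2 + s%:P * 'X + w%:P) l%:P.
Proof.
move=> h; apply: is_cofactor_pointwise => x y.
rewrite !(dxD, dxM, exprS, expr0, mulr1, dxC, dxX, derivD, derivM, derivX, derivC).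
by rewrite !(hornerD, hornerM, hornerX, hornerC) -[RHS]h; ring.
Qed.

Ltac eval_curve := rewrite !(derivD, derivN, derivZ, derivX, derivXn, derivC);
  rewrite !(hornerD, hornerN, hornerM, hornerZ, hornerMn, hornerX, hornerXn, hornerC) /=.

Lemma cofactor_F1 (alpha e sigma delta : K) : delta = alpha * (e + alpha) / 3 -> sigma = 2 * (e + alpha) / 3 ->
  is_cofactor 'X (lienardQ alpha e sigma delta) (F1 alpha e) (lam1 alpha).
Proof.
move=> -> ->; have -> : F1 alpha e = 'X + (- 'X^2 + (1 / 3 * (alpha + e))%:P)%:P.
  by rewrite /F1 polyCD polyCN addrA.
by apply: cofactor_linear => x y; eval_curve; field.
Qed.

Lemma cofactor_F2 (alpha e sigma delta : K) : delta = 25 * alpha / 12 - 5 * sigma / 6 - 125 / 24 ->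
  e = 45 / 4 - 3 * alpha -> is_cofactor 'X (lienardQ alpha e sigma delta) (F2 alpha sigma) (lam2 K).
Proof. by move=> -> ->; apply: cofactor_linear => x y; eval_curve; field. Qed.

Lemma cofactor_F3 : is_cofactor 'X (lienardQ (- (27 / 4)) (63 / 2) (- (9 / 2)) (- (595 / 16))) (F3 K) (lam3 K).
Proof. by apply: cofactor_quadratic => x y; eval_curve; field. Qed.

Lemma cofactor_F4 : is_cofactor 'X (lienardQ (21 / 4) (- (9 / 2)) (- (17 / 2)) (93 / 16)) (F4 K) (lam4 K).
Proof. by apply: cofactor_quadratic => x y; eval_curve; field. Qed.

Lemma cofactor_F5 : is_cofactor 'X (lienardQ (- (65 / 12)) (55 / 2) (- (185 / 18)) (- ((11 * 1000 + 825) / 432))) (F5 K) (lam5 K).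
Proof. by apply: cofactor_quadratic => x y; eval_curve; field. Qed.

Lemma cofactor_F6 : is_cofactor 'X (lienardQ (9 / 4) (9 / 2) (- (39 / 2)) (145 / 16)) (F6 K) (lam6 K).
Proof. by apply: cofactor_cubic => x y; eval_curve; field. Qed.

Lemma cofactor_F7 (al : K) : al ^+ 2 - 4975 / 486 * al + 4225 / 144 = 0 ->
  is_cofactor 'X (lienardQ al (45 / 4 - 3 * al) (al / 9 - 15 / 4)
    ((5 * 1000 + 101) * al / (14 * 1000 + 580) + 193 / 54)) (F7 al) (lam7 al).
Proof.
move=> quad; apply: cofactor_quadratic => x y; eval_curve.
by apply: (eq_mod (c := 4 / 3 * x ^+ 3 - 110 / 81 * x ^+ 2 + 523 / 1215 * x - 91 / 486) quad); field.
Qed.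
End ListedCurves.


Section CurveIrreducible.
Variable K : numClosedFieldType.

Lemma coef_cubic_inx (A B C D : {poly K}) i : (cubic_inx A B C D)`_i = nth 0 [:: D; C; B; A] i.
Proof.
rewrite /cubic_inx !coefD !coefCM !coefXn coefX coefC.
by case: i => [|[|[|[|i]]]]; rewrite /= ?(mulr1n, mulr0n, mulr0, mulr1, addr0, add0r) // nth_nil.
Qed.

Lemma size_unrev N (f : nat -> K) : (size (unrev N f) <= N.+1)%N.
Proof. exact: size_poly. Qed.

Lemma swap_rec_inx (a b r : K) N A :
  (swapXY (rec_inx a b r N A) \is monic) * (size (swapXY (rec_inx a b r N A)) = N.+2).
Proof.
pose S := swapXY (rec_inx a b r N A).
have cS j : (N < j)%N -> S`_j = ((j == N.+1)%:R : K)%:P.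
  move=> Nj; apply/polyP => i; rewrite coef_swapXY coef_cubic_inx coefC.
  case: i => [|[|[|[|i]]]] /=; rewrite ?nth_nil ?coef0 //; last 3 first.
  - by rewrite nth_default // (leq_trans (size_unrev _ _)).
  - by rewrite nth_default // (leq_trans (size_unrev _ _)).
  - by rewrite nth_default // (leq_trans (size_unrev _ _)).
  by rewrite coefD coefXn [(unrev _ _)`__]nth_default ?addr0 // (leq_trans (size_unrev _ _)).
have szS : size S = N.+2.
  apply/eqP; rewrite eqn_leq; apply/andP; split.
    by apply/leq_sizeP => j lt; rewrite cS 1?ltnW // gtn_eqF.
  rewrite ltnNge; apply/negP => /leq_sizeP/(_ N.+1 (leqnn _)).
  by rewrite cS // eqxx => /eqP; rewrite oner_eq0.
have mS : S \is monic by rewrite monicE lead_coefE szS cS //= eqxx.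
by [].
Qed.

Lemma curve_irreducible (a b r : K) N A : A 0%N = 1 ->
  (forall v, (unrev N A).[v] = 0 -> (unrev N (Bj A)).[v] != 0) -> irreducible_elt (curve a b r N A).
Proof.
move=> A0 noroot; have [mS szS] := swap_rec_inx a b r N A.
apply: irreducible_shift => //; first by rewrite szS.
apply: (irreducible_swap (N := N)) => //.
- by apply/leq_sizeP => -[|[|[|[|i]]]] // _; rewrite coef_cubic_inx nth_default.
- by rewrite coef_cubic_inx /= coef_poly ltnSn subnn A0 oppr_eq0 oner_eq0.
by move=> v; rewrite !coef_cubic_inx /= => /eqP/noroot; rewrite rootE.
Qed.

Lemma curve1_irreducible (a b r : K) A : A 0%N = 1 -> A 1%N != 0 -> irreducible_elt (curve a b r 1 A).
Proof.
move=> A0 A1; apply: curve_irreducible => // v; rewrite !horner_unrev1 /Bj A0 => e.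
have vE : v = - A 1%N by apply: (eq_mod (c := -1) e); ring.
rewrite vE (_ : - _ = - 3 * A 1%N); last by field.
by rewrite mulf_neq0 // oppr_eq0 pnatr_eq0.
Qed.

Lemma curve2_irreducible (a b r : K) A : A 0%N = 1 -> A 1%N != 0 -> A 2%N != 0 ->
  4 * A 2%N != A 1%N ^+ 2 -> irreducible_elt (curve a b r 2 A).
Proof.
move=> A0 A1 A2 A12; apply: curve_irreducible => // v; rewrite !horner_unrev2 /Bj A0 => e.
apply/eqP => e'.
have vE : A 1%N * v = - 2 * A 2%N.
  apply: (eq_mod (c := 1) (_ : 5 / 6 * 0 - 1 / 3 * 0 = 0)); first by rewrite !mulr0 subrr.
  by rewrite -{1}e -e'; field.
have : A 2%N * (4 * A 2%N - A 1%N ^+ 2) = 0.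
  have -> : A 2%N * (4 * A 2%N - A 1%N ^+ 2) = (- 2 * A 2%N) ^+ 2 + A 1%N ^+ 2 * (- 2 * A 2%N) + A 1%N ^+ 2 * A 2%N by ring.
  by rewrite -vE -[RHS](mulr0 (- A 1%N ^+ 2)) -e; ring.
by move/eqP; rewrite mulf_eq0 (negbTE A2) subr_eq0 (negbTE A12).
Qed.
End CurveIrreducible.

Section Main.
Variables (K : numClosedFieldType) (alpha e sigma delta : K).
Implicit Types (F lam : {poly {poly K}}) (c : K).

Lemma const2_unit c : c != 0 -> (c%:P%:P : {poly {poly K}}) \is a GRing.unit.
Proof. by move=> c0; do 2!rewrite poly_unitE size_polyC coefC ?polyC_eq0 c0 /=; rewrite unitfE. Qed.

Lemma irreducible_scale c F : c != 0 -> irreducible_elt F -> irreducible_elt (c%:P%:P * F).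
Proof.
move=> c0 [F0 Fu irr]; have cu := const2_unit c0.
split; first by rewrite mulf_neq0 // !polyC_eq0.
  by rewrite unitrMr.
move=> b d e0; have : F = (c%:P%:P^-1 * b) * d by rewrite -mulrA -e0 mulKr.
by move=> /irr[]; [rewrite unitrMr ?unitrV // => ?; left | right].
Qed.

Lemma cofactor_scale c P Q F lam : is_cofactor P Q F lam -> is_cofactor P Q (c%:P%:P * F) lam.
Proof.
move=> cF; rewrite /is_cofactor dxM dxC derivC polyC0 mul0r add0r /dy derivM derivC mul0r add0r.
transitivity (c%:P%:P * (P * dx F + Q * dy F)); first by rewrite /dy; ring.
by rewrite cF; ring.
Qed.

Let nz n : n.+1%:R != 0 :> K. Proof. by rewrite pnatr_eq0. Qed.

Lemma lienard_list_curve F lam : lienard_list alpha e sigma delta F lam ->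
  irreducible_elt F /\ is_cofactor (lienardP K) (lienardQ alpha e sigma delta) F lam.
Proof.
case=> [hd hs|hd he|ha he hd hs|ha he hd hs|ha he hd hs|ha he hd hs|quad he hd hs].
- split; last exact: cofactor_F1.
  have -> : F1 alpha e = 'X + (- 'X^2 + (1 / 3 * (alpha + e))%:P)%:P by rewrite /F1 polyCD polyCN addrA.
  by apply: irreducible_linear; rewrite ?monicXaddC ?size_XaddC.
- split; last exact: cofactor_F2.
  by apply: irreducible_linear; rewrite ?monicXaddC ?size_XaddC.
- split; last by rewrite ha he hd hs; exact: cofactor_F3.
  rewrite -(curve_F3 (A := nth 0 [:: 1; 7 / 3])) //.
  by apply: curve1_irreducible => //=; rewrite mulf_neq0 ?invr_eq0 ?nz.
- split; last by rewrite ha he hd hs; exact: cofactor_F4.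
  rewrite -(curve_F4 (A := nth 0 [:: 1; 1])) //.
  by apply: curve1_irreducible => //=; rewrite oner_neq0.
- split; last by rewrite ha he hd hs; exact: cofactor_F5.
  rewrite -(curve_F5 (A := nth 0 [:: 1; 25 / 9])) //.
  by apply: curve1_irreducible => //=; rewrite mulf_neq0 ?invr_eq0 ?nz.
- split; last by rewrite ha he hd hs; exact: cofactor_F6.
  rewrite -(curve_F6 (A := nth 0 [:: 1; 8 / 3; 52 / 9])) //.
  apply: curve2_irreducible => //=; rewrite ?mulf_neq0 ?invr_eq0 ?nz //.
  rewrite -subr_eq0 (_ : _ - _ = 16); first exact: nz.
  by field.
split; last by rewrite he hd hs; exact: cofactor_F7.
rewrite -(curve_F7 (A := nth 0 [:: 1; 5 / 4 - 13 / 81 * alpha])) //.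
apply: curve1_irreducible => //=; apply/eqP => a0.
have aE : alpha = 405 / 52 by apply: (eq_mod (c := - (81 / 13)) a0); field.
have : 125%:R ^+ 2 / 39%:R ^+ 2 = 0 :> K by rewrite -[RHS]quad aE; field.
by apply/eqP; rewrite mulf_neq0 ?invr_eq0 ?expf_neq0 ?nz.
Qed.

Theorem classification F lam :
  [/\ irreducible_elt F, invariant_curve (lienardP K) (lienardQ alpha e sigma delta) F &
      is_cofactor (lienardP K) (lienardQ alpha e sigma delta) F lam] <->
  exists c, c != 0 /\ exists F0, lienard_list alpha e sigma delta F0 lam /\ F = c%:P%:P * F0.
Proof.
split=> [[irrF [ncF _] cF]|[c [c0 [F0 [/lienard_list_curve[irr0 cof0] ->]]]]]; last first.
  have irr := irreducible_scale c0 irr0; have cof := cofactor_scale c cof0.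
  split=> //; split; last by exists lam.
  case=> k kE; case: irr; rewrite kE !polyC_eq0 => k0.
  by rewrite (const2_unit k0).
have nzF : F != 0 by case: irrF.
have [c [l [c0 lE lcF]]] := cofactor_shape nzF cF.
have ci0 : c^-1 != 0 by rewrite invr_eq0.
exists c; split=> //; exists (c^-1%:P%:P * F); split; last first.
  by rewrite mulrA -!polyCM divff // mul1r.
rewrite lE in cF *; apply: monic_curves.
- exact: irreducible_scale.
- by rewrite monicE lead_coefM lead_coefC lcF -polyCM mulVf.
- rewrite mul_polyC size_scale ?polyC_eq0 // ltnNge; apply/negP => sz; apply: ncF; exists c.
  by rewrite [LHS](size1_polyC sz) -lcF lead_coefE; case: (size F) sz => [|[]].
exact: cofactor_scale.
Qed.
End Main.


Theorem theorem4p1 (R : realType) (alpha e sigma delta : R[i])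
    (F lam : {poly {poly R[i]}}) :
  [/\ irreducible_elt F,
      invariant_curve (lienardP R[i]) (lienardQ alpha e sigma delta) F &
      is_cofactor (lienardP R[i]) (lienardQ alpha e sigma delta) F lam]
  <->
  exists c : R[i], c != 0 /\
    exists F0 : {poly {poly R[i]}},
      lienard_list alpha e sigma delta F0 lam /\ F = c%:P%:P * F0.
Proof. exact: classification. Qed.
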